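(* Let $G$ and $H$ be finitely generated nilpotent groups with $G\equiv H$. Then: (a) there is a group monomorphism $\phi:G\to H$ whose image has finite index in $H$; (b) for every addition $G_0$ of $G$ there is an addition $H_0$ of $H$ with $G_0\cong H_0$ and $G/G_0\cong H/H_0$; (c) $Is(G')\cong Is(H')$; (d) $G/Is(G')\cong H/Is(H')$; (e) $Is(G'\cdot Z(G))/(Is(G')\cdot Z(G))\cong Is(H'\cdot Z(H))/(Is(H')\cdot Z(H))$.
   Context: For a subgroup $N$ of a group $G$, $Is(N)=\{x\in G:\ x^k\in N \text{ for some integer } k\ge1\}$ is its isolator. $G'$ is the commutator subgroup and $Z(G)$ the center. With $I(G)=Is(G')\cap Z(G)$, an addition of $G$ is a subgroup $G_0\le Z(G)$ such that $Z(G)=G_0\times I(G)$. $\equiv$ denotes elementary equivalence in the first-order language of groups. *)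

(* Defs.v *)
From Stdlib Require Import List Arith.
Import ListNotations.
Set Implicit Arguments.

Record group := Group {
  carrier :> Type;
  mul : carrier -> carrier -> carrier;
  one : carrier;
  inv : carrier -> carrier;
  mulA : forall x y z, mul x (mul y z) = mul (mul x y) z;
  mul1g : forall x, mul one x = x;
  mulVg : forall x, mul (inv x) x = one
}.
Arguments mul {g}.
Arguments one {g}.
Arguments inv {g}.

Section GroupNotions.
Variable G : group.

Fixpoint gpow (x : G) (n : nat) : G :=
  match n with 0 => one | S n => mul x (gpow x n) end.

Inductive gen (S : G -> Prop) : G -> Prop :=
| gen_in : forall x, S x -> gen S x
| gen_one : gen S one
| gen_mul : forall x y, gen S x -> gen S y -> gen S (mul x y)
| gen_inv : forall x, gen S x -> gen S (inv x).

Definition is_subgroup (A : G -> Prop) : Prop :=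
  A one /\ (forall x y, A x -> A y -> A (mul x y)) /\ (forall x, A x -> A (inv x)).

Definition comm (x y : G) : G := mul (inv x) (mul (inv y) (mul x y)).

Definition derived : G -> Prop := gen (fun z => exists x y, z = comm x y).

Definition center (z : G) : Prop := forall x, mul z x = mul x z.

Definition isolator (N : G -> Prop) (x : G) : Prop :=
  exists k, 1 <= k /\ N (gpow x k).

Definition setprod (A B : G -> Prop) (z : G) : Prop :=
  exists a b, A a /\ B b /\ z = mul a b.

Definition IG (z : G) : Prop := isolator derived z /\ center z.

Definition addition (G0 : G -> Prop) : Prop :=
  is_subgroup G0 /\
  (forall z, G0 z -> center z) /\
  (forall z, center z <-> setprod G0 IG z) /\
  (forall z, G0 z -> IG z -> z = one).

(* lower central series: gamma_1 = G (index 0 here), gamma_{i+1} = [gamma_i, G] *)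
Fixpoint lcs (n : nat) : G -> Prop :=
  match n with
  | 0 => fun _ => True
  | S n => gen (fun z => exists x y, lcs n x /\ z = comm x y)
  end.

Definition nilpotent : Prop := exists c, forall x, lcs c x -> x = one.

Definition fin_gen : Prop := exists l : list G, forall x, gen (fun y => In y l) x.

Definition finite_index (A : G -> Prop) : Prop :=
  exists l : list G, forall h, exists r a, In r l /\ A a /\ h = mul r a.

Definition coset_of (A B : G -> Prop) := 
  { S : G -> Prop | exists a, A a /\ S = (fun x => B (mul (inv a) x)) }.

End GroupNotions.

Arguments gen {G}.
Arguments derived {G}.
Arguments center {G}.
Arguments isolator {G}.
Arguments setprod {G}.
Arguments IG {G}.
Arguments addition {G}.
Arguments nilpotent : clear implicits.
Arguments fin_gen : clear implicits.
Arguments finite_index {G}.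
Arguments is_subgroup {G}.
Arguments coset_of {G}.

Definition is_hom (G H : group) (f : G -> H) : Prop :=
  forall x y, f (mul x y) = mul (f x) (f y).

Definition sub_iso (G : group) (A : G -> Prop) (H : group) (B : H -> Prop) : Prop :=
  exists f : G -> H,
    (forall x, A x -> B (f x)) /\
    (forall x y, A x -> A y -> f (mul x y) = mul (f x) (f y)) /\
    (forall x y, A x -> A y -> f x = f y -> x = y) /\
    (forall y, B y -> exists x, A x /\ f x = y).

(* isomorphism between quotients A/B (B normal in A <= G) and C/D (D normal in C <= H):
   a bijection between the sets of cosets preserving the (set-product) coset multiplication *)
Definition quot_iso (G : group) (A B : G -> Prop) (H : group) (C D : H -> Prop) : Prop :=
  exists phi : coset_of A B -> coset_of C D,
    (forall S T, phi S = phi T -> S = T) /\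
    (forall U, exists S, phi S = U) /\
    (forall S T U : coset_of A B,
        (forall z, setprod (proj1_sig S) (proj1_sig T) z <-> proj1_sig U z) ->
        (forall z, setprod (proj1_sig (phi S)) (proj1_sig (phi T)) z <-> proj1_sig (phi U) z)).

Inductive term := tvar (n : nat) | tone | tmul (t u : term) | tinv (t : term).

Inductive formula :=
| feq (t u : term)
| fnot (p : formula)
| fand (p q : formula)
| for_ (p q : formula)
| fimp (p q : formula)
| fall (n : nat) (p : formula)
| fex (n : nat) (p : formula).

Fixpoint teval (G : group) (e : nat -> G) (t : term) : G :=
  match t with
  | tvar n => e n
  | tone => one
  | tmul t u => mul (teval G e t) (teval G e u)
  | tinv t => inv (teval G e t)
  end.

Arguments teval : clear implicits.
Definition upd (G : group) (e : nat -> G) (n : nat) (a : G) : nat -> G :=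
  fun m => if Nat.eqb m n then a else e m.

Arguments upd : clear implicits.
Fixpoint sat (G : group) (e : nat -> G) (p : formula) : Prop :=
  match p with
  | feq t u => teval G e t = teval G e u
  | fnot p => ~ sat G e p
  | fand p q => sat G e p /\ sat G e q
  | for_ p q => sat G e p \/ sat G e q
  | fimp p q => sat G e p -> sat G e q
  | fall n p => forall a : G, sat G (upd G e n a) p
  | fex n p => exists a : G, sat G (upd G e n a) p
  end.

Fixpoint tfree (n : nat) (t : term) : bool :=
  match t with
  | tvar m => Nat.eqb m n
  | tone => false
  | tmul t u => tfree n t || tfree n u
  | tinv t => tfree n t
  end.

Fixpoint ffree (n : nat) (p : formula) : bool :=
  match p with
  | feq t u => tfree n t || tfree n u
  | fnot p => ffree n p
  | fand p q | for_ p q | fimp p q => ffree n p || ffree n q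
  | fall m p | fex m p => negb (Nat.eqb m n) && ffree n p
  end.

Definition sentence (p : formula) : Prop := forall n, ffree n p = false.

(* G and H are elementarily equivalent: they satisfy the same first-order sentences
   (the environment is irrelevant for sentences). *)
Definition elem_equiv (G H : group) : Prop :=
  forall p, sentence p -> (sat G (fun _ => @one G) p <-> sat H (fun _ => @one H) p).

Definition allG (G : group) : G -> Prop := fun _ => True.
Arguments is_hom {G H}.
Arguments sub_iso {G} A {H}.
Arguments quot_iso {G} A B {H}.

(* Main.v *)
Require Import Defs.
From Stdlib Require Import ssreflect List Arith ZArith Lia Classical ClassicalEpsilon.
From Stdlib Require Import FunctionalExtensionality PropExtensionality ProofIrrelevance.
Import ListNotations.
Set Implicit Arguments.
Unset Strict Implicit.
Unset Printing Implicit Defensive.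
Set Bullet Behavior "None".

Arguments comm {G} x y.
Arguments gpow {G} x n.
Arguments lcs {G} n _.
Arguments gen_in {G S x} _.
Arguments gen_one {G S}.
Arguments gen_mul {G S x y} _ _.
Arguments gen_inv {G S x} _.
Arguments mulA {g}.
Arguments mul1g {g}.
Arguments mulVg {g}.
Arguments sat {G} e p.
Arguments teval {G} e t.
Arguments upd {G} e n a _.

(** The commutator induces a nondegenerate pairing of [Z2(K)/Z(K)] with [K].  The center [S] of the
ring of its self-adjoint maps is a commutative ring, finitely generated as an abelian group, whose
elements are coded by tuples of [K], uniformly in [K].  In [G] the [S]-module [Z2/Z] has a filtration
with steps [S a_i] modulo the previous one and annihilators prime, so that for each monic integer
polynomial [f] the values [s a_i] with [f(s) = 0] fall into finitely many cosets of the previous step;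
these are named by words in generators of [G].  In [H], additive generators of [S] are roots of monic
integer polynomials, hence a tuple of [H] with the same first-order properties generates [Z2(H)]
modulo [Z(H)].  By induction through [K/Z(K)], some tuple of [H] that satisfies the defining relations
of [G] generates [H] modulo [Z(H)], which gives [p : G -> H] with [H = p(G) Z(H)]; congruence
conditions on the center make the exponent of [Z(H)/p(Z(G))] congruent to 1 modulo any prescribed
integer.  A homomorphism in the other direction shows that [p] is injective.  Then [p(G') = H'], and
coprimality of exponents gives [p(Is G') = Is H'], from which the remaining statements follow;
for additions, [p] is first corrected by a homomorphism of [G/Is G'] into [I(H)]. *)

(** That a tuple generates a group modulo its center is a statement with an infinite disjunction
    over words, so it cannot be transferred directly. The ring [S] replaces this by finite
    disjunctions: its elements can be quantified over, and a monic polynomial, which may have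
    infinitely many roots in [S], has only finitely many modulo a prime ideal. Nilpotent scalars
    show why primes are needed: all multiples of a scalar of square zero are roots of [t^2].
    Commutativity of [S] is what provides the primes. The transferred condition depends on both
    groups, since the polynomials belong to generators of [S] for [H], while the words naming the
    cosets are found in [G]. The pairing is blind to the center itself; there the finite quotient by
    [m]-th powers is used instead, and this is the origin of the exponent [N]. Taking [m] to be a
    multiple of the exponents of [Is(H')/H'] and of [Is(Is(G')Z(G))/(Is(G')Z(G))] makes [N]
    congruent to 1 modulo both. *)

(** * Group identities, homomorphisms and integer powers *)

Lemma mulgV (K : group) (x : K) : mul x (inv x) = one.
Proof.
have h : mul (inv (inv x)) (inv x) = one by apply: mulVg.
by rewrite -[mul x (inv x)]mul1g -{1}h -mulA [mul (inv x) _]mulA mulVg mul1g.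
Qed.

Lemma mulg1 (K : group) (x : K) : mul x one = x.
Proof. by rewrite -(mulVg x) mulA mulgV mul1g. Qed.

Lemma mulKg (K : group) (x y : K) : mul (inv x) (mul x y) = y.
Proof. by rewrite mulA mulVg mul1g. Qed.

Lemma mulVKg (K : group) (x y : K) : mul x (mul (inv x) y) = y.
Proof. by rewrite mulA mulgV mul1g. Qed.

Lemma mulIg (K : group) (x y z : K) : mul x y = mul x z -> y = z.
Proof. by move=> h; rewrite -(mulKg x y) h mulKg. Qed.

Lemma mulgI (K : group) (x y z : K) : mul y x = mul z x -> y = z.
Proof. by move=> h; rewrite -(mulg1 y) -(mulgV x) mulA h -mulA mulgV mulg1. Qed.

Lemma invg1 (K : group) : inv (@one K) = one.
Proof. by rewrite -[inv one]mulg1 mulVg. Qed.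

Lemma invgK (K : group) (x : K) : inv (inv x) = x.
Proof. by apply: (@mulIg _ (inv x)); rewrite mulgV mulVg. Qed.

Lemma invMg (K : group) (x y : K) : inv (mul x y) = mul (inv y) (inv x).
Proof. by apply: (@mulIg _ (mul x y)); rewrite mulgV -mulA (mulA y) mulgV mul1g mulgV. Qed.

Lemma mulAr (K : group) (x y z : K) : mul (mul x y) z = mul x (mul y z).
Proof. by rewrite mulA. Qed.

(* A complete rewriting system for free groups, so [gs] decides their identities. *)
Ltac gs := rewrite ?(mulAr, mulg1, mul1g, mulVg, mulgV, mulKg, mulVKg, invg1, invgK, invMg).

Lemma eq_invmul (K : group) (x y : K) : mul (inv x) y = one <-> x = y.
Proof.
split=> [h|->]; last by gs.
by rewrite -(mulg1 x) -h; gs.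
Qed.

Lemma eq_mulinv (K : group) (x y : K) : mul x (inv y) = one <-> x = y.
Proof.
split=> [h|->]; last by gs.
by rewrite -(mul1g y) -h; gs.
Qed.

Lemma comm_eq1 (K : group) (x y : K) : comm x y = one <-> mul x y = mul y x.
Proof.
rewrite /comm; split=> h.
- have := f_equal (fun z => mul y (mul x z)) h; by gs.
- by rewrite h; gs.
Qed.

Definition normal (K : group) (N : K -> Prop) :=
  is_subgroup N /\ forall x y, N x -> N (mul (inv y) (mul x y)).

Definition abelian (K : group) := forall x y : K, mul x y = mul y x.

Section Hom.
Variables (K Q : group) (p : K -> Q).
Hypothesis hp : is_hom p.

Lemma hom1 : p one = one.
Proof. by apply: (@mulIg _ (p one)); rewrite -hp; gs. Qed.

Lemma homV x : p (inv x) = inv (p x).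
Proof. by apply: (@mulIg _ (p x)); rewrite -hp; gs; rewrite hom1. Qed.

Lemma hom_comm x y : p (comm x y) = comm (p x) (p y).
Proof. by rewrite /comm !(hp, homV). Qed.

Lemma hom_pow x k : p (gpow x k) = gpow (p x) k.
Proof. by elim: k => [|k ih] /=; rewrite ?hom1 // hp ih. Qed.

Lemma hom_inj : (forall x, p x = one -> x = one) -> forall x y, p x = p y -> x = y.
Proof.
move=> h x y e; apply/eq_invmul; apply: h.
by rewrite hp homV e; gs.
Qed.

Lemma hom_gen (S : K -> Prop) (T : Q -> Prop) :
  (forall x, S x -> gen T (p x)) -> forall x, gen S x -> gen T (p x).
Proof.
move=> h x; elim=> {x}[x /h|| x y _ hx _ hy|x _ hx] //.
- by rewrite hom1; apply: gen_one.
- by rewrite hp; apply: gen_mul.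
- by rewrite homV; apply: gen_inv.
Qed.

Lemma ker_normal : normal (fun x => p x = one).
Proof.
split; first split; first by apply: hom1.
- by split=> [x y hx hy|x hx]; rewrite ?hp ?homV ?hx ?hy; gs.
- by move=> x y hx; rewrite !hp homV hx; gs.
Qed.
End Hom.

Lemma gen_sub (K : group) (S A : K -> Prop) :
  is_subgroup A -> (forall x, S x -> A x) -> forall x, gen S x -> A x.
Proof.
move=> [a1 [aM aV]] h x; elim=> {x}[x /h||x y _ hx _ hy|x _ hx] //; by [apply: aM|apply: aV].
Qed.

Lemma gen_subgroup (K : group) (S : K -> Prop) : is_subgroup (gen S).
Proof.
split; first exact: gen_one.
by split=> [x y|x]; [apply: gen_mul|apply: gen_inv].
Qed.

Lemma gen_mono (K : group) (S T : K -> Prop) :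
  (forall x, S x -> T x) -> forall x, gen S x -> gen T x.
Proof. by move=> h; apply: gen_sub; [apply: gen_subgroup|move=> x /h; apply: gen_in]. Qed.

Lemma gen_trans (K : group) (S T : K -> Prop) :
  (forall x, S x -> gen T x) -> forall x, gen S x -> gen T x.
Proof. by move=> h; apply: gen_sub; [apply: gen_subgroup|]. Qed.

Lemma center_subgroup (K : group) : is_subgroup (@center K).
Proof.
split; first by move=> x; gs.
split=> [x y hx hy z|x hx z].
- by rewrite mulAr hy -mulAr hx; gs.
- by apply: (@mulIg _ x); rewrite mulVKg -mulAr hx; gs.
Qed.

Lemma center_normal (K : group) : normal (@center K).
Proof.
split; first exact: center_subgroup.
by move=> x y hx; rewrite hx; gs.
Qed.

Lemma gpowD (K : group) (x : K) a b : gpow x (a + b) = mul (gpow x a) (gpow x b).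
Proof. by elim: a => [|a ih] /=; gs => //; rewrite ih; gs. Qed.

Lemma gpowSr (K : group) (x : K) a : gpow x (S a) = mul (gpow x a) x.
Proof. by rewrite -Nat.add_1_r gpowD /=; gs. Qed.

Definition gz (K : group) (x : K) (k : Z) : K :=
  match k with
  | Z0 => one
  | Zpos p => gpow x (Pos.to_nat p)
  | Zneg p => inv (gpow x (Pos.to_nat p))
  end.

Lemma gz_nat (K : group) (x : K) (n : nat) : gz x (Z.of_nat n) = gpow x n.
Proof. by case: n => [|n] //; rewrite /gz /= SuccNat2Pos.id_succ. Qed.

Lemma gz_Nnat (K : group) (x : K) (n : nat) : gz x (- Z.of_nat n) = inv (gpow x n).
Proof. by case: n => [|n]; rewrite /gz /= ?SuccNat2Pos.id_succ; gs. Qed.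

Lemma gzS (K : group) (x : K) (k : Z) : gz x (Z.succ k) = mul x (gz x k).
Proof.
have [h|h] : (0 <= k \/ k < 0)%Z by lia.
- rewrite -(Z2Nat.id k h) -Nat2Z.inj_succ !gz_nat //.
- have -> : k = (- Z.of_nat (S (Z.to_nat (- k - 1))))%Z by lia.
  set n := Z.to_nat _.
  have -> : Z.succ (- Z.of_nat (S n)) = (- Z.of_nat n)%Z by lia.
  by rewrite !gz_Nnat gpowSr; gs.
Qed.

Lemma gzD (K : group) (x : K) (a b : Z) : gz x (a + b) = mul (gz x a) (gz x b).
Proof.
have P : forall n : nat, gz x (Z.of_nat n + b) = mul (gz x (Z.of_nat n)) (gz x b).
  elim=> [|n ih]; first by rewrite /=; gs.
  by rewrite Nat2Z.inj_succ Z.add_succ_l !gzS ih; gs.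
have [h|h] : (0 <= a \/ a < 0)%Z by lia.
  by rewrite -(Z2Nat.id a h) P.
have N : forall (n : nat) c, gz x (Z.of_nat n + c) = mul (gpow x n) (gz x c).
  move=> n c; elim: n => [|n ih]; first by rewrite /=; gs.
  by rewrite Nat2Z.inj_succ Z.add_succ_l gzS ih /=; gs.
have -> : a = (- Z.of_nat (Z.to_nat (- a)))%Z by lia.
set n := Z.to_nat _.
rewrite gz_Nnat; apply: (@mulIg _ (gpow x n)); rewrite -N.
by gs; congr gz; lia.
Qed.

Lemma gzN (K : group) (x : K) (a : Z) : gz x (- a) = inv (gz x a).
Proof.
apply: (@mulIg _ (gz x a)); rewrite -gzD; gs.
by have -> : (a + - a = 0)%Z by lia.
Qed.

Lemma gz1 (K : group) (x : K) : gz x 1 = x.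
Proof. by rewrite /gz /=; gs. Qed.

Lemma gzM (K : group) (x : K) (a b : Z) : gz x (a * b) = gz (gz x a) b.
Proof.
have P : forall n : nat, gz x (a * Z.of_nat n) = gpow (gz x a) n.
  elim=> [|n ih]; first by rewrite Z.mul_0_r.
  by rewrite Nat2Z.inj_succ Z.mul_succ_r gzD ih gpowSr.
have [h|h] : (0 <= b \/ b < 0)%Z by lia.
  by rewrite -(Z2Nat.id b h) P gz_nat.
have -> : b = (- Z.of_nat (Z.to_nat (- b)))%Z by lia.
by rewrite Z.mul_opp_r gzN P gz_Nnat.
Qed.

Lemma gz_one (K : group) (a : Z) : gz (@one K) a = one.
Proof.
have P : forall n, gpow (@one K) n = one by elim=> //= n ->; gs.
by case: a => [|p|p] //=; rewrite P; gs.
Qed.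

Lemma gz_hom (K Q : group) (p : K -> Q) x k : is_hom p -> p (gz x k) = gz (p x) k.
Proof. by move=> h; case: k => [|n|n] /=; rewrite ?(homV h) ?(hom_pow h) ?(hom1 h). Qed.

Lemma gpow_sub (K : group) (A : K -> Prop) x n : is_subgroup A -> A x -> A (gpow x n).
Proof. by move=> [a1 [aM aV]] hx; elim: n => //= n ih; apply: aM. Qed.

Lemma gz_sub (K : group) (A : K -> Prop) x k : is_subgroup A -> A x -> A (gz x k).
Proof. by move=> sA hx; case: k => [|n|n] /=; [case: sA|apply: gpow_sub|apply: (proj2 (proj2 sA)); apply: gpow_sub]. Qed.

Lemma gpowMc (K : group) (x y : K) n : mul x y = mul y x ->
  gpow (mul x y) n = mul (gpow x n) (gpow y n).
Proof.
move=> h.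
have c : forall k, mul y (gpow x k) = mul (gpow x k) y.
  elim=> [|k ih] /=; gs => //.
  by rewrite -mulAr -h -ih; gs.
elim: n => [|n ih] /=; gs => //.
by rewrite ih -[mul y (mul _ _)]mulAr c; gs.
Qed.

Lemma gpowV (K : group) (x : K) n : gpow (inv x) n = inv (gpow x n).
Proof.
elim: n => [|n ih]; first by rewrite /=; gs.
by rewrite gpowSr ih /=; gs.
Qed.

Lemma gpowM (K : group) (x : K) a b : gpow x (a * b) = gpow (gpow x a) b.
Proof. by rewrite -!gz_nat Nat2Z.inj_mul gzM. Qed.

Lemma gpow1n (K : group) n : gpow (@one K) n = one.
Proof. by rewrite -gz_nat gz_one. Qed.

Lemma gzMc (K : group) (x y : K) k : mul x y = mul y x ->
  gz (mul x y) k = mul (gz x k) (gz y k).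
Proof.
move=> h.
case: k => [|n|n] /=; [by gs|exact: gpowMc|].
by rewrite h gpowMc // invMg.
Qed.

(** * Subgroups and quotients as groups in their own right *)

Lemma subgroup_group (K : group) (A : K -> Prop) : is_subgroup A ->
  exists (T : group) (i : T -> K), is_hom i /\ (forall x y, i x = i y -> x = y) /\
    (forall t, A (i t)) /\ (forall x, A x -> exists t, i t = x).
Proof.
move=> [a1 [aM aV]].
have inj : forall x y : sig A, proj1_sig x = proj1_sig y -> x = y.
  by move=> [x p] [y q] /= e; apply: subset_eq_compat.
unshelve eexists (@Group (sig A)
  (fun x y => exist _ _ (aM _ _ (proj2_sig x) (proj2_sig y))) (exist _ _ a1)
  (fun x => exist _ _ (aV _ (proj2_sig x))) _ _ _).
- by move=> x y z; apply: inj; rewrite /= mulA.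
- by move=> x; apply: inj; rewrite /= mul1g.
- by move=> x; apply: inj; rewrite /= mulVg.
- exists (@proj1_sig _ _); split; first by [].
  split; first exact: inj.
  split; first by move=> [].
  by move=> x hx; exists (exist _ x hx).
Qed.

Section Quotient.
Variables (K : group) (N : K -> Prop) (hN : normal N).

(** A representative of the coset of [x] that depends only on the coset. The quotient is carried by
    the fixed points of [canon] and so has Leibniz equality. *)
Definition canon (x : K) : K := epsilon (inhabits one) (fun y => N (mul (inv x) y)).

Lemma canonP x : N (mul (inv x) (canon x)).
Proof.
apply: (epsilon_spec (inhabits one) (fun y => N (mul (inv x) y))); exists x; rewrite mulVg.
by case: hN => [[]].
Qed.

Lemma canon_eq x y : canon x = canon y <-> N (mul (inv x) y).
Proof.
case: hN => [[n1 [nM nV]] nJ]; split=> [h|h].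
- have := nM _ _ (canonP x) (nV _ (canonP y)); rewrite h; gs; by gs.
- rewrite /canon; congr epsilon; apply: functional_extensionality => z.
  apply: propositional_extensionality; split=> hz.
  + have -> : mul (inv y) z = mul (inv (mul (inv x) y)) (mul (inv x) z) by gs.
    by apply: nM => //; apply: nV.
  + have -> : mul (inv x) z = mul (mul (inv x) y) (mul (inv y) z) by gs.
    by apply: nM.
Qed.

Lemma canonK x : canon (canon x) = canon x.
Proof. by apply: eq_sym; apply/canon_eq; apply: canonP. Qed.

Definition qcar := { x : K | canon x = x }.
Definition qpi (x : K) : qcar := exist _ (canon x) (canonK x).

Lemma qinj (a b : qcar) : proj1_sig a = proj1_sig b -> a = b.
Proof. by case: a b => [x p] [y q] /= e; apply: subset_eq_compat. Qed.

Lemma qpiK (a : qcar) : qpi (proj1_sig a) = a.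
Proof. by apply: qinj => /=; case: a. Qed.

Lemma qpi_eq x y : qpi x = qpi y <-> N (mul (inv x) y).
Proof.
rewrite -canon_eq; split=> [h|h]; last exact: qinj.
by have := f_equal (@proj1_sig _ _) h.
Qed.

Definition qmul (a b : qcar) := qpi (mul (proj1_sig a) (proj1_sig b)).
Definition qinv (a : qcar) := qpi (inv (proj1_sig a)).

Lemma qmulE x y : qmul (qpi x) (qpi y) = qpi (mul x y).
Proof.
case: hN => [[n1 [nM nV]] nJ].
apply: eq_sym; apply/qpi_eq => /=.
have -> : mul (inv (mul x y)) (mul (canon x) (canon y)) =
   mul (mul (inv y) (mul (mul (inv x) (canon x)) y)) (mul (inv y) (canon y)) by gs.
by apply: nM; [apply: nJ|]; apply: canonP.
Qed.

Lemma qmulA a b c : qmul a (qmul b c) = qmul (qmul a b) c.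
Proof. by rewrite -(qpiK a) -(qpiK b) -(qpiK c) !qmulE mulA. Qed.

Lemma qmul1g a : qmul (qpi one) a = a.
Proof. by rewrite -{1}(qpiK a) qmulE mul1g qpiK. Qed.

Lemma qmulVg a : qmul (qinv a) a = qpi one.
Proof. by rewrite /qinv -{2}(qpiK a) qmulE mulVg. Qed.

Definition quo : group := @Group qcar qmul (qpi one) qinv qmulA qmul1g qmulVg.
Definition proj (x : K) : quo := qpi x.

Lemma proj_hom : is_hom proj.
Proof. by move=> x y; rewrite /proj /= qmulE. Qed.

Lemma proj_eq x y : proj x = proj y <-> N (mul (inv x) y).
Proof. exact: qpi_eq. Qed.

Lemma proj_surj (a : quo) : exists x, proj x = a.
Proof. by exists (proj1_sig a); apply: qpiK. Qed.

Lemma proj1P x : proj x = one <-> N x.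
Proof.
have -> : (@one quo) = proj one by [].
split=> h; first by have := proj1 (proj_eq _ _) (eq_sym h); gs.
by apply: eq_sym; apply/proj_eq; gs.
Qed.
End Quotient.

(** * Noetherian groups *)

Definition fg (K : group) (A : K -> Prop) :=
  exists l : list K, (forall x, In x l -> A x) /\ forall x, A x -> gen (fun y => In y l) x.

Definition noeth (K : group) := forall A : K -> Prop, is_subgroup A -> fg A.

Lemma preimage_list (X Y : Type) (f : X -> Y) (P : X -> Prop) (l : list Y) :
  (forall y, In y l -> exists x, P x /\ f x = y) ->
  exists l', (forall x, In x l' -> P x) /\ map f l' = l.
Proof.
elim: l => [|y l ih] h; first by exists [].
have [x [px fx]] := h y (or_introl eq_refl).
have [l' [h1 h2]] := ih (fun z hz => h z (or_intror hz)).
exists (x :: l'); split; last by rewrite /= fx h2.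
by move=> z [<-|/h1].
Qed.

(** Lifts of generators of the image, together with generators of the part of [B] in the kernel,
    generate [B]: divide an element by a lift of its image. *)
Lemma fg_ext (K Q : group) (p : K -> Q) (B : K -> Prop) :
  is_hom p -> is_subgroup B ->
  fg (fun y => exists x, B x /\ p x = y) -> fg (fun x => B x /\ p x = one) -> fg B.
Proof.
move=> hp sB [l1 [h1 g1]] [l2 [h2 g2]].
have [l [hl el]] := @preimage_list _ _ p B l1 h1.
exists (l ++ l2); split; first by move=> x hx; case: (in_app_or _ _ _ hx) => [/hl|/h2 []].
move=> x bx.
have W : forall y, gen (fun y => In y l1) y -> exists z, gen (fun y => In y (l ++ l2)) z /\ B z /\ p z = y.
  move=> y; elim=> {y}[y|| y z _ [a [ga [ba ea]]] _ [b [gb [bb eb]]]|y _ [a [ga [ba ea]]]].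
  - rewrite -el => /in_map_iff [z [ez iz]]; exists z; split; last by split; [apply: hl|].
    by apply: gen_in; apply: in_or_app; left.
  - exists one; split; first exact: gen_one.
    by split; [case: sB|apply: hom1].
  - exists (mul a b); split; first exact: gen_mul.
    by split; [apply: (proj1 (proj2 sB))|rewrite hp ea eb].
  - exists (inv a); split; first exact: gen_inv.
    by split; [apply: (proj2 (proj2 sB))|rewrite homV // ea].
have [|z [gnz [bz ez]]] := W (p x); first by apply: g1; exists x.
have -> : x = mul z (mul (inv z) x) by gs.
apply: gen_mul => //.
apply: (gen_mono _ (g2 _ _)); first by move=> y hy; apply: in_or_app; right.
split; last by rewrite hp homV // ez; gs.
by apply: (proj1 (proj2 sB)) => //; apply: (proj2 (proj2 sB)).
Qed.

Lemma image_subgroup (K Q : group) (p : K -> Q) (B : K -> Prop) :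
  is_hom p -> is_subgroup B -> is_subgroup (fun y => exists x, B x /\ p x = y).
Proof.
move=> hp [b1 [bM bV]]; split; first by exists one; rewrite (hom1 hp).
split=> [x y [a [ba <-]] [b [bb <-]]|x [a [ba <-]]].
- by exists (mul a b); rewrite hp; split; [apply: bM|].
- by exists (inv a); rewrite homV //; split; [apply: bV|].
Qed.

Lemma preim_subgroup (K Q : group) (p : K -> Q) (B : Q -> Prop) :
  is_hom p -> is_subgroup B -> is_subgroup (fun x => B (p x)).
Proof.
move=> hp [b1 [bM bV]]; split; first by rewrite (hom1 hp).
by split=> [x y|x]; rewrite ?hp ?(homV hp) => *; [apply: bM|apply: bV].
Qed.

Lemma cap_subgroup (K : group) (A B : K -> Prop) :
  is_subgroup A -> is_subgroup B -> is_subgroup (fun x => A x /\ B x).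
Proof.
move=> [a1 [aM aV]] [b1 [bM bV]]; split=> //.
by split=> [x y [? ?] [? ?]|x [? ?]]; split; auto.
Qed.

Lemma noeth_ext (K Q : group) (p : K -> Q) : is_hom p -> noeth Q ->
  (forall A, is_subgroup A -> (forall x, A x -> p x = one) -> fg A) -> noeth K.
Proof.
move=> hp nQ h B sB; apply: (fg_ext hp sB); first exact/nQ/image_subgroup.
by apply: h => [|x []] //; apply: cap_subgroup => //; case: (ker_normal hp).
Qed.

Lemma fg_trivial (K : group) (A : K -> Prop) : (forall x, A x -> x = one) -> fg A.
Proof. by move=> h; exists []; split=> // x /h ->; apply: gen_one. Qed.

Lemma noeth_inj (K Q : group) (p : K -> Q) : is_hom p -> (forall x, p x = one -> x = one) ->
  noeth Q -> noeth K.
Proof. by move=> hp ip nQ; apply: (noeth_ext hp nQ) => A _ h; apply: fg_trivial => x /h /ip. Qed.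

Lemma noeth_surj (K Q : group) (p : K -> Q) : is_hom p -> (forall y, exists x, p x = y) ->
  noeth K -> noeth Q.
Proof.
move=> hp sp nK A sA.
have [l [h1 h2]] := nK _ (preim_subgroup hp sA).
exists (map p l); split; first by move=> x /in_map_iff [y [<- /h1]].
move=> y ay; have [x ex] := sp y; rewrite -ex in ay *.
have := h2 x ay; apply: (hom_gen hp) => z hz.
by apply: gen_in; apply: in_map.
Qed.

Lemma least_pos (P : nat -> Prop) n : P n -> 0 < n ->
  exists d, 0 < d /\ P d /\ forall m, 0 < m -> P m -> d <= m.
Proof.
elim/lt_wf_ind: n => n ih pn n0.
case: (classic (exists m, 0 < m /\ P m /\ m < n)) => [[m [m0 [pm lm]]]|h]; first exact: (ih m).
exists n; do 2!split=> //.
by move=> m m0 pm; case: (Nat.le_gt_cases n m) => // l; case: h; exists m.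
Qed.

(** Division with remainder by the least positive element of [P], with [d = 0] when [P] holds only
    at 0. *)
Lemma principal (P : Z -> Prop) :
  P 0%Z -> (forall a b, P a -> P b -> P (a + b)%Z) -> (forall a, P a -> P (- a)%Z) ->
  exists d, P d /\ (0 <= d)%Z /\ forall a, P a -> exists q, a = (d * q)%Z.
Proof.
move=> p0 pD pN.
have pM : forall d, P d -> forall q, P (d * q)%Z.
  move=> d pd q.
  have Q : forall n : nat, P (d * Z.of_nat n)%Z.
    elim=> [|n ih]; first by rewrite Z.mul_0_r.
    by rewrite Nat2Z.inj_succ Z.mul_succ_r; apply: pD.
  have [h|h] : (0 <= q \/ q < 0)%Z by lia.
    by rewrite -(Z2Nat.id q h).
  have -> : (d * q = - (d * Z.of_nat (Z.to_nat (- q))))%Z by rewrite Z2Nat.id; lia.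
  exact: pN.
case: (classic (exists a, P a /\ a <> 0%Z)) => [[a [pa a0]]|h]; last first.
  exists 0%Z; do 2!split=> //.
  by move=> a pa; exists 0%Z; apply: NNPP => ha; apply: h; exists a; split=> // e; apply: ha; lia.
have [||d [d0 [pd dm]]] := @least_pos (fun n => P (Z.of_nat n)) (Z.abs_nat a); [|lia|].
  have [e|e] : Z.of_nat (Z.abs_nat a) = a \/ Z.of_nat (Z.abs_nat a) = (- a)%Z by lia.
    by rewrite e.
  by rewrite e; apply: pN.
exists (Z.of_nat d); split=> //; split; first lia.
move=> b pb; exists (b / Z.of_nat d)%Z.
have hb := Z.div_mod b (Z.of_nat d) ltac:(lia).
have hm := Z.mod_pos_bound b (Z.of_nat d) ltac:(lia).
set m := (b mod _)%Z in hb hm.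
have pm : P m.
  have -> : m = (b + - (Z.of_nat d * (b / Z.of_nat d)))%Z by lia.
  by apply: pD => //; apply/pN/pM.
suff : m = 0%Z by lia.
have := dm (Z.to_nat m); rewrite Z2Nat.id; first lia.
by move=> h; case: (Z.eq_dec m 0) => // m0; have := h ltac:(lia) pm; lia.
Qed.

Lemma fg_cyclic (K : group) (g : K) (A : K -> Prop) : is_subgroup A ->
  (forall x, A x -> exists k, x = gz g k) -> fg A.
Proof.
move=> [a1 [aM aV]] h.
have [|||d [pd [_ hd]]] := @principal (fun k => A (gz g k)) => //.
- by move=> a b; rewrite gzD; apply: aM.
- by move=> a; rewrite gzN; apply: aV.
- exists [gz g d]; split; first by move=> x [<-|[]].
  move=> x ax; have [k ek] := h x ax; rewrite ek in ax *.
  have [q ->] := hd _ ax; rewrite gzM.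
  by apply: gz_sub; [apply: gen_subgroup|apply: gen_in; left].
Qed.

Definition cyc (K : group) (g x : K) := exists k, x = gz g k.

Lemma cyc_subgroup (K : group) (g : K) : is_subgroup (cyc g).
Proof.
split; first by exists 0%Z.
split=> [x y [a ->] [b ->]|x [a ->]]; first by exists (a + b)%Z; rewrite gzD.
by exists (- a)%Z; rewrite gzN.
Qed.

Lemma abelian_normal (K : group) (A : K -> Prop) : abelian K -> is_subgroup A -> normal A.
Proof. by move=> ab sA; split=> // x y hx; rewrite (ab x); gs. Qed.

Lemma quo_abelian (K : group) (N : K -> Prop) (hN : normal N) : abelian K -> abelian (quo hN).
Proof.
move=> ab x y; have [a <-] := proj_surj x; have [b <-] := proj_surj y.
by rewrite -!proj_hom ab.
Qed.

(** Divide by the cyclic subgroup of one generator; subgroups of a cyclic group are cyclic. *)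
Lemma noeth_abelian_gen (n : nat) (K : group) (l : list K) : length l = n -> abelian K ->
  (forall x, gen (fun y => In y l) x) -> noeth K.
Proof.
elim: n K l => [|n ih] K [|g l] //= el ab gl.
  move=> A _; apply: fg_trivial => x _.
  by elim: {x}(gl x) => [x []|//|x y _ -> _ ->|x _ ->]; gs.
have hN := abelian_normal ab (cyc_subgroup g).
apply: (noeth_ext (proj_hom hN)).
- apply: (ih _ (map (proj hN) l)); [by rewrite length_map; lia|exact: quo_abelian|].
  move=> y; have [x <-] := proj_surj y; elim: {x}(gl x) => [x||x z _ hx _ hz|x _ hx].
  + move=> [<-|hx]; last by apply: gen_in; apply: in_map.
    suff -> : proj hN g = one by apply: gen_one.
    by apply/proj1P; exists 1%Z; rewrite gz1.
  + exact: gen_one.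
  + by rewrite proj_hom; apply: gen_mul.
  + by rewrite (homV (proj_hom hN)); apply: gen_inv.
- move=> A sA h; apply: (@fg_cyclic _ g) => // x ax.
  by have /proj1P := h x ax.
Qed.
Lemma noeth_abelian (K : group) : fin_gen K -> abelian K -> noeth K.
Proof. by move=> [l gl] ab; apply: (noeth_abelian_gen (l := l)). Qed.

(** * The lower central series; finitely generated nilpotent groups are Noetherian *)

Lemma lcs_subgroup (K : group) n : is_subgroup (@lcs K n).
Proof. by case: n => [|n]; [split|apply: gen_subgroup]. Qed.

Lemma conj_comm (K : group) (x y : K) : mul (inv y) (mul x y) = mul x (comm x y).
Proof. by rewrite /comm; gs. Qed.

Lemma comm_Ml (K : group) (x y z : K) :
  comm (mul x y) z = mul (mul (inv y) (mul (comm x z) y)) (comm y z).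
Proof. by rewrite /comm; gs. Qed.

Lemma comm_Mr (K : group) (x y z : K) :
  comm x (mul y z) = mul (comm x z) (mul (inv z) (mul (comm x y) z)).
Proof. by rewrite /comm; gs. Qed.

Lemma comm_Vl (K : group) (x z : K) : comm (inv x) z = mul (inv (inv x)) (mul (inv (comm x z)) (inv x)).
Proof. by rewrite /comm; gs. Qed.

Lemma comm_Vr (K : group) (x z : K) : comm x (inv z) = mul (inv (inv z)) (mul (inv (comm x z)) (inv z)).
Proof. by rewrite /comm; gs. Qed.

Lemma commV (K : group) (x y : K) : inv (comm x y) = comm y x.
Proof. by rewrite /comm; gs. Qed.

Lemma lcs_comm (K : group) n (x y : K) : lcs n x -> lcs (S n) (comm x y).
Proof. by move=> h; apply: gen_in; exists x, y. Qed.

Lemma lcs_antitone (K : group) n (x : K) : lcs (S n) x -> lcs n x.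
Proof.
elim: n x => [//|n ih] x; apply: gen_mono => z [a [b [ha ->]]].
by exists a, b; split=> //; apply: ih.
Qed.

Lemma lcs_normal (K : group) n : normal (@lcs K n).
Proof.
split; first exact: lcs_subgroup.
move=> x y hx; rewrite conj_comm; apply: (proj1 (proj2 (@lcs_subgroup K n))) => //.
exact/lcs_antitone/lcs_comm.
Qed.

Lemma comml_subgroup (K : group) (M : K -> Prop) (b : K) : normal M -> is_subgroup (fun a => M (comm a b)).
Proof.
move=> [[m1 [mM mV]] mJ]; split.
  by have -> : comm one b = one by rewrite /comm; gs.
split=> [x y hx hy|x hx]; first by rewrite comm_Ml; apply: mM => //; apply: mJ.
by rewrite comm_Vl; apply/mJ/mV.
Qed.

Lemma commr_subgroup (K : group) (M : K -> Prop) (a : K) : normal M -> is_subgroup (fun b => M (comm a b)).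
Proof.
move=> [[m1 [mM mV]] mJ]; split.
  by have -> : comm a one = one by rewrite /comm; gs.
split=> [x y hx hy|x hx]; first by rewrite comm_Mr; apply: mM => //; apply: mJ.
by rewrite comm_Vr; apply/mJ/mV.
Qed.

(** Modulo [lcs (S (S n))] the commutator is additive in each argument, so commutators of generators
    of one layer with generators of [K] generate the next layer. *)
Lemma lcs_fg_mod (K : group) n : fin_gen K ->
  exists l : list K, (forall x, In x l -> lcs n x) /\
    forall x, lcs n x -> gen (fun y => In y l \/ lcs (S n) y) x.
Proof.
move=> [gs ggs]; elim: n => [|n [l [hl gl]]].
  by exists gs; split=> // x _; apply: (gen_mono _ (ggs x)); left.
exists (map (fun p => comm (fst p) (snd p)) (list_prod l gs)).
split.
  move=> x /in_map_iff [[a b] [<- /in_prod_iff [ha hb]]].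
  exact/lcs_comm/hl.
set M := gen _.
have ML x : M x -> lcs (S n) x.
  apply: gen_sub; first exact: lcs_subgroup.
  move=> y [/in_map_iff [[a b] [<- /in_prod_iff [ha hb]]]|]; first exact/lcs_comm/hl.
  exact: lcs_antitone.
have sM : is_subgroup M by apply: gen_subgroup.
have LM x : lcs (S (S n)) x -> M x by move=> h; apply: gen_in; right.
(* Conjugation changes an element of [M] by a commutator in [lcs (S (S n))], which is contained in
   [M]. *)
have nM : normal M.
  split=> // x y hx; rewrite conj_comm; apply: (proj1 (proj2 sM)) => //.
  exact/LM/lcs_comm/ML.
apply: gen_sub => // x [a [b [ha ->]]].
apply: (gen_sub (comml_subgroup b nM) _ (gl a ha)) => {x ha}y [hy|hy]; last exact/LM/lcs_comm.
apply: (gen_sub (commr_subgroup y nM) _ (ggs b)) => z hz.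
apply: gen_in; left; apply/in_map_iff; exists (y, z); split=> //.
exact/in_prod_iff.
Qed.

Lemma lcs_quo (K Q : group) (p : K -> Q) n : is_hom p -> (forall y, exists x, p x = y) ->
  forall y, lcs n y -> exists x, lcs n x /\ p x = y.
Proof.
move=> hp sp; elim: n => [|n ih] y; first by have [x <-] := sp y; exists x.
apply: (gen_sub (image_subgroup hp (lcs_subgroup K (S n)))).
move=> z [a [b [/ih [x [hx <-]] ->]]].
have [w <-] := sp b; exists (comm x w); split; first exact: lcs_comm.
exact: hom_comm.
Qed.

Lemma lcs_hom (K Q : group) (p : K -> Q) n x : is_hom p -> lcs n x -> lcs n (p x).
Proof.
move=> hp; elim: n x => [//|n ih] x; apply: (hom_gen hp) => z [a [b [ha ->]]].
by rewrite hom_comm //; apply/lcs_comm/ih.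
Qed.

Lemma fin_gen_surj (K Q : group) (p : K -> Q) : is_hom p -> (forall y, exists x, p x = y) ->
  fin_gen K -> fin_gen Q.
Proof.
move=> hp sp [l gl]; exists (map p l) => y; have [x <-] := sp y.
apply: (hom_gen hp _ (gl x)) => z hz; apply: gen_in; exact: in_map.
Qed.

(** The last nontrivial layer is central, hence abelian, and it is finitely generated because the
    next layer is trivial; the quotient by it has smaller class. *)
Lemma noeth_nilpotent_class c (K : group) : fin_gen K -> (forall x : K, lcs c x -> x = one) -> noeth K.
Proof.
elim: c K => [|c ih] K fgK hc.
  by move=> A _; apply: fg_trivial => x _; apply: hc.
have nN := lcs_normal K c.
apply: (noeth_ext (proj_hom nN)).
  apply: ih; first exact: (fin_gen_surj (proj_hom nN) (@proj_surj _ _ nN)).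
  move=> y hy; have [x [hx <-]] := lcs_quo (proj_hom nN) (@proj_surj _ _ nN) hy.
  exact/proj1P.
move=> A sA hA.
have cN (x y : K) : lcs c x -> mul x y = mul y x.
  by move=> hx; apply: (proj1 (comm_eq1 x y)); apply: hc; exact: (lcs_comm y hx).
have [T [i [hi [ii [iN sN]]]]] := subgroup_group (lcs_subgroup K c).
have [l [hl gl]] := lcs_fg_mod c fgK.
have nT : noeth T.
  apply: noeth_abelian; last by move=> x y; apply: ii; rewrite !hi cN.
  have [l' [_ el]] := @preimage_list T K i (fun _ => True) l
    (fun y hy => let: ex_intro _ t e := sN y (hl y hy) in ex_intro _ t (conj I e)).
  exists l' => t.
  have P : forall x, gen (fun y => In y l \/ lcs (S c) y) x -> exists t, gen (fun y => In y l') t /\ i t = x.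
    apply: (gen_sub (image_subgroup hi (gen_subgroup _))).
    move=> x [hx|hx]; last by rewrite (hc _ hx); exists one; split; [apply: gen_one|apply: hom1].
    move: hx; rewrite -el => /in_map_iff [s [<- hs]]; exists s; split=> //; exact: gen_in.
  by have [s [hs /ii <-]] := P _ (gl _ (iN t)).
have [m [hm gm]] := nT _ (preim_subgroup hi sA).
exists (map i m); split; first by move=> x /in_map_iff [t [<- /hm]].
move=> x ax; have [t et] : exists t, i t = x by apply: sN; apply/(proj1P nN)/hA.
rewrite -et in ax *; apply: (hom_gen hi _ (gm t ax)) => z hz.
exact/gen_in/in_map.
Qed.

Lemma noeth_nilpotent (K : group) : fin_gen K -> nilpotent K -> noeth K.
Proof. by move=> h [c]; apply: noeth_nilpotent_class. Qed.

Lemma noeth_fin_gen (K : group) : noeth K -> fin_gen K.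
Proof. by move=> /(_ (fun _ => True)) [|l [_ h]] //; exists l => x; apply: h. Qed.

Lemma fg_fin_gen (K T : group) (i : T -> K) : noeth K -> is_hom i -> (forall x y, i x = i y -> x = y) -> noeth T.
Proof. by move=> nK hi ii; apply: (noeth_inj hi _ nK) => x; rewrite -(hom1 hi) => /ii. Qed.

Lemma chain_fg (K : group) (C : nat -> K -> Prop) : noeth K ->
  (forall n, is_subgroup (C n)) -> (forall n x, C n x -> C (S n) x) ->
  exists n, forall m x, C m x -> C n x.
Proof.
move=> nK sC mC.
have mono n k x : C n x -> C (n + k) x.
  by elim: k => [|k ih] h; rewrite ?Nat.add_0_r ?Nat.add_succ_r //; apply/mC/ih.
have mono' n m x : n <= m -> C n x -> C m x.
  by move=> l h; have := mono n (m - n) x h; rewrite (_ : n + (m - n) = m) //; lia.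
have [|l [hl gl]] := nK (fun x => exists n, C n x).
  split; first by exists 0; case: (sC 0).
  split=> [x y [a ha] [b hb]|x [a ha]]; last by exists a; apply: (proj2 (proj2 (sC a))).
  exists (a + b); apply: (proj1 (proj2 (sC _))).
  - by apply: mono' ha; lia.
  - by apply: mono' hb; lia.
have [n hn] : exists n, forall x, In x l -> C n x.
  elim: l hl {gl} => [|y l ih] hl; first by exists 0.
  have [n hn] := ih (fun x h => hl x (or_intror h)).
  have [m hm] := hl y (or_introl eq_refl).
  exists (n + m) => x [<-|/hn h]; first by apply: mono' hm; lia.
  by apply: mono' h; lia.
exists n => m x hx; apply: (gen_sub (sC n) hn); apply: gl; by exists m.
Qed.

(** Induction from above: [P A] may be proved assuming [P] for all strictly larger subgroups. A
    counterexample would start, by dependent choice, a strictly ascending chain. *)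
Lemma noeth_ind (K : group) (P : (K -> Prop) -> Prop) : noeth K ->
  (forall A, is_subgroup A ->
     (forall B, is_subgroup B -> (forall x, A x -> B x) -> (exists x, B x /\ ~ A x) -> P B) -> P A) ->
  forall A, is_subgroup A -> P A.
Proof.
move=> nK h A sA; apply: NNPP => nA.
pose X := {B : K -> Prop | is_subgroup B /\ ~ P B}.
have step : forall B : X, exists C : X, (forall x, proj1_sig B x -> proj1_sig C x) /\
    exists x, proj1_sig C x /\ ~ proj1_sig B x.
  move=> [B [sB nB]]; apply: NNPP => hC; apply/nB/h => // C sC BC [x [cx bx]].
  apply: NNPP => nC; apply: hC.
  by exists (exist _ C (conj sC nC)); split=> //; exists x.
have [f hf] := choice _ step.
pose ch := fix ch n : X := match n with 0 => exist _ A (conj sA nA) | S n => f (ch n) end.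
have [n hn] := @chain_fg _ (fun n => proj1_sig (ch n)) nK
  (fun n => proj1 (proj2_sig (ch n))) (fun n => proj1 (hf (ch n))).
have [x [h1 h2]] := proj2 (hf (ch n)).
by apply/h2/(hn (S n)).
Qed.

(** * Finitely generated abelian groups *)

Lemma mulCA (K : group) (x y z : K) : abelian K -> mul x (mul y z) = mul y (mul x z).
Proof. by move=> ab; rewrite mulA (ab x) mulAr. Qed.

(** Remainders modulo [m] of the exponents of the generators give the list. Finiteness of this
    quotient is what lets a formula describe a center modulo [m]-th powers. *)
Lemma finite_mod_powers (K : group) (m : nat) : fin_gen K -> abelian K -> 0 < m ->
  exists L : list K, forall x, exists w y, In w L /\ x = mul w (gpow y m).
Proof.
move=> [l gl] ab m0.
suff [L hL] : exists L : list K, forall x, gen (fun y => In y l) x -> exists w y, In w L /\ x = mul w (gpow y m).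
  by exists L => x; apply: hL.
elim: l {gl} => [|g l [L hL]].
  exists [one] => x gx; exists one, one; split; first by left.
  have -> : x = one by elim: {x}gx => [x []|//|x y _ -> _ ->|x _ ->]; gs.
  by rewrite gpow1n; gs.
exists (flat_map (fun k => map (fun w => mul (gpow g k) w) L) (List.seq 0 m)) => x gx.
have [k [z [gz' ->]]] : exists k z, gen (fun y => In y l) z /\ x = mul (gz g k) z.
  elim: {x}gx => [x [<-|hx]||x y _ [k [z [hz ->]]] _ [k' [z' [hz' ->]]]|x _ [k [z [hz ->]]]].
  - by exists 1%Z, one; rewrite gz1; gs; split=> //; apply: gen_one.
  - by exists 0%Z, x; rewrite /=; gs; split=> //; apply: gen_in.
  - by exists 0%Z, one; rewrite /=; gs; split=> //; apply: gen_one.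
  - exists (k + k')%Z, (mul z z'); split; first exact: gen_mul.
    by rewrite gzD; gs; rewrite (mulCA z).
  - exists (- k)%Z, (inv z); split; first exact: gen_inv.
    by rewrite gzN invMg; exact: (ab (inv z)).
have [w [y [hw ->]]] := hL z gz'.
have hd := Z.div_mod k (Z.of_nat m) ltac:(lia).
have hm := Z.mod_pos_bound k (Z.of_nat m) ltac:(lia).
exists (mul (gpow g (Z.to_nat (k mod Z.of_nat m))) w), (mul (gz g (k / Z.of_nat m)) y); split.
  apply/in_flat_map; exists (Z.to_nat (k mod Z.of_nat m)); split; last exact: in_map.
  by apply/in_seq; lia.
rewrite {1}hd gzD gpowMc; first exact: ab.
rewrite -!gz_nat Z2Nat.id; first lia.
rewrite -gzM (Z.mul_comm (Z.of_nat m)).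
by gs; rewrite mulCA //; congr mul; rewrite mulCA.
Qed.

Lemma torsion_exponent (K : group) (l : list K) (B : K -> Prop) : abelian K -> is_subgroup B ->
  (forall x, In x l -> exists k, 1 <= k /\ B (gpow x k)) ->
  exists k, 1 <= k /\ forall x, gen (fun y => In y l) x -> B (gpow x k).
Proof.
move=> ab sB h.
have [k [k1 hk]] : exists k, 1 <= k /\ forall x, In x l -> B (gpow x k).
  elim: l h => [|y l ih] h; first by exists 1.
  have [k [k1 hk]] := ih (fun x hx => h x (or_intror hx)).
  have [j [j1 hj]] := h y (or_introl eq_refl).
  exists (k * j); split; first nia.
  move=> x [<-|/hk hx]; first by rewrite Nat.mul_comm gpowM; apply: gpow_sub.
  by rewrite gpowM; apply: gpow_sub.
exists k; split=> //; apply: gen_sub => //.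
split; first by rewrite gpow1n; case: sB.
split=> [x y hx hy|x hx]; first by rewrite gpowMc //; apply: (proj1 (proj2 sB)).
by rewrite gpowV; apply: (proj2 (proj2 sB)).
Qed.
(* If [A = B A^m] then [A/B] is killed by an integer congruent to 1 modulo [m]. *)
Lemma nakayama (K : group) (l : list K) (m : nat) (B : K -> Prop) : abelian K -> is_subgroup B ->
  (forall x, gen (fun y => In y l \/ B y) x) ->
  (forall x, exists b y, B b /\ x = mul b (gpow y m)) ->
  exists q, forall x, B (gz x (1 + Z.of_nat m * q)).
Proof.
move=> ab; elim: l B => [|g l ih] B sB gl hm.
  exists 0%Z => x; rewrite Z.mul_0_r Z.add_0_r gz1.
  by apply: (gen_sub sB _ (gl x)) => y [].
have [b1 [bM bV]] := sB.
pose B' x := exists k b, B b /\ x = mul (gz g k) b.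
have sB' : is_subgroup B'.
  split; first by exists 0%Z, one; split=> //=; gs.
  split=> [x y [k [b [hb ->]]] [k' [b' [hb' ->]]]|x [k [b [hb ->]]]].
    exists (k + k')%Z, (mul b b'); split; first exact: bM.
    by rewrite gzD; gs; rewrite (mulCA b).
  exists (- k)%Z, (inv b); split; first exact: bV.
  by rewrite gzN invMg; exact: (ab (inv b)).
have BB' x : B x -> B' x by exists 0%Z, x; split=> //=; gs.
have [||q hq] := ih B' sB'.
- move=> x; apply: (gen_trans _ (gl x)) => y [[<-|hy]|hy].
  + by apply: gen_in; right; exists 1%Z, one; rewrite gz1; gs.
  + by apply: gen_in; left.
  + by apply: gen_in; right; apply: BB'.
- by move=> x; have [b [y [hb ->]]] := hm x; exists b, y; split=> //; apply: BB'.
set n := (1 + _)%Z in hq.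
(* Write [g = b y^m] and, by induction, [y^n = g^c b']. Raising the first equation to the power [n]
   puts [g^(n - c m)] into [B], and both [n] and [n - c m] are congruent to 1 modulo [m]; their
   product is the exponent sought. *)
have [b [y [hb ey]]] := hm g.
have [c [b' [hb' eb']]] := hq y.
have hg : B (gz g (n - c * Z.of_nat m)).
  rewrite gzD gzN {1}ey gzMc; first exact: ab.
  have -> : gz (gpow y m) n = mul (gz g (c * Z.of_nat m)) (gz b' (Z.of_nat m)).
    by rewrite -gz_nat -gzM Z.mul_comm gzM eb' gzMc ?gzM //; apply: ab.
  rewrite (ab (gz g _)) mulAr mulAr mulgV mulg1.
  by apply: bM; apply: gz_sub.
exists (q + q - c + Z.of_nat m * q * (q - c))%Z => x.
have -> : (1 + Z.of_nat m * (q + q - c + Z.of_nat m * q * (q - c)) = n * (n - c * Z.of_nat m))%Z.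
  by rewrite /n; ring.
have [k [b'' [hb'' e]]] := hq x.
rewrite gzM e gzMc; first exact: ab.
apply: bM; last exact: gz_sub.
by rewrite -gzM Z.mul_comm gzM; apply: gz_sub.
Qed.

(** * Torsion-free abelian groups: freeness, splitting, subgroups of finite exponent *)

Definition torsion_free (K : group) := forall (x : K) k, 1 <= k -> gpow x k = one -> x = one.

Lemma torsion_free_gz (K : group) (x : K) k : torsion_free K -> k <> 0%Z -> gz x k = one -> x = one.
Proof.
move=> tf; case: k => [//|p|p] _ /= h; apply: (tf _ (Pos.to_nat p)) => //; try lia.
by rewrite -[gpow _ _]invgK h invg1.
Qed.

(** Torsion-freeness allows division of [p] and [q] by their gcd; a Bezout relation then gives an
    element of which both [y] and [h] are powers. *)
Lemma cyc_pair (K : group) (y h : K) p q : abelian K -> torsion_free K -> p <> 0%Z ->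
  gz y p = gz h q -> exists a b, cyc (mul (gz y a) (gz h b)) y /\ cyc (mul (gz y a) (gz h b)) h.
Proof.
move=> ab tf p0 e.
have [u [v huv]] := Z.gcd_bezout p q (Z.gcd p q) eq_refl.
have [p' ep] := Z.gcd_divide_l p q.
have [q' eq] := Z.gcd_divide_r p q.
set d := Z.gcd p q in huv ep eq.
have d0 : d <> 0%Z by move=> d0; apply: p0; rewrite ep d0; lia.
have e' : gz y p' = gz h q'.
  apply/eq_mulinv/(torsion_free_gz tf d0).
  rewrite -gzN gzMc; first exact: ab.
  by rewrite -!gzM Z.mul_opp_l -ep -eq gzN e; gs.
have huv' : (u * p' + v * q' = 1)%Z by nia.
exists v, u; split; [exists q'|exists p']; rewrite gzMc; try exact: ab; rewrite -!gzM.
- rewrite [(u * q')%Z]Z.mul_comm (gzM h) -e' -gzM -gzD.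
  by rewrite (_ : v * q' + p' * u = 1)%Z ?gz1 //; lia.
- rewrite [(v * p')%Z]Z.mul_comm (gzM y) e' -gzM -gzD.
  by rewrite (_ : q' * v + u * p' = 1)%Z ?gz1 //; lia.
Qed.

(** Elements commensurable with [g] span a group of rank at most one; [cyc_pair] absorbs the list
    into a cyclic group one element at a time. *)
Lemma locally_cyclic (K : group) (g : K) (l : list K) : abelian K -> torsion_free K ->
  (forall x, In x l -> exists k j, k <> 0%Z /\ gz x k = gz g j) ->
  exists h, (exists k j, k <> 0%Z /\ gz h k = gz g j) /\ forall x, In x l -> cyc h x.
Proof.
move=> ab tf; elim: l => [|y l ih] hl.
  by exists one; split=> //; exists 1%Z, 0%Z; rewrite gz_one.
have [h [[k' [j' [k0' e']]] hh]] := ih (fun x hx => hl x (or_intror hx)).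
have [k [j [k0 e]]] := hl y (or_introl eq_refl).
(* If [j' = 0] then [h] is trivial and [y] alone serves; otherwise the exponent [k * j'] required by
   [cyc_pair] is nonzero. *)
case: (Z.eq_dec j' 0) => [j0|j0].
  have h1 : h = one by apply: (torsion_free_gz tf k0'); rewrite e' j0.
  exists y; split; first by exists k, j.
  move=> x [<-|/hh [a ->]]; first by exists 1%Z; rewrite gz1.
  by exists 0%Z; rewrite h1 gz_one.
have [||a [b [hy hc]]] := @cyc_pair _ y h (k * j') (k' * j) ab tf; first nia.
  by rewrite !gzM e e' -!gzM Z.mul_comm.
exists (mul (gz y a) (gz h b)); split.
  exists (k * k')%Z, (j * (k' * a) + j' * (k * b))%Z; split; first nia.
  rewrite gzMc; first exact: ab.
  rewrite -!gzM gzD; congr mul.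
    by rewrite (_ : a * (k * k') = k * (k' * a))%Z ?(gzM y k) ?e -?gzM //; lia.
  by rewrite (_ : b * (k * k') = k' * (k * b))%Z ?(gzM h k') ?e' -?gzM //; lia.
have [t et] := hc.
move=> x [<- //|/hh [s ->]]; exists (t * s)%Z; by rewrite gzM -et.
Qed.

Definition Zgroup : group := @Group Z Z.add 0%Z Z.opp Z.add_assoc Z.add_0_l Z.add_opp_diag_l.

Definition prodg (K Q : group) : group.
Proof.
refine (@Group (K * Q) (fun x y => (mul (fst x) (fst y), mul (snd x) (snd y)))
  (one, one) (fun x => (inv (fst x), inv (snd x))) _ _ _).
- by move=> x y z; rewrite /= !mulA.
- by move=> [x y]; rewrite /= !mul1g.
- by move=> [x y]; rewrite /= !mulVg.
Defined.

Lemma gpow_prod (K Q : group) (a : K) (b : Q) n :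
  gpow ((a, b) : prodg K Q) n = (gpow a n, gpow b n).
Proof. by elim: n => //= n ->. Qed.

Lemma gz_prod (K Q : group) (a : K) (b : Q) k : gz ((a, b) : prodg K Q) k = (gz a k, gz b k).
Proof. by case: k => [|p|p] //; rewrite /gz gpow_prod. Qed.

Definition unitg : group.
Proof. by refine (@Group unit (fun _ _ => tt) tt (fun _ => tt) _ _ _) => [] // [].  Defined.

Fixpoint Zn (n : nat) : group := match n with 0 => unitg | S n => prodg Zgroup (Zn n) end.

Definition bijective (X Y : Type) (f : X -> Y) :=
  (forall x y, f x = f y -> x = y) /\ forall y, exists x, f x = y.

Lemma gz_Zgroup (a : Zgroup) (k : Z) : gz a k = (a * k : Z)%Z.
Proof.
have P n : gpow a n = (a * Z.of_nat n : Z)%Z.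
  by elim: n => [|n ih]; rewrite ?Z.mul_0_r //= ih /=; lia.
by case: k => [|p|p] /=; rewrite ?P /=; lia.
Qed.

(** Projectivity of [Z^n]: the image of the first basis vector is lifted arbitrarily, the rest by
    induction. *)
Lemma Zn_lift n (A Q : group) (p : A -> Q) (h : Zn n -> Q) : abelian A -> is_hom p -> is_hom h ->
  (forall y, exists x, p x = y) -> exists s : Zn n -> A, is_hom s /\ forall z, p (s z) = h z.
Proof.
move=> ab hp; elim: n h => [|n ih] h hh sp.
  exists (fun _ => one); split; first by move=> x y; gs.
  by move=> []; rewrite (hom1 hp) -(hom1 hh).
have h1 : is_hom (fun z => h (0%Z, z) : Q) by move=> x y; rewrite -hh.
have h2 : is_hom (fun k : Zgroup => h (k, one)) by move=> x y; rewrite -hh /=; gs.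
have [s [hs es]] := ih _ h1 sp.
have [a ea] := sp (h (1%Z, one)).
exists (fun t => mul (gz a (fst t)) (s (snd t))); split.
  move=> [k z] [k' z'] /=; rewrite gzD hs; gs; rewrite (mulCA (s z)) //.
move=> [k z] /=; rewrite hp es (gz_hom _ _ hp) ea.
have := gz_hom (1%Z : Zgroup) k h2 => /= <-; rewrite -hh gz_Zgroup /=; gs.
by case: k.
Qed.

Lemma surj_inv (X Y : Type) (f : X -> Y) : (forall y, exists x, f x = y) -> exists g : Y -> X, forall y, f (g y) = y.
Proof. by move=> h; apply: (choice (fun y x => f x = y)). Qed.

Lemma torsion_free_is_free n (K : group) (l : list K) : length l = n -> abelian K -> torsion_free K ->
  (forall x, gen (fun y => In y l) x) -> exists n (j : Zn n -> K), is_hom j /\ bijective j.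
Proof.
elim: n K l => [|n ih] K [|g l] //= el ab tf gl.
  have K1 x : x = one :> K.
    by elim: {x}(gl x) => [x []|//|x y _ -> _ ->|x _ ->]; gs.
  exists 0, (fun _ => one); split; first by move=> x y; gs.
  by split=> [[] []|y] //; exists tt.
(* [I] is the isolator of the cyclic group of [g]. It is cyclic, and [K/I] is torsion-free with one
   generator fewer, hence free, so the projection splits. *)
pose I (x : K) := exists k j, k <> 0%Z /\ gz x k = gz g j.
have sI : is_subgroup I.
  split; first by exists 1%Z, 0%Z; rewrite gz_one.
  split=> [x y [k [j [k0 e]]] [k' [j' [k0' e']]]|x [k [j [k0 e]]]].
    exists (k * k')%Z, (j * k' + j' * k)%Z; split; first nia.
    by rewrite gzMc ?(gzM x) ?e ?[(k * k')%Z]Z.mul_comm ?(gzM y) ?e' -?gzM ?gzD //; apply: ab.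
  exists (- k)%Z, j; split; first lia.
  by rewrite -e -{1}(gz1 x) -gzN -gzM; congr gz; lia.
have nI := abelian_normal ab sI.
have nK : noeth K by apply: (noeth_abelian_gen (l := g :: l)).
have [li [hi gi]] := nK _ sI.
have [h [hI hc]] := locally_cyclic ab tf hi.
have Ih x : I x -> cyc h x by move=> /gi; apply: gen_sub hc _; exact: cyc_subgroup.
have hp := proj_hom nI.
have [||||m [j [hj [ij sj]]]] := ih (quo nI) (map (proj nI) l).
- by rewrite length_map; lia.
- exact: quo_abelian.
- move=> y k k1; have [x <-] := proj_surj y; rewrite -(hom_pow hp) => /proj1P [a [b [a0 e]]].
  apply/proj1P; exists (Z.of_nat k * a)%Z, b; split; first nia.
  by rewrite gzM gz_nat.
- move=> y; have [x <-] := proj_surj y; elim: {x}(gl x) => [x||x z _ hx _ hz|x _ hx].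
  + move=> [<-|hx]; last by apply: gen_in; apply: in_map.
    suff -> : proj nI g = one by apply: gen_one.
    by apply/proj1P; exists 1%Z, 1%Z.
  + exact: gen_one.
  + by rewrite hp; apply: gen_mul.
  + by rewrite (homV hp); apply: gen_inv.
have [s [hs es]] := Zn_lift ab hp hj (@proj_surj _ _ nI).
(* This case occurs exactly when [g] is trivial; then [I] is trivial and contributes no basis
   element. *)
case: (classic (h = one)) => [h1|h1].
  have I1 x : I x -> x = one by move=> /Ih [k ->]; rewrite h1 gz_one.
  exists m, s; split=> //; split.
    by move=> x y e; apply: ij; rewrite -!es e.
  move=> x; have [z ez] := sj (proj nI x); exists z; apply/eq_invmul/I1.
  by apply/proj_eq; rewrite es.
exists (S m), (fun t => mul (gz h (fst t)) (s (snd t))); split.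
  by move=> [k z] [k' z'] /=; rewrite gzD hs; gs; rewrite (mulCA (s z)).
have Ph k : proj nI (gz h k) = one by apply/proj1P; apply: gz_sub.
split.
  move=> [k z] [k' z'] /= e.
  have ez : z = z'.
    have := f_equal (proj nI) e; rewrite !hp !Ph !es; gs; exact: ij.
  rewrite ez in e *; congr (_, _).
  have := mulgI e => /eq_invmul; rewrite -gzN -gzD => h0.
  have [//|h2] : k = k' \/ (- k + k')%Z <> 0%Z by lia.
  by case: h1; apply: (torsion_free_gz tf h2).
move=> x; have [z ez] := sj (proj nI x).
have [k ek] : cyc h (mul x (inv (s z))).
  by apply: Ih; apply/(proj1P nI); rewrite hp (homV hp) es ez; gs.
by exists (k, z); rewrite /= -ek; gs.
Qed.

Lemma free_basis (K : group) : fin_gen K -> abelian K -> torsion_free K ->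
  exists n (j : Zn n -> K), is_hom j /\ bijective j.
Proof. by move=> [l gl] ab tf; apply: (torsion_free_is_free (l := l)). Qed.

Lemma section (A Q : group) (p : A -> Q) : abelian A -> abelian Q -> fin_gen Q -> torsion_free Q ->
  is_hom p -> (forall y, exists x, p x = y) -> exists s : Q -> A, is_hom s /\ forall y, p (s y) = y.
Proof.
move=> abA abQ fgQ tf hp sp.
have [n [j [hj [ij sj]]]] := free_basis fgQ abQ tf.
have [s [hs es]] := Zn_lift abA hp hj sp.
have [g eg] := surj_inv sj.
exists (fun y => s (g y)); split; last by move=> y; rewrite es eg.
by move=> x y; rewrite -hs; congr s; apply: ij; rewrite hj !eg.
Qed.

(** An isolated subgroup is a direct factor: [A/B] is free, and dividing [x] by the lift of its
    image under a section projects onto [B]. *)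
Lemma retraction (A : group) (B : A -> Prop) : abelian A -> fin_gen A -> is_subgroup B ->
  (forall x k, 1 <= k -> B (gpow x k) -> B x) ->
  exists r : A -> A, is_hom r /\ (forall x, B (r x)) /\ forall x, B x -> r x = x.
Proof.
move=> ab fgA sB tf.
have nB := abelian_normal ab sB.
have hp := proj_hom nB.
have [|||s [hs es]] := section (p := proj nB) ab _ _ _ hp (@proj_surj _ _ nB).
- exact: quo_abelian.
- exact: (fin_gen_surj hp (@proj_surj _ _ nB)).
- move=> y k k1; have [x <-] := proj_surj y; rewrite -(hom_pow hp) => /proj1P h.
  by apply/proj1P; apply: (tf x k).
exists (fun x => mul x (inv (s (proj nB x)))); split; last split.
- move=> x y; rewrite hp hs invMg; gs; congr mul.
  by rewrite (ab (inv (s (proj nB y)))) mulCA.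
- by move=> x; apply/(proj1P nB); rewrite hp (homV hp) es; gs.
- by move=> x /(proj1P nB) ->; rewrite (hom1 hs); gs.
Qed.

(** A triangular basis: a vector of [C] with first coordinate [d], followed by a basis of the
    vectors of [C] with first coordinate 0. *)
Lemma Zn_subgroup n (C : Zn n -> Prop) (N : nat) : is_subgroup C -> 1 <= N ->
  (forall x, C (gpow x N)) ->
  exists j : Zn n -> Zn n, is_hom j /\ (forall x y, j x = j y -> x = y) /\
    (forall x, C (j x)) /\ forall y, C y -> exists x, j x = y.
Proof.
elim: n C => [|n ih] C [c1 [cM cV]] N1 hN.
  exists id; do !split=> //; first by move=> [].
  by move=> y _; exists y.
have h1 : is_hom (fun z : Zn n => (0%Z, z) : Zn (S n)) by [].
have h2 : is_hom (fun z : Zn (S n) => fst z) by [].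
have [|//||j [hj [ij [Cj sj]]]] := ih (fun z => C (0%Z, z)).
- exact: (preim_subgroup h1).
- by move=> x; have := hom_pow h1 x N => /= ->.
have [|||d [[z0 hd] [d0 pd]]] := @principal (fun k => exists z, C (k, z)).
- by exists one.
- by move=> a b [z hz] [z' hz']; exists (mul z z'); have := cM _ _ hz hz'.
- by move=> a [z hz]; exists (inv z); have := cV _ hz.
(* [C] contains the [N]-th multiple of the first basis vector, so its projection to the first
   coordinate is not zero. *)
have dpos : d <> 0%Z.
  move=> e; have [|q hq] := pd (Z.of_nat N); last by lia.
  exists (gpow one N).
  have := hN (1%Z, one); rewrite gpow_prod.
  by rewrite -(gz_nat (1%Z : Zgroup)) gz_Zgroup Z.mul_1_l.
have abn : forall n, abelian (Zn n).
  elim=> [[] []|k ihk [a x] [b y]] //=; rewrite (ihk x) //.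
  by congr (_, _); apply: Z.add_comm.
have Cd k : C (gz ((d, z0) : Zn (S n)) k) by apply: gz_sub.
have ed k : gz ((d, z0) : Zn (S n)) k = ((d * k)%Z, gz z0 k).
  by rewrite gz_prod gz_Zgroup.
exists (fun t => ((d * fst t)%Z, mul (gz z0 (fst t)) (j (snd t)))); split; last split; last split.
- move=> [k z] [k' z'] /=; congr (_, _); first by lia.
  by rewrite gzD hj; gs; rewrite (mulCA (j z)) //; apply: abn.
- move=> [k z] [k' z'] /= [e1 e2].
  have ek : k = k' by nia.
  rewrite ek in e2 *; congr (_, _); apply: ij; exact: (mulIg e2).
- move=> [k z] /=.
  have := cM _ _ (Cd k) (Cj z); rewrite ed /=.
  by rewrite Z.add_0_r.
- move=> [k z] hc.
  have [|q eq] := pd k; first by exists z.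
  have := cM _ _ (cV _ (Cd q)) hc; rewrite ed /= => hz.
  have [|w hw] := sj (mul (inv (gz z0 q)) z).
    by move: hz; rewrite (_ : (- (d * q) + k)%Z = 0%Z) //; lia.
  by exists (q, w); rewrite /= hw; gs; rewrite eq.
Qed.

(** Turns an embedding with cokernel of finite exponent into an isomorphism. It is applied to
    [H/Is(H')] and to an addition of [H]. *)
Lemma free_finite_exponent_iso (Q : group) (C : Q -> Prop) (N : nat) : fin_gen Q -> abelian Q -> torsion_free Q ->
  is_subgroup C -> 1 <= N -> (forall x, C (gpow x N)) ->
  exists j : Q -> Q, is_hom j /\ (forall x y, j x = j y -> x = y) /\
    (forall x, C (j x)) /\ forall y, C y -> exists x, j x = y.
Proof.
move=> fgQ ab tf sC N1 hN.
have [n [b [hb [ib sb]]]] := free_basis fgQ ab tf.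
have [g eg] := surj_inv sb.
have hg : is_hom g by move=> x y; apply: ib; rewrite hb !eg.
have [||j [hj [ij [Cj sj]]]] := Zn_subgroup (C := fun z => C (b z)) (N := N) _ N1.
- exact: (preim_subgroup hb).
- by move=> x; rewrite (hom_pow hb).
exists (fun x => b (j (g x))); split; last split; last split.
- by move=> x y; rewrite hg hj hb.
- by move=> x y /ib /ij e; rewrite -(eg x) -(eg y) e.
- by move=> x.
- move=> y cy; have [|x ex] := sj (g y); first by rewrite eg.
  exists (b x); have -> : g (b x) = x by apply: ib; rewrite eg.
  by rewrite ex eg.
Qed.
(** * Uniformly definable predicates *)

(** Iterated [option]: passing under a quantifier adds the variable [None], so tuples and contexts
    are extended in the same way. *)
Fixpoint fin (n : nat) : Type := match n with 0 => Empty_set | S n => option (fin n) end.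

Inductive word (V : Type) :=
| wvar (v : V) | wone | wmul (s t : word V) | winv (t : word V).
Arguments wone {V}.

Fixpoint weval (V : Type) (K : group) (e : V -> K) (w : word V) : K :=
  match w with
  | wvar v => e v
  | wone => one
  | wmul s t => mul (weval e s) (weval e t)
  | winv t => inv (weval e t)
  end.

(* [dfn Q]: for any placement [c] of the variables of type [V] among those of [formula] that
   leaves the variables from [N] on free for quantification, one formula defines [Q] in all groups. *)
Definition dfn (V : Type) (Q : forall K : group, (V -> K) -> Prop) :=
  forall (c : V -> nat) N, (forall v, c v < N) ->
    exists p, forall (K : group) (e : nat -> K), sat e p <-> Q K (fun v => e (c v)).

Definition utm (V : Type) (t : forall K : group, (V -> K) -> K) :=
  exists w : word V, forall (K : group) (e : V -> K), t K e = weval e w.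

Section Terms.
Variable V : Type.

Lemma utm_var (v : V) : utm (fun K e => e v).
Proof. by exists (wvar v). Qed.

Lemma utm_one : utm (fun K (e : V -> K) => one).
Proof. by exists wone. Qed.

Lemma utm_mul s t : utm s -> utm t -> utm (fun K (e : V -> K) => mul (s K e) (t K e)).
Proof. by move=> [a ha] [b hb]; exists (wmul a b) => K e; rewrite ha hb. Qed.

Lemma utm_inv t : utm t -> utm (fun K (e : V -> K) => inv (t K e)).
Proof. by move=> [a ha]; exists (winv a) => K e; rewrite ha. Qed.

Lemma utm_comm s t : utm s -> utm t -> utm (fun K (e : V -> K) => comm (s K e) (t K e)).
Proof. by move=> hs ht; rewrite /comm; do !(apply: utm_mul || apply: utm_inv). Qed.

Lemma utm_pow t n : utm t -> utm (fun K (e : V -> K) => gpow (t K e) n).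
Proof. by move=> ht; elim: n => [|n ih] /=; [apply: utm_one|apply: utm_mul]. Qed.

Lemma utm_gz t k : utm t -> utm (fun K (e : V -> K) => gz (t K e) k).
Proof. by move=> ht; case: k => [|n|n] /=; [apply: utm_one|apply: utm_pow|apply/utm_inv/utm_pow]. Qed.

End Terms.

Lemma utm_word (V : Type) (w : word V) (W : Type) (f : V -> W) :
  utm (fun K (e : W -> K) => weval (fun v => e (f v)) w).
Proof.
elim: w => [v||s hs t ht|t ht] /=; [exact: (utm_var (f v))|exact: utm_one|exact: utm_mul|exact: utm_inv].
Qed.
Lemma utm_sub (V W : Type) (t : forall K : group, (V -> K) -> K) (f : V -> W) : utm t ->
  utm (fun K e => t K (fun v => e (f v))).
Proof.
move=> [w hw]; have [w' hw'] := utm_word w f.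
by exists w' => K e; rewrite hw hw'.
Qed.

Fixpoint wterm (V : Type) (c : V -> nat) (w : word V) : term :=
  match w with
  | wvar v => tvar (c v)
  | wone => tone
  | wmul s t => tmul (wterm c s) (wterm c t)
  | winv t => tinv (wterm c t)
  end.

Lemma wtermE (V : Type) (c : V -> nat) (w : word V) (K : group) (e : nat -> K) :
  teval e (wterm c w) = weval (fun v => e (c v)) w.
Proof. by elim: w => //= [s -> t ->|t ->]. Qed.

Definition ocons (V X : Type) (e : V -> X) (a : X) (v : option V) : X :=
  match v with Some v => e v | None => a end.

Lemma upd_ocons (V : Type) (c : V -> nat) N (K : group) (e : nat -> K) a : (forall v, c v < N) ->
  (fun v => upd e N a (ocons c N v)) = ocons (fun v => e (c v)) a.
Proof.
move=> hc; apply: functional_extensionality => -[v|] /=; rewrite /upd.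
  by have /Nat.eqb_neq -> : c v <> N by have := hc v; lia.
by rewrite Nat.eqb_refl.
Qed.

Section Closure.
Variable V : Type.
Implicit Types Q R : forall K : group, (V -> K) -> Prop.

Lemma dfn_ext Q R : (forall K e, Q K e <-> R K e) -> dfn Q -> dfn R.
Proof.
move=> h hQ c N hc; have [p hp] := hQ c N hc.
by exists p => K e; rewrite hp h.
Qed.

Lemma dfn_eq s t : utm s -> utm t -> dfn (fun K (e : V -> K) => s K e = t K e).
Proof.
move=> [a ha] [b hb] c N hc; exists (feq (wterm c a) (wterm c b)) => K e.
by rewrite /= !wtermE ha hb.
Qed.

Lemma dfn_not Q : dfn Q -> dfn (fun K e => ~ Q K e).
Proof. by move=> h c N hc; have [p hp] := h c N hc; exists (fnot p) => K e /=; rewrite hp. Qed.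

Lemma dfn_and Q R : dfn Q -> dfn R -> dfn (fun K e => Q K e /\ R K e).
Proof.
move=> h h' c N hc; have [p hp] := h c N hc; have [q hq] := h' c N hc.
by exists (fand p q) => K e /=; rewrite hp hq.
Qed.

Lemma dfn_or Q R : dfn Q -> dfn R -> dfn (fun K e => Q K e \/ R K e).
Proof.
move=> h h' c N hc; have [p hp] := h c N hc; have [q hq] := h' c N hc.
by exists (for_ p q) => K e /=; rewrite hp hq.
Qed.

Lemma dfn_imp Q R : dfn Q -> dfn R -> dfn (fun K e => Q K e -> R K e).
Proof.
move=> h h' c N hc; have [p hp] := h c N hc; have [q hq] := h' c N hc.
by exists (fimp p q) => K e /=; rewrite hp hq.
Qed.

End Closure.

Section Quantifiers.
Variable V : Type.

Lemma dfn_all (T : forall K : group, (V -> K) -> K -> Prop) :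
  dfn (fun K (e : option V -> K) => T K (fun v => e (Some v)) (e None)) ->
  dfn (fun K e => forall a, T K e a).
Proof.
move=> h c N hc; have [|p hp] := h (ocons c N) (S N).
  by move=> [v|] /=; [have := hc v|]; lia.
exists (fall N p) => K e /=; split=> H a.
  by have := proj1 (hp _ _) (H a); have := upd_ocons e a hc => E; rewrite (f_equal (fun g v => g (Some v)) E) (f_equal (fun g => g None) E).
apply/hp; have := upd_ocons e a hc => E.
by rewrite (f_equal (fun g v => g (Some v)) E) (f_equal (fun g => g None) E).
Qed.

Lemma dfn_ex (T : forall K : group, (V -> K) -> K -> Prop) :
  dfn (fun K (e : option V -> K) => T K (fun v => e (Some v)) (e None)) ->
  dfn (fun K e => exists a, T K e a).
Proof.
move=> h; apply: (dfn_ext (Q := fun K e => ~ forall a, ~ T K e a)).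
  move=> K e; split=> [H|[a ha] H]; last exact: (H a).
  by apply: NNPP => H'; apply: H => a ha; apply: H'; exists a.
apply: (dfn_not (Q := fun K e => forall a, ~ T K e a)).
apply: (dfn_all (T := fun K e a => ~ T K e a)).
exact: (dfn_not (Q := fun K (e : option V -> K) => T K (fun v => e (Some v)) (e None))).
Qed.

(** The truth value of [P] is fixed, so excluded middle chooses the formula. This lets facts about a
    fixed tuple of [G] appear inside a uniform condition. *)
Lemma dfn_const (P : Prop) : dfn (fun K (e : V -> K) => P).
Proof.
case: (classic P) => hP.
  by apply: (dfn_ext (Q := fun K e => one = one)) => [//|]; apply: dfn_eq; apply: utm_one.
apply: (dfn_ext (Q := fun K e => ~ one = one)) => [//|].
by apply: dfn_not; apply: dfn_eq; apply: utm_one.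
Qed.

Lemma dfn_all_fin n (T : fin n -> forall K : group, (V -> K) -> Prop) :
  (forall j, dfn (T j)) -> dfn (fun K e => forall j, T j K e).
Proof.
elim: n T => [|n ih] T h.
  by apply: (dfn_ext (Q := fun K e => True)) => [K e|]; [split=> // _ []|apply: dfn_const].
apply: (dfn_ext (Q := fun K e => T None K e /\ forall j, T (Some j) K e)).
  by move=> K e; split=> [[h0 hS] [j|]|H] //; split.
by apply: dfn_and => //; apply: ih.
Qed.

Lemma dfn_all_list (X : Type) (l : list X) (T : X -> forall K : group, (V -> K) -> Prop) :
  (forall x, dfn (T x)) -> dfn (fun K e => forall x, In x l -> T x K e).
Proof.
move=> h; elim: l => [|y l ih].
  by apply: (dfn_ext (Q := fun K e => True)) => [K e|]; [split=> // _ x []|apply: dfn_const].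
apply: (dfn_ext (Q := fun K e => T y K e /\ forall x, In x l -> T x K e)); last exact: dfn_and.
move=> K e; split=> [[h0 hS] x [<-//|/hS]|H] //; split; first by apply: H; left.
by move=> x hx; apply: H; right.
Qed.

Lemma dfn_ex_list (X : Type) (l : list X) (T : X -> forall K : group, (V -> K) -> Prop) :
  (forall x, dfn (T x)) -> dfn (fun K e => exists x, In x l /\ T x K e).
Proof.
move=> h; elim: l => [|y l ih].
  apply: (dfn_ext (Q := fun K e => False)) => [K e|]; last exact: dfn_const.
  by split=> // -[x []].
apply: (dfn_ext (Q := fun K e => T y K e \/ exists x, In x l /\ T x K e)); last exact: dfn_or.
move=> K e; split=> [[h0|[x [hx hT]]]|[x [[<-|hx] hT]]].
- by exists y; split=> //; left.
- by exists x; split=> //; right.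
- by left.
- by right; exists x.
Qed.
End Quantifiers.

Lemma dfn_sub (V W : Type) (f : V -> W) (Q : forall K : group, (V -> K) -> Prop) : dfn Q ->
  dfn (fun K e => Q K (fun v => e (f v))).
Proof. by move=> h c N hc; apply: (h (fun v => c (f v)) N) => v; apply: hc. Qed.

Lemma dfn_all_tuple n (V : Type) (T : forall K : group, (V -> K) -> (fin n -> K) -> Prop) :
  dfn (fun K (e : V + fin n -> K) => T K (fun v => e (inl v)) (fun i => e (inr i))) ->
  dfn (fun K e => forall u, T K e u).
Proof.
elim: n V T => [|n ih] V T h.
  apply: (dfn_ext (Q := fun K e => T K e (fun i : fin 0 => match i with end))).
    by move=> K e; split=> // H u; have -> : u = fun i : fin 0 => match i with end by apply: functional_extensionality => -[].
  have := dfn_sub (fun s : V + fin 0 => match s with inl v => v | inr i => match i with end end) h.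
  apply: dfn_ext => K e.
  by have -> : (fun i : fin 0 => e match i with end) = fun i : fin 0 => match i with end by apply: functional_extensionality => -[].
apply: (dfn_ext (Q := fun K e => forall a u, T K e (ocons u a))).
  move=> K e; split=> H u; last by move=> u'; apply: H.
  have -> : u = ocons (fun i => u (Some i)) (u None) by apply: functional_extensionality => -[].
  exact: H.
apply: (dfn_all (T := fun K e a => forall u, T K e (ocons u a))).
apply: (ih _ (fun K (e : option V -> K) u => T K (fun v => e (Some v)) (ocons u (e None)))).
have := dfn_sub (fun s : V + fin (S n) => match s with
  | inl v => inl (Some v) | inr (Some i) => inr i | inr None => inl (@None V) end : option V + fin n) h.
apply: dfn_ext => K e.
by have -> : (fun i : fin (S n) => e match i with Some j => inr j | None => inl None end) =
  ocons (fun i => e (inr i)) (e (inl None)) by apply: functional_extensionality => -[].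
Qed.

Lemma dfn_ex_tuple n (V : Type) (T : forall K : group, (V -> K) -> (fin n -> K) -> Prop) :
  dfn (fun K (e : V + fin n -> K) => T K (fun v => e (inl v)) (fun i => e (inr i))) ->
  dfn (fun K e => exists u, T K e u).
Proof.
move=> h; apply: (dfn_ext (Q := fun K e => ~ forall u, ~ T K e u)).
  move=> K e; split=> [H|[a ha] H]; last exact: (H a).
  by apply: NNPP => H'; apply: H => a ha; apply: H'; exists a.
apply: (dfn_not (Q := fun K e => forall u, ~ T K e u)).
apply: (dfn_all_tuple (T := fun K e a => ~ T K e a)).
exact: (dfn_not (Q := fun K (e : V + fin n -> K) => T K (fun v => e (inl v)) (fun i => e (inr i)))).
Qed.

Lemma dfn_center (V : Type) t : utm t -> dfn (fun K (e : V -> K) => center (t K e)).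
Proof.
move=> ht; apply: (dfn_all (T := fun K e x => mul (t K e) x = mul x (t K e))).
by apply: dfn_eq; apply: utm_mul; (apply: (utm_sub _ ht) || apply: utm_var).
Qed.

(** * Interpretation of [K/Z(K)] in [K] *)

Definition cquo (K : group) : group := quo (center_normal K).
Definition cproj (K : group) : K -> cquo K := @proj K _ (center_normal K).

Lemma cproj_hom (K : group) : is_hom (@cproj K).
Proof. exact: proj_hom. Qed.

Lemma cproj_surj (K : group) (y : cquo K) : exists x, cproj x = y.
Proof. exact: proj_surj. Qed.

Lemma cproj_eq (K : group) (x y : K) : cproj x = cproj y <-> center (mul (inv x) y).
Proof. exact: proj_eq. Qed.

Lemma cproj1 (K : group) (x : K) : cproj x = one <-> center x.
Proof. exact: proj1P. Qed.

Lemma teval_cquo (K : group) (e : nat -> K) t : teval (fun n => cproj (e n)) t = cproj (teval e t).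
Proof.
by elim: t => [//|/=|t ht u hu /=|t ht /=]; rewrite ?(hom1 (@cproj_hom K)) ?ht ?hu ?(homV (@cproj_hom K)) ?cproj_hom.
Qed.

Fixpoint tmax t := match t with
  | tvar n => S n | tone => 0 | tmul t u => tmax t + tmax u | tinv t => tmax t end.

Lemma teval_upd (K : group) (e : nat -> K) t N a : tmax t <= N -> teval (upd e N a) t = teval e t.
Proof.
elim: t => [n|/=|t ht u hu|t ht] //= h.
- by rewrite /upd; have /Nat.eqb_neq -> : n <> N by lia.
- by rewrite ht ?hu //; lia.
- by rewrite ht.
Qed.

(** Elements of [K/Z(K)] are represented by elements of [K]; only equations change, into the
    statement that the quotient of the two sides is central. *)
Lemma sat_cquo p : exists q, forall (K : group) (e : nat -> K), sat e q <-> sat (fun n => cproj (e n)) p.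
Proof.
have U (K : group) (e : nat -> K) n a : (fun m => cproj (upd e n a m)) = upd (fun m => cproj (e m)) n (cproj a).
  by apply: functional_extensionality => m; rewrite /upd; case: Nat.eqb.
elim: p => [t u|p [q hq]|p [q hq] p' [q' hq']|p [q hq] p' [q' hq']|p [q hq] p' [q' hq']|n p [q hq]|n p [q hq]].
(* Every variable of [t] and [u] lies below [N], so [N] can be quantified over without capture. *)
- pose N := tmax t + tmax u.
  exists (fall N (feq (tmul (tmul (tinv t) u) (tvar N)) (tmul (tvar N) (tmul (tinv t) u)))) => K e /=.
  rewrite !teval_cquo cproj_eq.
  have E a : upd e N a N = a by rewrite /upd Nat.eqb_refl.
  have Et a : teval (upd e N a) t = teval e t by apply: teval_upd; lia.
  have Eu a : teval (upd e N a) u = teval e u by apply: teval_upd; lia.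
  by split=> H a; have := H a; rewrite ?E ?Et ?Eu.
- by exists (fnot q) => K e /=; rewrite hq.
- by exists (fand q q') => K e /=; rewrite hq hq'.
- by exists (for_ q q') => K e /=; rewrite hq hq'.
- by exists (fimp q q') => K e /=; rewrite hq hq'.
- exists (fall n q) => K e /=; split=> H a.
    by have [b <-] := cproj_surj a; rewrite -U; apply/hq.
  by apply/hq; rewrite U.
- exists (fex n q) => K e /=; split=> -[a ha].
    by exists (cproj a); rewrite -U; apply/hq.
  have [b eb] := cproj_surj a; exists b; apply/hq; by rewrite U eb.
Qed.

Lemma dfn_cquo (V : Type) (Q : forall K : group, (V -> K) -> Prop) : dfn Q ->
  dfn (fun K e => Q (cquo K) (fun v => cproj (e v))).
Proof.
move=> h c N hc; have [p hp] := h c N hc; have [q hq] := sat_cquo p.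
by exists q => K e; rewrite hq hp.
Qed.

(** * Transfer of definable conditions on tuples *)

Definition transfer (G H : group) := forall n (Q : forall K : group, (fin n -> K) -> Prop), dfn Q ->
  (exists e, Q G e) -> exists e, Q H e.

Lemma fin_code n : exists c : fin n -> nat, (forall v, c v < n) /\
  forall (X : Type) (x0 : X) (e : fin n -> X), exists e' : nat -> X, e = fun v => e' (c v).
Proof.
elim: n => [|n [c [hc he]]].
  exists (fun i : fin 0 => match i with end); split=> [[]|X x0 e].
  by exists (fun _ => x0); apply: functional_extensionality => -[].
exists (ocons c n); split=> [[v|]|X x0 e] /=; [by have := hc v; lia|by lia|].
have [e' ee'] := he X x0 (fun v => e (Some v)).
exists (fun m => if Nat.eqb m n then e None else e' m).
apply: functional_extensionality => -[v|] /=; last by rewrite Nat.eqb_refl.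
have /Nat.eqb_neq -> : c v <> n by have := hc v; lia.
by have := f_equal (fun g => g v) ee'.
Qed.

Fixpoint fmax p := match p with
  | feq t u => tmax t + tmax u
  | fnot p => fmax p
  | fand p q | for_ p q | fimp p q => fmax p + fmax q
  | fall n p | fex n p => fmax p end.

Lemma tmax_free t k : tmax t <= k -> tfree k t = false.
Proof.
elim: t => [n|//|t ht u hu|t ht] /= h.
- by apply/Nat.eqb_neq; lia.
- by rewrite ht ?hu //; lia.
- exact: ht.
Qed.

Lemma fmax_free p k : fmax p <= k -> ffree k p = false.
Proof.
elim: p => [t u|p ih|p ih q ih'|p ih q ih'|p ih q ih'|n p ih|n p ih] /= h;
  rewrite ?tmax_free ?ih ?ih' ?Bool.andb_false_r //; lia.
Qed.

Fixpoint fclose m p := match m with 0 => p | S m => fclose m (fex m p) end.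

Lemma fclose_free m p k : (k < m \/ ffree k p = false) -> ffree k (fclose m p) = false.
Proof.
elim: m p => [|m ih] p /= h; first by case: h => //; lia.
apply: ih => /=; case: (Nat.eq_dec m k) => [->|mk].
  by right; rewrite Nat.eqb_refl.
by case: h => h; [left; lia|right; rewrite h Bool.andb_false_r].
Qed.

Lemma sat_fclose m p (K : group) (e : nat -> K) :
  sat e (fclose m p) <-> exists e', (forall k, m <= k -> e' k = e k) /\ sat e' p.
Proof.
elim: m p => [|m ih] p /=.
  split=> [h|[e' [he h]]]; first by exists e.
  by have <- : e' = e by apply: functional_extensionality => k; apply: he; lia.
rewrite ih /=; split=> [[e' [he [a h]]]|[e' [he h]]].
  exists (upd e' m a); split=> // k hk.
  rewrite /upd; have /Nat.eqb_neq -> : k <> m by lia.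
  by apply: he; lia.
exists (upd e' m (e m)); split.
  move=> k hk; rewrite /upd; case: (Nat.eq_dec k m) => [->|km]; first by rewrite Nat.eqb_refl.
  have /Nat.eqb_neq -> := km.
  by apply: he; lia.
exists (e' m); have -> : upd (upd e' m (e m)) m (e' m) = e' => //.
apply: functional_extensionality => k; rewrite /upd.
by case: (Nat.eqb_spec k m) => [->|].
Qed.

(** All variables below [m] are closed existentially; [m] bounds both the codes of the tuple and the
    variables of [p], so the closure is a sentence. *)
Lemma elem_equiv_transfer (G H : group) : elem_equiv G H -> transfer G H.
Proof.
move=> E n Q hQ [e he].
have [c [hc code]] := fin_code n.
have [p hp] := hQ c n hc.
pose m := n + fmax p.
have S : sentence (fclose m p).
  by move=> k; apply: fclose_free; case: (Nat.lt_ge_cases k m) => h; [left|right; apply: fmax_free; lia].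
have : sat (fun _ => @one G) (fclose m p).
  have [e' ee] := code G one e.
  apply/sat_fclose; exists (fun k => if Nat.ltb k m then e' k else one); split.
    by move=> k hk; have /Nat.ltb_ge -> : m <= k.
  apply/hp; suff -> : (fun v => if Nat.ltb (c v) m then e' (c v) else one) = e by [].
  apply: functional_extensionality => v; rewrite ee.
  by have /Nat.ltb_lt -> : c v < m by have := hc v; lia.
move=> /(E _ S) /sat_fclose [e' [_ /hp h]].
by exists (fun v => e' (c v)).
Qed.
(** * Commutative rings of endomorphisms *)

Section Roots.
Variables (R : Type) (rO rI : R) (radd rmul rsub : R -> R -> R) (ropp : R -> R).
Hypothesis Rth : ring_theory rO rI radd rmul rsub ropp eq.
Add Ring Rring : Rth.

(** The monic polynomial of degree [length cs]: [cs] lists the lower coefficients, constant term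
    first, and the leading 1 is implicit. *)
Fixpoint mev (cs : list R) (x : R) : R :=
  match cs with [] => rI | c :: cs => radd c (rmul x (mev cs x)) end.

Lemma mev_add cs ds r c : length cs = length ds ->
  exists es, length es = S (length cs) /\
    forall x, radd (mev (c :: cs) x) (rmul r (mev ds x)) = mev es x.
Proof.
elim: cs ds c => [|c1 cs ih] [|d ds] c //= el.
  by exists [radd c r]; split=> // x /=; ring.
have [es [les ees]] := ih ds c1 ltac:(by injection el).
exists (radd c (rmul r d) :: es); split; first by rewrite /= les.
by move=> x /=; rewrite -ees /=; ring.
Qed.

(** The factor theorem; the quotient is again monic, of degree one less. *)
Lemma mev_div cs c r : exists ds, length ds = length cs /\
  forall x, rsub (mev (c :: cs) x) (mev (c :: cs) r) = rmul (rsub x r) (mev ds x).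
Proof.
elim: cs c => [|c1 cs ih] c; first by exists []; split=> // x /=; ring.
have [ds [lds eds]] := ih c1.
have [es [les ees]] := mev_add r c1 (eq_sym lds).
exists es; split=> // x; rewrite -ees.
have -> : rsub (mev (c :: c1 :: cs) x) (mev (c :: c1 :: cs) r) =
  radd (rmul (rsub x r) (mev (c1 :: cs) x)) (rmul r (rsub (mev (c1 :: cs) x) (mev (c1 :: cs) r))).
  by cbn [mev]; ring.
by rewrite eds; ring.
Qed.

Variable P : R -> Prop.
Hypothesis Psub : forall a b, P a -> P b -> P (rsub a b).
Hypothesis Pprime : forall a b, P (rmul a b) -> P a \/ P b.
Hypothesis P1 : ~ P rI.

(** The bound on roots over a domain, read modulo the prime [P]: after division by [x - r], every
    root not congruent to [r] is a root of the quotient. *)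
Lemma roots_bound n cs l : length cs = n -> ForallOrdPairs (fun a b => ~ P (rsub a b)) l ->
  Forall (fun x => P (mev cs x)) l -> length l <= n.
Proof.
elim: n cs l => [|n ih] [|c cs] [|r l] /= el; try (by move=> *; lia); try discriminate el.
  by move=> _ h; inversion h.
move=> hl hr; inversion hl as [|? ? h1 h2]; inversion hr as [|? ? h3 h4]; subst.
have [ds [lds eds]] := mev_div cs c r.
suff : length l <= n by lia.
apply: (ih ds) => //; first by rewrite lds; injection el.
apply/Forall_forall => x hx.
have hPx : P (mev (c :: cs) x) by have := proj1 (Forall_forall _ _) h4 x hx.
have := Psub hPx h3; rewrite eds => /Pprime [hxr|//].
case: (proj1 (Forall_forall _ _) h1 x hx).
(* Negatives come from closure under subtraction: [(a - a) - a = - a]. *)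
have := Psub (Psub hxr hxr) hxr.
by have -> : rsub (rsub (rsub x r) (rsub x r)) (rsub x r) = rsub r x by ring.
Qed.

(** If no list represented all roots, every list of incongruent roots could be extended, past the
    bound given by the degree. *)
Lemma roots_finite cs : exists L, forall x, P (mev cs x) -> exists w, In w L /\ P (rsub x w).
Proof.
apply: NNPP => H.
have [l [el [h1 h2]]] : exists l, length l = S (length cs) /\
    ForallOrdPairs (fun a b => ~ P (rsub a b)) l /\ Forall (fun x => P (mev cs x)) l.
  elim: (S _) => [|n [l [el [h1 h2]]]]; first by exists []; do !constructor.
  have [x [hx hw]] : exists x, P (mev cs x) /\ forall w, In w l -> ~ P (rsub x w).
    apply: NNPP => H'; apply: H; exists l => x hx; apply: NNPP => H''.
    by apply: H'; exists x; split=> // w hw hP; apply: H''; exists w.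
  exists (x :: l); split; first by rewrite /= el.
  by split; constructor=> //; apply/Forall_forall.
by have := roots_bound eq_refl h1 h2; rewrite el; lia.
Qed.
End Roots.

Definition fung (X : Type) (A : group) : group.
Proof.
refine (@Group (X -> A) (fun f g x => mul (f x) (g x)) (fun _ => one) (fun f x => inv (f x)) _ _ _).
- by move=> f g h; apply: functional_extensionality => x; rewrite mulA.
- by move=> f; apply: functional_extensionality => x; rewrite mul1g.
- by move=> f; apply: functional_extensionality => x; rewrite mulVg.
Defined.

Lemma noeth_separated (K A : group) (hs : list (K -> A)) : noeth A ->
  (forall h, In h hs -> is_hom h) ->
  (forall x, (forall h, In h hs -> h x = one) -> x = one) -> noeth K.
Proof.
move=> nA hh H B sB.
have : forall x, B x -> (forall h, In h hs -> h x = one) -> x = one by move=> x _; apply: H.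
elim: hs hh B sB {H} => [|h hs ih] hh B sB H.
  by apply: fg_trivial => x bx; apply: H.
have hh1 : is_hom h by apply: hh; left.
apply: (fg_ext hh1 sB); first exact/nA/image_subgroup.
apply: ih; first by move=> g hg; apply: hh; right.
  by apply: cap_subgroup => //; case: (ker_normal hh1).
move=> x [bx hx] hg; apply: H => // g [<-//|]; exact: hg.
Qed.

Section Endo.
Variables (A : group) (E : (A -> A) -> Prop).
Hypothesis nA : noeth A.
Hypothesis abA : abelian A.
Hypothesis Ehom : forall s, E s -> is_hom s.
Hypothesis E1 : E (fun a => a).
Hypothesis EM : forall s t, E s -> E t -> E (fun a => s (t a)).
Hypothesis EA : forall s t, E s -> E t -> E (fun a => mul (s a) (t a)).
Hypothesis EN : forall s, E s -> E (fun a => inv (s a)).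
Hypothesis EC : forall s t, E s -> E t -> forall a, s (t a) = t (s a).

Lemma E0 : E (fun _ => one).
Proof.
have := EA E1 (EN E1); have -> // : (fun a : A => mul a (inv a)) = fun _ => one.
by apply: functional_extensionality => a; gs.
Qed.

Lemma Egz k : E (fun a => gz a k).
Proof.
have P n : E (fun a => gpow a n) by elim: n => [|n ih]; [exact: E0|exact: (EA E1 ih)].
by case: k => [|n|n] ; [exact: E0|exact: P|exact: (EN (P _))].
Qed.

Lemma E_subgroup : is_subgroup (E : fung A A -> Prop).
Proof. by split; [apply: E0|split=> [s t|s]; [apply: EA|apply: EN]]. Qed.

(** An endomorphism is determined by its values at finitely many generators of [A], so the additive
    group of [E] embeds into a finite power of [A]. *)
Lemma E_group : exists (T : group) (i : T -> A -> A), noeth T /\ (forall t, E (i t)) /\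
  (forall s, E s -> exists t, i t = s) /\ forall a, is_hom (fun t => i t a).
Proof.
have [T [i [hi [ii [iE sE]]]]] := subgroup_group E_subgroup.
have ha a : is_hom (fun t => i t a) by move=> x y; rewrite hi.
exists T, i; split=> //.
have [l gl] := noeth_fin_gen nA.
apply: (noeth_separated (hs := map (fun a t => i t a) l) nA).
  by move=> h /in_map_iff [a [<- _]].
move=> t ht; apply: ii; rewrite (hom1 hi); apply: functional_extensionality => a.
have hit := Ehom (iE t).
elim: {a}(gl a) => [a hal||a b _ ea _ eb|a _ ea].
- exact: (ht _ (in_map (fun a t => i t a) l a hal)).
- by rewrite (hom1 hit).
- by rewrite hit ea eb /=; gs.
- by rewrite (homV hit) ea /=; gs.
Qed.

Lemma E_fg : exists ts : list (A -> A), (forall t, In t ts -> E t) /\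
  forall s a, E s -> gen (fun y => exists t, In t ts /\ y = t a) (s a).
Proof.
have [T [i [nT [iE [sE ha]]]]] := E_group.
have [l gl] := noeth_fin_gen nT.
exists (map i l); split; first by move=> t /in_map_iff [x [<- _]].
move=> s a /sE [t <-]; apply: (hom_gen (ha a) _ (gl t)) => x hx.
by apply: gen_in; exists (i x); split=> //; apply: in_map.
Qed.

(** An integer polynomial in the endomorphism [s], applied to [a]; [mevA] is the monic version, with
    the additional term [s^(length cs)]. *)
Fixpoint pev (cs : list Z) (s : A -> A) (a : A) : A :=
  match cs with [] => one | c :: cs => mul (gz a c) (s (pev cs s a)) end.

Fixpoint mevA (cs : list Z) (s : A -> A) (a : A) : A :=
  match cs with [] => a | c :: cs => mul (gz a c) (s (mevA cs s a)) end.

Lemma E_pev cs s : E s -> E (pev cs s).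
Proof.
by move=> hs; elim: cs => [|c cs ih]; [apply: E0|exact: (EA (Egz c) (EM hs ih))].
Qed.

Lemma mevA_pev cs s a : E s -> mevA cs s a = mul (pev cs s a) (Nat.iter (length cs) s a).
Proof.
move=> hs; elim: cs => [|c cs ih] /=; first by gs.
by rewrite ih (Ehom hs); gs.
Qed.

Lemma pev_add cs ds s : E s -> length cs = length ds ->
  exists es, length es = length cs /\ forall a, pev es s a = mul (pev cs s a) (pev ds s a).
Proof.
move=> hs; elim: cs ds => [|c cs ih] [|d ds] //= el; first by exists []; split=> // x /=; gs.
have [es [les ees]] := ih ds ltac:(by injection el).
exists ((c + d)%Z :: es); split; first by rewrite /= les.
by move=> x /=; rewrite ees (Ehom hs) gzD; gs; rewrite (mulCA (gz x d)).
Qed.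

Lemma pev_opp cs s a : E s -> pev (map Z.opp cs) s a = inv (pev cs s a).
Proof.
move=> hs; elim: cs => [|c cs ih] /=; first by gs.
by rewrite ih (homV (Ehom hs)) gzN invMg abA.
Qed.

Lemma pev_repeat n s a : E s -> pev (repeat 0%Z n ++ [1%Z]) s a = Nat.iter n s a.
Proof. by move=> hs; elim: n => [|n ih] /=; rewrite ?(hom1 (Ehom hs)); gs => //; rewrite ih. Qed.

Lemma pev_rcons cs s a : E s -> pev (cs ++ [0%Z]) s a = pev cs s a.
Proof. by move=> hs; elim: cs => [|c cs ih] /=; rewrite ?(hom1 (Ehom hs)) ?ih; gs. Qed.

(** The polynomials in [s] of degree less than [n] form an ascending chain of additive subgroups.
    Once it is stationary, [s^n] equals a polynomial of lower degree. *)
Lemma E_integral s : E s -> exists cs, forall a, mevA cs s a = one.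
Proof.
move=> hs; have [T [i [nT [iE [sE ha]]]]] := E_group.
pose C n (t : T) := exists cs, length cs = n /\ forall a, i t a = pev cs s a.
have [n|n t [cs [<- h]]|n hn] := @chain_fg T C nT.
- split.
    exists (repeat 0%Z n); split; first exact: repeat_length.
    move=> a; rewrite (hom1 (ha a)).
    by elim: n => //= n <-; rewrite (hom1 (Ehom hs)); gs.
  split=> [x y [cs [e h]] [ds [e' h']]|x [cs [e h]]].
    have [es [les ees]] := @pev_add cs ds s hs ltac:(congruence).
    by exists es; split; [congruence|move=> a; rewrite (ha a) h h' ees].
  exists (map Z.opp cs); split; first by rewrite length_map.
  by move=> a; rewrite (homV (ha a)) h pev_opp.
- exists (cs ++ [0%Z]); rewrite length_app /=; split; first lia.
  by move=> a; rewrite pev_rcons.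
have [t et] := sE _ (E_pev (repeat 0%Z n ++ [1%Z]) hs).
have [|cs [lcs hcs]] := hn (S n) t.
  exists (repeat 0%Z n ++ [1%Z]); rewrite length_app repeat_length /=; split; first lia.
  by move=> a; rewrite et.
exists (map Z.opp cs) => a.
rewrite mevA_pev // pev_opp // length_map lcs -hcs et pev_repeat //.
by gs.
Qed.

Fixpoint spanE (l : list A) (x : A) : Prop :=
  match l with
  | [] => x = one
  | a :: l => exists s y, E s /\ spanE l y /\ x = mul (s a) y
  end.

Lemma spanE_subgroup l : is_subgroup (spanE l).
Proof.
elim: l => [|a l [l1 [lM lV]]].
  by split=> //; split=> [x y -> ->|x ->]; gs.
split; first by exists (fun _ => one), one; split; [apply: E0|split=> //; gs].
split=> [x y [s [u [hs [hu ->]]]] [t [v [ht [hv ->]]]]|x [s [u [hs [hu ->]]]]].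
  exists (fun a => mul (s a) (t a)), (mul u v); split; first exact: (EA hs ht).
  by split; [apply: lM|gs; rewrite (mulCA u)].
exists (fun a => inv (s a)), (inv u); split; first exact: (EN hs).
by split; [apply: lV|rewrite invMg abA].
Qed.

Lemma spanE_stable l s x : E s -> spanE l x -> spanE l (s x).
Proof.
move=> hs; elim: l x => [|a l ih] x /=; first by move=> ->; rewrite (hom1 (Ehom hs)).
move=> [t [y [ht [hy ->]]]]; exists (fun a => s (t a)), (s y); rewrite (Ehom hs).
by split; [exact: (EM hs ht)|split=> //; apply: ih].
Qed.

(** Take the annihilator of [a] modulo [M] maximal. If [s (t a)] lies in [M] while [s a] and [t a]
    do not, then [t a] has a larger annihilator: it contains the old one by commutativity, and also
    [s]. *)
Lemma exists_prime (M : A -> Prop) a : is_subgroup M -> (forall s x, E s -> M x -> M (s x)) -> ~ M a ->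
  exists a', ~ M a' /\ forall s t, E s -> E t -> M (s (t a')) -> M (s a') \/ M (t a').
Proof.
move=> sM stM; have [T [i [nT [iE [sE ha]]]]] := E_group.
have IH := @noeth_ind T (fun I => forall a, ~ M a -> (forall t, I t <-> M (i t a)) ->
  exists a', ~ M a' /\ forall s t, E s -> E t -> M (s (t a')) -> M (s a') \/ M (t a')) nT.
move=> na; refine (IH _ (fun t => M (i t a)) (preim_subgroup (ha a) sM) a na (fun t => iff_refl _)).
move=> {a na}I sI ih a na hI; apply: NNPP => H.
have [s [t [hs [ht [hst [hns hnt]]]]]] : exists s t, E s /\ E t /\ M (s (t a)) /\ ~ M (s a) /\ ~ M (t a).
  apply: NNPP => H'; apply: H; exists a; split=> // s t hs ht hst.
  apply: NNPP => H''; apply: H'; exists s, t; do !split=> //; tauto.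
apply: H; refine (ih (fun r => M (i r (t a))) (preim_subgroup (ha (t a)) sM) _ _ (t a) hnt (fun t => iff_refl _)).
- by move=> r /hI hr; rewrite (EC (iE r) ht); apply: stM.
- by have [r er] := sE s hs; exists r; rewrite hI er.
Qed.

(** A filtration read from the tail of [l]. The finite list [L] may depend on the polynomial [cs],
    but serves all of its roots in [E]. *)
Fixpoint tame (l : list A) : Prop :=
  match l with
  | [] => True
  | a :: l => tame l /\ forall cs, exists L, forall s, E s -> (forall x, mevA cs s x = one) ->
      exists w y, In w L /\ spanE l y /\ s a = mul w y
  end.

(** Packed as a type, so that [E] is a commutative ring for Leibniz equality and the bound on roots
    applies. *)
Definition Ering := {s | E s}.

Lemma Ering_inj (s t : Ering) : (forall a, proj1_sig s a = proj1_sig t a) -> s = t.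
Proof.
case: s t => [s hs] [t ht] /= h; apply: subset_eq_compat.
exact: functional_extensionality.
Qed.

Definition Eadd (s t : Ering) : Ering := exist _ _ (EA (proj2_sig s) (proj2_sig t)).
Definition Emul (s t : Ering) : Ering := exist _ _ (EM (proj2_sig s) (proj2_sig t)).
Definition Eopp (s : Ering) : Ering := exist _ _ (EN (proj2_sig s)).
Definition Esub (s t : Ering) : Ering := Eadd s (Eopp t).
Definition Ezero : Ering := exist _ _ E0.
Definition Eone : Ering := exist _ _ E1.
Definition Ez (k : Z) : Ering := exist _ _ (Egz k).

Lemma Ering_theory : ring_theory Ezero Eone Eadd Emul Esub Eopp eq.
Proof.
split=> //.
- by move=> s; apply: Ering_inj => a /=; gs.
- by move=> s t; apply: Ering_inj => a /=; apply: abA.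
- by move=> s t r; apply: Ering_inj => a /=; gs.
- by move=> s; apply: Ering_inj.
- by move=> s t; apply: Ering_inj => a; apply: EC (proj2_sig s) (proj2_sig t) a.
- by move=> s t r; apply: Ering_inj.
- by move=> s t r; apply: Ering_inj.
- by move=> s; apply: Ering_inj => a /=; gs.
Qed.

Lemma mevA_mev cs (s : Ering) a :
  mevA cs (proj1_sig s) a = proj1_sig (mev Eone Eadd Emul (map Ez cs) s) a.
Proof. by elim: cs => //= c cs ->. Qed.

(* Since [a] is chosen with [(M : a)] prime, a monic polynomial has finitely many roots modulo
   [(M : a)], hence finitely many values [s a] modulo [M]. *)
Lemma tame_step l : ~ (forall x, spanE l x) ->
  exists a, ~ spanE l a /\ forall cs, exists L, forall s, E s -> (forall x, mevA cs s x = one) ->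
      exists w y, In w L /\ spanE l y /\ s a = mul w y.
Proof.
move=> nl; have [b nb] : exists b, ~ spanE l b.
  by apply: NNPP => H; apply: nl => x; apply: NNPP => H'; apply: H; exists x.
have sM := spanE_subgroup l; have [m1 [mM mV]] := sM.
have [a [na pa]] := exists_prime sM (@spanE_stable l) nb.
exists a; split=> // cs.
pose P (s : Ering) := spanE l (proj1_sig s a).
have [||//|L hL] := @roots_finite _ _ _ _ _ _ _ Ering_theory P _ _ _ (map Ez cs).
- by move=> s t hs ht; apply: mM => //; apply: mV.
- by move=> s t; exact: (pa _ _ (proj2_sig s) (proj2_sig t)).
exists (map (fun r : Ering => proj1_sig r a) L) => s hs es.
have [|w [hw hP]] := hL (exist _ s hs).
  by rewrite /P -mevA_mev es.
exists (proj1_sig w a), (mul (inv (proj1_sig w a)) (s a)); split; first by apply: (in_map (fun r : Ering => proj1_sig r a)).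
by split; [rewrite abA|gs].
Qed.

(** A proper span can always be enlarged by [tame_step], and Noetherian induction ends the
    process. *)
Lemma tame_filtration : exists l, tame l /\ forall x, spanE l x.
Proof.
suff : forall M, is_subgroup M -> forall l, tame l -> (forall x, M x <-> spanE l x) ->
    exists l, tame l /\ forall x, spanE l x.
  by move=> H; apply: (H (spanE []) (spanE_subgroup []) []).
apply: (noeth_ind nA) => M sM ih l tl hM.
case: (classic (forall x, spanE l x)) => [h|/tame_step [a [na ha]]]; first by exists l.
have inc x : spanE l x -> spanE (a :: l) x.
  by move=> hx; exists (fun _ => one), x; split; [apply: E0|split=> //; gs].
apply: (ih (spanE (a :: l)) _ _ _ (a :: l)) => //; first exact: spanE_subgroup.
  by move=> x /hM /inc.
exists a; rewrite hM; split=> //.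
by exists (fun a => a), one; split=> //; split; [case: (spanE_subgroup l)|gs].
Qed.
End Endo.
(** * The commutator pairing on the second center *)

Definition second_center (K : group) (a : K) := forall b, center (comm a b).
Notation Z2 := second_center.

Lemma Z2_cproj (K : group) (a : K) : Z2 a <-> center (cproj a).
Proof.
split=> h.
  move=> y; have [b <-] := cproj_surj y.
  by apply/comm_eq1; rewrite -hom_comm; [apply: cproj_hom|apply/cproj1].
move=> b; apply/cproj1; rewrite hom_comm; first exact: cproj_hom.
by apply/comm_eq1.
Qed.

Lemma Z2_subgroup (K : group) : is_subgroup (@Z2 K).
Proof.
have [h1 [h2 h3]] := preim_subgroup (@cproj_hom K) (center_subgroup (cquo K)).
split; first exact/Z2_cproj.
split=> [x y /Z2_cproj hx /Z2_cproj hy|x /Z2_cproj hx]; apply/Z2_cproj; [exact: h2|exact: h3].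
Qed.

Lemma center_Z2 (K : group) (a : K) : center a -> Z2 a.
Proof.
move=> h b; have -> : comm a b = one by apply/comm_eq1.
by case: (center_subgroup K).
Qed.

Lemma Z2_commMl (K : group) (x y b : K) : Z2 x -> comm (mul x y) b = mul (comm x b) (comm y b).
Proof. by move=> hx; rewrite comm_Ml (hx b y) mulKg. Qed.

Lemma Z2_commMr (K : group) (x b c : K) : Z2 x -> comm x (mul b c) = mul (comm x b) (comm x c).
Proof. by move=> hx; rewrite comm_Mr (hx b c) mulKg (hx b). Qed.

Lemma Z2_comm_eq (K : group) (x y b : K) : center (mul (inv x) y) -> comm x b = comm y b.
Proof.
move=> h; have -> : y = mul x (mul (inv x) y) by gs.
set z := mul (inv x) y in h *.
by rewrite comm_Ml -(h (comm x b)) mulKg (proj2 (comm_eq1 z b) (h b)) mulg1.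
Qed.

(** [A] presents [Z2(K)/Z(K)]. The projection [pr] is total but meaningful only on [Z2], and [rp]
    picks representatives, so no subset types occur in the formulas. *)
Record pairing (K A : group) (pr : K -> A) (rp : A -> K) : Prop := {
  pairA : abelian A;
  pairN : noeth K -> noeth A;
  pairM : forall x y, Z2 x -> Z2 y -> pr (mul x y) = mul (pr x) (pr y);
  pairE : forall x y, Z2 x -> Z2 y -> (pr x = pr y <-> center (mul (inv x) y));
  pairZ : forall a, Z2 (rp a);
  pairK : forall a, pr (rp a) = a
}.

Lemma pairing_exists (K : group) : exists (A : group) (pr : K -> A) (rp : A -> K), pairing pr rp.
Proof.
have [T [i [hi [ii [iZ sZ]]]]] := subgroup_group (Z2_subgroup K).
have nN : normal (fun t => center (i t)).
  split; first exact: (preim_subgroup hi (center_subgroup K)).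
  by move=> x y hx; rewrite !hi (homV hi) hx; gs.
have [g hg] : exists g : K -> T, forall x, Z2 x -> i (g x) = x.
  apply: (choice (fun x t => Z2 x -> i t = x)) => x.
  case: (classic (Z2 x)) => [/sZ [t et]|nx]; first by exists t.
  by exists one.
have [r hr] := surj_inv (@proj_surj _ _ nN).
have gM x y : Z2 x -> Z2 y -> g (mul x y) = mul (g x) (g y).
  move=> hx hy; apply: ii; rewrite hi !hg //.
  by apply: (proj1 (proj2 (Z2_subgroup K))).
exists (quo nN), (fun x => proj nN (g x)), (fun a => i (r a)); split.
- move=> x y; have [a <-] := proj_surj x; have [b <-] := proj_surj y.
  rewrite -!proj_hom; apply/proj_eq.
  have -> : mul (inv (mul a b)) (mul b a) = comm b a by rewrite /comm; gs.
  by rewrite (hom_comm hi); apply: iZ.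
- move=> nK; apply: (noeth_surj (proj_hom nN) (@proj_surj _ _ nN)).
  by apply: (noeth_inj hi _ nK) => x; rewrite -(hom1 hi) => /ii.
- by move=> x y hx hy; rewrite gM // proj_hom.
- by move=> x y hx hy; rewrite proj_eq hi (homV hi) !hg.
- by move=> a; apply: iZ.
- move=> a; rewrite -[RHS]hr; apply/proj_eq; rewrite hi (homV hi) hg //.
  by gs; case: (center_subgroup K).
Qed.

Section Ring.
Variables (K A : group) (pr : K -> A) (rp : A -> K).
Hypothesis P : pairing pr rp.

Definition pair (a : A) (b : K) : K := comm (rp a) b.

Lemma pair_pr x b : Z2 x -> pair (pr x) b = comm x b.
Proof.
move=> hx; apply: Z2_comm_eq; apply/(pairE P) => //; first exact: (pairZ P).
by rewrite (pairK P).
Qed.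

Lemma pairMl a b c : pair (mul a b) c = mul (pair a c) (pair b c).
Proof.
rewrite -Z2_commMl; first exact: (pairZ P).
have hM : Z2 (mul (rp a) (rp b)) by apply: (proj1 (proj2 (Z2_subgroup K))); apply: (pairZ P).
rewrite -pair_pr // (pairM P) ?(pairK P) //; exact: (pairZ P).
Qed.

Lemma pairMr a b c : pair a (mul b c) = mul (pair a b) (pair a c).
Proof. by apply/Z2_commMr/(pairZ P). Qed.

Lemma pair1l b : pair one b = one.
Proof. by apply: (@mulIg _ (pair one b)); rewrite -pairMl; gs. Qed.

Lemma pair1r a : pair a one = one.
Proof. by apply: (@mulIg _ (pair a one)); rewrite -pairMr; gs. Qed.

Lemma pairVl a b : pair (inv a) b = inv (pair a b).
Proof. by apply: (@mulIg _ (pair a b)); rewrite -pairMl; gs; apply: pair1l. Qed.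

Lemma pairVr a b : pair a (inv b) = inv (pair a b).
Proof. by apply: (@mulIg _ (pair a b)); rewrite -pairMr; gs; apply: pair1r. Qed.

Lemma pair_inj a a' : (forall b, pair a b = pair a' b) -> a = a'.
Proof.
move=> h; apply/eq_invmul; rewrite -(pairK P (mul _ _)).
have c1 : center (@one K) by case: (center_subgroup K).
have -> : one = pr one.
  by have := pairM P (center_Z2 c1) (center_Z2 c1); gs => e; apply: (@mulIg _ (pr one)); rewrite -e; gs.
apply/(pairE P); [exact: (pairZ P)|exact: center_Z2|]; gs.
apply: (proj2 (proj2 (center_subgroup K))) => b; apply/comm_eq1.
by have := pairMl (inv a) a' b; rewrite pairVl h; gs.
Qed.

(** The two arguments of the pairing live in different groups, so the adjoint [t] acts on [K].
    Additivity of [s] follows from nondegeneracy on the side of [A]. *)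
Definition selfadj (s : A -> A) := exists t : K -> K, forall a b, pair (s a) b = pair a (t b).

Lemma selfadj_hom s : selfadj s -> is_hom s.
Proof. by move=> [t ht] a b; apply: pair_inj => c; rewrite pairMl !ht pairMl. Qed.

Lemma selfadj_id : selfadj (fun a => a).
Proof. by exists id. Qed.

Lemma selfadj_M s t : selfadj s -> selfadj t -> selfadj (fun a => s (t a)).
Proof. by move=> [s' hs] [t' ht]; exists (fun b => t' (s' b)) => a b; rewrite hs ht. Qed.

Lemma selfadj_A s t : selfadj s -> selfadj t -> selfadj (fun a => mul (s a) (t a)).
Proof. by move=> [s' hs] [t' ht]; exists (fun b => mul (s' b) (t' b)) => a b; rewrite pairMl hs ht pairMr. Qed.

Lemma selfadj_N s : selfadj s -> selfadj (fun a => inv (s a)).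
Proof. by move=> [s' hs]; exists (fun b => inv (s' b)) => a b; rewrite pairVl hs pairVr. Qed.

(** The center is taken in order to obtain a commutative ring, as needed for prime annihilators; it
    remains definable, since self-adjoint maps are coded by tuples. *)
Definition scal (s : A -> A) := selfadj s /\ forall r, selfadj r -> forall a, s (r a) = r (s a).

Lemma scal_hom s : scal s -> is_hom s.
Proof. by move=> [/selfadj_hom]. Qed.

Lemma scal_id : scal (fun a => a).
Proof. by split; [apply: selfadj_id|]. Qed.

Lemma scal_M s t : scal s -> scal t -> scal (fun a => s (t a)).
Proof. by move=> [hs cs] [ht ct]; split; [apply: selfadj_M|move=> r hr a; rewrite ct // cs]. Qed.

Lemma scal_A s t : scal s -> scal t -> scal (fun a => mul (s a) (t a)).
Proof. by move=> [hs cs] [ht ct]; split; [apply: selfadj_A|move=> r hr a; rewrite ct // cs // (selfadj_hom hr)]. Qed.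

Lemma scal_N s : scal s -> scal (fun a => inv (s a)).
Proof. by move=> [hs cs]; split; [apply: selfadj_N|move=> r hr a; rewrite cs // (homV (selfadj_hom hr))]. Qed.

Lemma scal_C s t : scal s -> scal t -> forall a, s (t a) = t (s a).
Proof. by move=> [hs cs] [ht ct]; apply: cs. Qed.
End Ring.

(* First-order counterparts: when [e] separates the second center, a self-adjoint [s] with adjoint
   [t] is coded by the tuple [v j = t (e j)]. *)
Section Codes.
Variables (n : nat) (K : group) (e : fin n -> K).

Definition separates := forall x : K, Z2 x -> (forall j, comm x (e j) = one) -> center x.

Definition graph (v : fin n -> K) (a u : K) := Z2 a /\ Z2 u /\ forall j, comm u (e j) = comm a (v j).

(** An arbitrary tuple need not define a map. The first clause makes the graph total; the second
    provides the adjoint at every [b], beyond the [e j]. *)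
Definition adj_code (v : fin n -> K) :=
  (forall a, Z2 a -> exists u, graph v a u) /\
  (forall b, exists w, forall a u, graph v a u -> comm u b = comm a w).

(** [w] codes an arbitrary self-adjoint map; [u2] and [u4] are the two composites at [a], compared
    modulo the center. *)
Definition scal_code (v : fin n -> K) := adj_code v /\
  forall w, adj_code w -> forall a u1 u2 u3 u4,
    graph v a u1 -> graph w u1 u2 -> graph w a u3 -> graph v u3 u4 -> center (mul (inv u2) u4).

(** The counterpart of [spanE] on representatives in [K], with codes in place of scalars; [poly] is
    the counterpart of [mevA] in the same sense. *)
Fixpoint span (l : list K) (x : K) : Prop :=
  match l with
  | [] => center x
  | a :: l => exists v, exists u y, scal_code v /\ graph v a u /\ span l y /\ x = mul u y
  end.

Fixpoint poly (v : fin n -> K) (cs : list Z) (a u : K) : Prop :=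
  match cs with
  | [] => Z2 a /\ Z2 u /\ center (mul (inv a) u)
  | c :: cs => Z2 u /\ exists u1 u2, poly v cs a u1 /\ graph v u1 u2 /\ center (mul (inv u) (mul (gz a c) u2))
  end.

Definition root (v : fin n -> K) (cs : list Z) := forall a u, poly v cs a u -> center u.

(** Each entry of [wl] pairs a word for a generator of the filtration with words for coset
    representatives. Only the polynomials in the finite list [Qs] are treated, which keeps the
    condition a single formula. *)
Fixpoint tame_code (Qs : list (list Z)) (wl : list (word (fin n) * list (word (fin n)))) : Prop :=
  match wl with
  | [] => True
  | (w, L) :: wl => tame_code Qs wl /\
      forall cs, In cs Qs -> forall v, scal_code v -> root v cs ->
        exists o, In o L /\ exists u y, graph v (weval e w) u /\
          span (map (fun p => weval e (fst p)) wl) y /\ u = mul (weval e o) y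
  end.

Definition tame_basis Qs wl := separates /\
  (forall x, Z2 x -> span (map (fun p => weval e (fst p)) wl) x) /\ tame_code Qs wl.

Variables (A : group) (pr : K -> A) (rp : A -> K).
Hypothesis P : pairing pr rp.
Hypothesis sep : separates.

Let Z2M := proj1 (proj2 (Z2_subgroup K)).
Let Z2V := proj2 (proj2 (Z2_subgroup K)).

Lemma pr1 z : center z -> pr z = one.
Proof.
move=> h; have hz := center_Z2 h.
have c1 : Z2 (@one K) by case: (Z2_subgroup K).
have e1 : pr one = one.
  by have := pairM P c1 c1; gs => E; apply: (@mulIg _ (pr one)); rewrite -E; gs.
rewrite -e1; apply/(pairE P) => //; gs.
exact: (proj2 (proj2 (center_subgroup K))).
Qed.

Lemma sep_eq x y : Z2 x -> Z2 y -> (forall j, comm x (e j) = comm y (e j)) -> pr x = pr y.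
Proof.
move=> hx hy h; apply/(pairE P) => //; apply: sep; first by apply: Z2M => //; apply: Z2V.
move=> j; rewrite Z2_commMl; first exact: Z2V.
rewrite -h -Z2_commMl; first exact: Z2V.
by gs; rewrite /comm; gs.
Qed.

Lemma pr_eq_comm x y b : Z2 x -> Z2 y -> pr x = pr y -> comm x b = comm y b.
Proof. by move=> hx hy /(pairE P hx hy); apply: Z2_comm_eq. Qed.

Definition codes (v : fin n -> K) (s : A -> A) :=
  forall a u, Z2 a -> Z2 u -> (graph v a u <-> s (pr a) = pr u).

(** Totality and separation make the graph a map on [Z2/Z]; choice in the second clause of
    [adj_code] yields its adjoint. *)
Lemma adj_code_selfadj v : adj_code v -> exists s, selfadj rp s /\ codes v s.
Proof.
move=> [tot adj].
have [f hf] := choice (fun a u => graph v (rp a) u) (fun a => tot (rp a) (pairZ P a)).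
have cv : codes v (fun a => pr (f a)).
  move=> a u ha hu; have [h1 [h2 h3]] := hf (pr a).
  have E b : comm (rp (pr a)) b = comm a b by apply: pr_eq_comm => //; rewrite (pairK P).
  split=> [[_ [_ h]]|h].
    by apply: sep_eq => // j; rewrite h3 h E.
  split=> //; split=> // j.
  by rewrite -(pr_eq_comm (e j) h2 hu h) h3 E.
exists (fun a => pr (f a)); split=> //.
have [g hg] := choice _ adj; exists g => a b.
have [_ [h2 _]] := hf a.
by rewrite (pair_pr P) //; apply: hg.
Qed.

(** The values of the adjoint at the [e j] determine [s], because commutators with the [e j]
    separate [Z2] modulo the center. *)
Lemma selfadj_adj_code s : selfadj rp s -> exists v, adj_code v /\ codes v s.
Proof.
move=> [t ht]; exists (fun j => t (e j)).
have cv : codes (fun j => t (e j)) s.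
  move=> a u ha hu.
  have E j : comm (rp (s (pr a))) (e j) = comm a (t (e j)).
    by have := ht (pr a) (e j); rewrite (pair_pr P _ ha).
  split=> [[_ [_ h]]|h].
    rewrite -(pairK P (s _)); apply: sep_eq => //; first exact: (pairZ P).
    by move=> j; rewrite E h.
  split=> //; split=> // j; rewrite -E; apply: pr_eq_comm => //; first exact: (pairZ P).
  by rewrite (pairK P).
split=> //; split.
  move=> a ha; exists (rp (s (pr a))); apply/cv => //; first exact: (pairZ P).
  by rewrite (pairK P).
move=> b; exists (t b) => a u hg; have [ha [hu _]] := hg.
move: hg => /(cv _ _ ha hu) h.
by rewrite -(pair_pr P b hu) -h ht (pair_pr P _ ha).
Qed.

Lemma scal_code_scal v : scal_code v -> exists s, scal rp s /\ codes v s.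
Proof.
move=> [hv hc]; have [s [ss cs]] := adj_code_selfadj hv.
exists s; split=> //; split=> // r sr a.
have [w [hw cw]] := selfadj_adj_code sr.
have rpZ := pairZ P; have rpK := pairK P.
have := hc w hw (rp a) (rp (s a)) (rp (r (s a))) (rp (r a)) (rp (s (r a))).
rewrite -(pairE P) // !rpK => h; apply/eq_sym/h.
- by apply/cs => //; rewrite !rpK.
- by apply/cw => //; rewrite !rpK.
- by apply/cw => //; rewrite !rpK.
- by apply/cs => //; rewrite !rpK.
Qed.

Lemma scal_scal_code s : scal rp s -> exists v, scal_code v /\ codes v s.
Proof.
move=> [ss hs]; have [v [hv cv]] := selfadj_adj_code ss.
exists v; split=> //; split=> // w hw a u1 u2 u3 u4 h1 h2 h3 h4.
have [r [sr cr]] := adj_code_selfadj hw.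
have [a0 [z1 _]] := h1; have [_ [z2 _]] := h2; have [_ [z3 _]] := h3; have [_ [z4 _]] := h4.
move: h1 h2 h3 h4 => /(cv _ _ a0 z1) h1 /(cr _ _ z1 z2) h2 /(cr _ _ a0 z3) h3 /(cv _ _ z3 z4) h4.
by apply/(pairE P) => //; rewrite -h2 -h4 -h1 -h3 hs.
Qed.

Lemma span_spanE l x : span l x -> Z2 x /\ spanE (scal rp) (map pr l) (pr x).
Proof.
elim: l x => [|a l ih] x /=; first by move=> h; split; [apply: center_Z2|apply: pr1].
move=> [v [u [y [hv [hg [/ih [zy hy] ->]]]]]].
have [za [zu _]] := hg.
split; first exact: Z2M.
have [s [ss cs]] := scal_code_scal hv.
exists s, (pr y); split=> //; split=> //.
by rewrite (pairM P) //; congr mul; apply/eq_sym/cs.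
Qed.

Lemma spanE_span l x : (forall a, In a l -> Z2 a) -> Z2 x -> spanE (scal rp) (map pr l) (pr x) -> span l x.
Proof.
elim: l x => [|a l ih] x /= hl zx.
  move=> h1; have c1 : center (@one K) by case: (center_subgroup K).
  have := proj1 (pairE P (center_Z2 c1) zx); rewrite pr1 // h1; gs; exact.
move=> [s [y [ss [hy ex]]]].
have [v [hv cv]] := scal_scal_code ss.
have za : Z2 a by apply: hl; left.
pose u := rp (s (pr a)).
have zu : Z2 u by apply: (pairZ P).
have zy : Z2 (mul (inv u) x) by apply: Z2M => //; apply: Z2V.
exists v, u, (mul (inv u) x); split=> //; split; first by apply/cv => //; rewrite (pairK P).
split; last by gs.
apply: ih => //; first by move=> b hb; apply: hl; right.
suff -> : pr (mul (inv u) x) = y by [].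
apply: (@mulIg _ (pr u)); rewrite -(pairM P) //; gs.
by rewrite ex (pairK P).
Qed.

Lemma poly_mevA v s cs a u : is_hom s -> codes v s -> Z2 a ->
  (poly v cs a u <-> Z2 u /\ mevA cs s (pr a) = pr u).
Proof.
move=> hs cv za; have rpZ := pairZ P; have rpK := pairK P.
elim: cs u => [|c cs ih] u /=.
  split=> [[_ [zu h]]|[zu h]]; first by split=> //; apply/(pairE P).
  by split=> //; split=> //; apply/(pairE P).
have prgz : Z2 (gz a c) /\ pr (gz a c) = gz (pr a) c.
  have Q m : pr (gpow a m) = gpow (pr a) m.
    elim: m => [|m ihm] /=; first by apply: pr1; case: (center_subgroup K).
    by rewrite (pairM P) ?ihm //; exact: (gpow_sub m (Z2_subgroup K) za).
  split; first exact: (gz_sub c (Z2_subgroup K) za).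
  case: c => [|m|m] /=; rewrite ?Q //; first by apply: pr1; case: (center_subgroup K).
  apply: (@mulIg _ (pr (gpow a (Pos.to_nat m)))).
  have zm : Z2 (gpow a (Pos.to_nat m)) by exact: (gpow_sub _ (Z2_subgroup K) za).
  rewrite -(pairM P) //; first exact: Z2V.
  by rewrite -Q; gs; apply: pr1; case: (center_subgroup K).
case: prgz => zg eg.
split=> [[zu [u1 [u2 [/ih [z1 h1] [hg h]]]]]|[zu h]].
  split=> //; have [_ [z2 _]] := hg.
  move: hg => /(cv _ _ z1 z2) h2.
  rewrite h1 h2 -eg -(pairM P) //; apply/eq_sym/(pairE P) => //; exact: Z2M.
split=> //; exists (rp (mevA cs s (pr a))), (rp (s (mevA cs s (pr a)))).
split; first by apply/ih; rewrite rpK.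
split; first by apply/cv => //; rewrite !rpK.
apply/(pairE P) => //; first exact: Z2M.
by rewrite (pairM P) // eg rpK -h.
Qed.

Lemma root_mevA v s cs : is_hom s -> codes v s -> (root v cs <-> forall x, mevA cs s x = one).
Proof.
move=> hs cv; have rpZ := pairZ P; have rpK := pairK P.
have c1 : center (@one K) by case: (center_subgroup K).
split=> [h x|h a u hp].
  rewrite -[LHS]rpK; apply: pr1; apply: (h (rp x)).
  by apply/(poly_mevA _ _ hs cv) => //; rewrite !rpK.
have za : Z2 a.
  have Q : forall cs u, poly v cs a u -> Z2 a.
    by elim=> [|c cs' ih] u' /= => [[]|[_ [u1 [u2 [/ih]]]]].
  exact: Q hp.
move: hp => /(poly_mevA _ _ hs cv za) [zu]; rewrite h => e1.
have := proj1 (pairE P (center_Z2 c1) zu); rewrite pr1 //; gs; exact.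
Qed.
End Codes.

(** * Definability of the codes *)

Lemma utm_weval n (V : Type) (E : fin n -> forall K : group, (V -> K) -> K) (w : word (fin n)) :
  (forall j, utm (E j)) -> utm (fun K f => weval (fun j => E j K f) w).
Proof.
move=> hE; elim: w => [v||s hs t ht|t ht] /=; [exact: hE|exact: utm_one|exact: utm_mul|exact: utm_inv].
Qed.

Ltac utm_tac :=
  intros; cbv beta;
  first
  [ assumption
  | match goal with h : utm ?t |- utm (fun K f => ?t K (fun v => f _)) => eapply (utm_sub _ h) end
  | match goal with h : forall j, utm (?t j) |- utm (fun K f => ?t ?j K (fun v => f _)) => eapply (utm_sub _ (h j)) end
  | match goal with h : forall j, utm (?t j) |- _ => exact (h _) end
  | apply utm_var
  | apply utm_one
  | apply utm_mul; utm_tac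
  | apply utm_inv; utm_tac
  | apply utm_comm; utm_tac
  | apply utm_gz; utm_tac
  | apply utm_pow; utm_tac
  | apply (@utm_weval _ _ (fun j K f => _)); utm_tac ].

Ltac dfn_step :=
  first
  [ apply dfn_and
  | apply dfn_imp
  | apply dfn_eq; utm_tac
  | apply dfn_center; utm_tac
  | apply dfn_all; cbv beta
  | apply dfn_ex; cbv beta
  | apply dfn_all_tuple; cbv beta
  | apply dfn_ex_tuple; cbv beta
  | apply dfn_all_fin; intro ].

Section Definability.
Variable V : Type.

Lemma dfn_Z2 t : utm t -> dfn (fun K (f : V -> K) => Z2 (t K f)).
Proof. by move=> ht; rewrite /second_center; repeat dfn_step. Qed.
End Definability.

Section Definability2.
Variables (n : nat).

Lemma dfn_separates (V : Type) (E : fin n -> forall K : group, (V -> K) -> K) :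
  (forall j, utm (E j)) -> dfn (fun K f => separates (fun j => E j K f)).
Proof.
move=> hE; rewrite /separates; do 2!dfn_step; first by apply: dfn_Z2; utm_tac.
by repeat dfn_step.
Qed.

Lemma dfn_graph (V : Type) (E v : fin n -> forall K : group, (V -> K) -> K) a u :
  (forall j, utm (E j)) -> (forall j, utm (v j)) -> utm a -> utm u ->
  dfn (fun K f => graph (fun j => E j K f) (fun j => v j K f) (a K f) (u K f)).
Proof.
move=> hE hv ha hu; rewrite /graph; do 2![dfn_step; first by apply: dfn_Z2; utm_tac].
by repeat dfn_step.
Qed.

Lemma dfn_adj_code (V : Type) (E v : fin n -> forall K : group, (V -> K) -> K) :
  (forall j, utm (E j)) -> (forall j, utm (v j)) ->
  dfn (fun K f => adj_code (fun j => E j K f) (fun j => v j K f)).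
Proof.
move=> hE hv; rewrite /adj_code; dfn_step.
  do 2!dfn_step; first by apply: dfn_Z2; utm_tac.
  dfn_step.
  apply dfn_graph; utm_tac.
do 4!dfn_step; dfn_step; last by dfn_step.
apply dfn_graph; utm_tac.
Qed.

Lemma dfn_scal_code (V : Type) (E v : fin n -> forall K : group, (V -> K) -> K) :
  (forall j, utm (E j)) -> (forall j, utm (v j)) ->
  dfn (fun K f => scal_code (fun j => E j K f) (fun j => v j K f)).
Proof.
move=> hE hv; rewrite /scal_code; dfn_step; first by apply dfn_adj_code.
dfn_step; dfn_step; first by apply dfn_adj_code; utm_tac.
do 5!dfn_step.
do 4![dfn_step; first by apply dfn_graph; utm_tac].
by dfn_step.
Qed.

Lemma dfn_span (l : list (word (fin n))) (V : Type) (E : fin n -> forall K : group, (V -> K) -> K) x :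
  (forall j, utm (E j)) -> utm x ->
  dfn (fun K f => span (fun j => E j K f) (map (weval (fun j => E j K f)) l) (x K f)).
Proof.
elim: l V E x => [|w l ih] V E x hE hx /=; first by dfn_step.
do 3!dfn_step; dfn_step; first by apply dfn_scal_code; utm_tac.
dfn_step; first by apply dfn_graph; utm_tac.
dfn_step; last by dfn_step.
apply: (ih _ (fun j K f => E j K (fun v => f (Some (Some (inl v))))) (fun K f => f None)); utm_tac.
Qed.

Lemma dfn_poly (cs : list Z) (V : Type) (E v : fin n -> forall K : group, (V -> K) -> K) a u :
  (forall j, utm (E j)) -> (forall j, utm (v j)) -> utm a -> utm u ->
  dfn (fun K f => poly (fun j => E j K f) (fun j => v j K f) cs (a K f) (u K f)).
Proof.
elim: cs V E v a u => [|c cs ih] V E v a u hE hv ha hu /=.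
  do 2![dfn_step; first by apply: dfn_Z2; utm_tac].
  by dfn_step.
dfn_step; first by apply: dfn_Z2; utm_tac.
do 2!dfn_step; dfn_step.
  apply: (ih _ (fun j K f => E j K (fun v => f (Some (Some v)))) (fun j K f => v j K (fun v => f (Some (Some v))))
    (fun K f => a K (fun v => f (Some (Some v)))) (fun K f => f (Some None))); utm_tac.
by dfn_step; [apply dfn_graph; utm_tac|dfn_step].
Qed.

Lemma dfn_root (cs : list Z) (V : Type) (E v : fin n -> forall K : group, (V -> K) -> K) :
  (forall j, utm (E j)) -> (forall j, utm (v j)) ->
  dfn (fun K f => root (fun j => E j K f) (fun j => v j K f) cs).
Proof.
move=> hE hv; rewrite /root; do 3!dfn_step; first by apply dfn_poly; utm_tac.
by dfn_step.
Qed.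

Lemma dfn_tame_code Qs wl : dfn (fun K (e : fin n -> K) => tame_code e Qs wl).
Proof.
elim: wl => [|[w L] wl ih] /=; first exact: dfn_const.
dfn_step => //.
apply dfn_all_list => cs.
do 2!dfn_step; first by apply dfn_scal_code; utm_tac.
dfn_step; first by apply dfn_root; utm_tac.
apply dfn_ex_list => o.
do 2!dfn_step; dfn_step; first by apply dfn_graph; utm_tac.
dfn_step; last by dfn_step.
have := @dfn_span (map fst wl) (option (option (fin n + fin n))) (fun j K f => f (Some (Some (inl j)))) (fun K f => f None) ltac:(utm_tac) ltac:(utm_tac).
by apply: dfn_ext => K f; rewrite map_map.
Qed.

Lemma dfn_tame_basis Qs wl : dfn (fun K (e : fin n -> K) => tame_basis e Qs wl).
Proof.
rewrite /tame_basis; dfn_step; first by apply dfn_separates; utm_tac.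
dfn_step; last exact: dfn_tame_code.
do 2!dfn_step; first by apply: dfn_Z2; utm_tac.
have := @dfn_span (map fst wl) (option (fin n)) (fun j K f => f (Some j)) (fun K f => f None) ltac:(utm_tac) ltac:(utm_tac).
by apply: dfn_ext => K f; rewrite map_map.
Qed.
End Definability2.

(** * Generation modulo the center from a first-order condition *)

Definition generates n (K : group) (e : fin n -> K) := forall x, exists w, x = weval e w.

Lemma generates_separates n (K : group) (e : fin n -> K) : generates e -> separates e.
Proof.
move=> ge x hx h b; have [w ->] := ge b; apply/comm_eq1.
have nM : normal (fun z : K => z = one).
  split; last by move=> y z ->; gs.
  by split=> //; split=> [y z -> ->|y ->]; gs.
have [s1 [sM sV]] := commr_subgroup x nM.
elim: w => [j||s hs t ht|t ht] /=; [exact: h|exact: s1|exact: sM|exact: sV].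
Qed.

Lemma scal_tame_filtration (K A : group) (pr : K -> A) (rp : A -> K) : pairing pr rp -> noeth K ->
  exists l, tame (scal rp) l /\ forall x, spanE (scal rp) l x.
Proof.
move=> P nK; apply: tame_filtration.
- exact: (pairN P).
- exact: (pairA P).
- exact: (scal_hom P).
- exact: scal_id.
- exact: scal_M.
- exact: (scal_A P).
- exact: (scal_N P).
- exact: scal_C.
Qed.

(** [Qs] is arbitrary here, so that it can later be dictated by the other group. The filtration and
    its coset representatives become words because [e] generates. *)
Lemma tame_basis_exists n (K : group) (e : fin n -> K) Qs : noeth K -> generates e ->
  exists wl, tame_basis e Qs wl.
Proof.
move=> nK ge; have sep := generates_separates ge.
have [A [pr [rp P]]] := pairing_exists K.
have rpZ := pairZ P; have rpK := pairK P.
have [Z1 [Z2M Z2V]] := Z2_subgroup K.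
have [l [tl fl]] := scal_tame_filtration P nK.
have [g hg] : exists g : A -> word (fin n), forall a, weval e (g a) = rp a.
  by apply: (choice (fun a w => weval e w = rp a)) => a; have [w ->] := ge (rp a); exists w.
suff [wl [ew [zw tw]]] : exists wl : list (word (fin n) * list (word (fin n))),
  map pr (map (fun p => weval e (fst p)) wl) = l /\ (forall a, In a (map (fun p => weval e (fst p)) wl) -> Z2 a) /\
  tame_code e Qs wl.
  exists wl; split=> //; split=> // x zx; apply: (spanE_span P sep) => //.
  by rewrite ew.
elim: l tl {fl} => [|a l ih] /=; first by exists [].
move=> [/ih [wl [ew [zw tw]]] fin].
have [L hL] : exists L : list A, forall cs, In cs Qs -> forall s, scal rp s -> (forall x, mevA cs s x = one) ->
    exists w y, In w L /\ spanE (scal rp) l y /\ s a = mul w y.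
  elim: Qs {ih ew zw tw} => [|cs Qs [L hL]]; first by exists [].
  have [L' hL'] := fin cs; exists (L ++ L') => cs' [<-|hcs] s hs es.
    have [w [y [hw hy]]] := hL' s hs es.
    by exists w, y; split=> //; apply: in_or_app; right.
  have [w [y [hw hy]]] := hL cs' hcs s hs es.
  by exists w, y; split=> //; apply: in_or_app; left.
exists ((g a, map g L) :: wl); split; first by rewrite /= ew hg rpK.
split; first by move=> b [<-|/zw //] /=; rewrite hg.
split=> // cs hcs v hv hr.
have [s [ss cs']] := scal_code_scal P sep hv.
have es := proj1 (root_mevA P cs (scal_hom P ss) cs') hr.
have [w [y [hw [hy ey]]]] := hL cs hcs s ss es.
exists (g w); split; first exact: in_map.
have zy : Z2 (mul (inv (weval e (g w))) (rp (s a))) by rewrite hg; apply: Z2M => //; apply: Z2V.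
exists (rp (s a)), (mul (inv (weval e (g w))) (rp (s a))); split.
  by rewrite /= hg; apply/cs' => //; rewrite !rpK.
split; last by gs.
apply: (spanE_span P sep) => //; rewrite ew.
suff -> : pr (mul (inv (weval e (g w))) (rp (s a))) = y by [].
have zg : Z2 (weval e (g w)) by rewrite hg.
apply: (@mulIg _ (pr (weval e (g w)))); rewrite -(pairM P) //.
by rewrite mulVKg hg !rpK ey.
Qed.

(** [Qs] consists of monic polynomials annihilating additive generators of the ring of scalars, and
    so depends on [K] alone, before any tuple or words are given. *)
Lemma tame_basis_generates (K : group) : noeth K -> exists Qs, forall n (e : fin n -> K) wl,
  tame_basis e Qs wl -> forall x, Z2 x -> exists w z, center z /\ x = mul (weval e w) z.
Proof.
move=> nK; have [A [pr [rp P]]] := pairing_exists K.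
have rpZ := pairZ P; have rpK := pairK P.
have [Z1 [Z2M Z2V]] := Z2_subgroup K.
have [ts [hts gts]] := E_fg (pairN P nK) (scal_hom P) (scal_id rp) (scal_A P) (@scal_N _ _ _ _ P).
have [Qs hQs] : exists Qs, forall t, In t ts -> exists cs, In cs Qs /\ forall a, mevA cs t a = one.
  elim: ts hts {gts} => [|t ts ih] hts; first by exists [].
  have [Qs hQs] := ih (fun t h => hts t (or_intror h)).
  have [cs hcs] := E_integral (pairN P nK) (pairA P) (scal_hom P) (scal_id rp) (@scal_M _ _ rp)
     (scal_A P) (@scal_N _ _ _ _ P) (hts t (or_introl eq_refl)).
  exists (cs :: Qs) => t' [<-|/hQs [cs' [h1 h2]]]; first by exists cs; split=> //; left.
  by exists cs'; split=> //; right.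
exists Qs => n e wl [sep [full tw]] x zx.
(* [Lam] is the part of [Z2/Z] reached by words in [e]; induction along the filtration shows that it
   is everything. *)
pose Lam (b : A) := exists w, Z2 (weval e w) /\ pr (weval e w) = b.
have sLam : is_subgroup Lam.
  split; first by exists wone; split=> //=; apply: (pr1 P); case: (center_subgroup K).
  split=> [a b [w [zw <-]] [w' [zw' <-]]|a [w [zw <-]]].
    by exists (wmul w w') => /=; rewrite (pairM P) //; split=> //; apply: Z2M.
  exists (winv w) => /=; split; first exact: Z2V.
  apply: (@mulIg _ (pr (weval e w))); rewrite -(pairM P) //; first exact: Z2V.
  by gs; apply: (pr1 P); case: (center_subgroup K).
suff W : forall b, spanE (scal rp) (map pr (map (fun p => weval e (fst p)) wl)) b -> Lam b.
  have [_ /W [w [zw ew]]] := span_spanE P sep (full x zx).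
  exists w, (mul (inv (weval e w)) x); split; last by gs.
  by apply/(pairE P).
elim: wl tw {full} => [|[w L] wl ih] /=; first by move=> _ b ->; case: sLam.
move=> [/ih {}ih tw] b [s [y [ss [/ih hy ->]]]].
apply: (proj1 (proj2 sLam)) => //.
(* An arbitrary scalar is a sum of the chosen generators and their negatives, so only the values of
   these generators have to be reached; they are roots of polynomials in [Qs]. *)
apply: (gen_sub sLam _ (gts s _ ss)) => c [t [ht ->]].
have [cs [hcs et]] := hQs t ht.
have [v [hv cv]] := scal_scal_code P sep (hts t ht).
have hr := proj2 (root_mevA P cs (scal_hom P (hts t ht)) cv) et.
have [o [ho [u [y' [hg [hsp eu]]]]]] := tw cs hcs v hv hr.
have [za [zu _]] := hg.
move: hg => /(cv _ _ za zu) ->.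
have [zy /ih [w' [zw' ew']]] := span_spanE P sep hsp.
have zo : Z2 (weval e o).
  have -> : weval e o = mul u (inv y') by rewrite eu; gs.
  by apply: Z2M => //; apply: Z2V.
exists (wmul o w') => /=; split; first exact: Z2M.
by rewrite eu !(pairM P) // ew'.
Qed.

(** The length of the upper central series, expressed by repeated quotients to fit the induction
    through [cquo]. *)
Fixpoint center_class (c : nat) (K : group) : Prop :=
  match c with 0 => forall x : K, x = one | S c => center_class c (cquo K) end.

Lemma lcs_center_class c (K : group) : (forall x : K, lcs c x -> x = one) -> center_class c K.
Proof.
elim: c K => [|c ih] K h /=; first by move=> x; apply: h.
apply: ih => y hy; have [x [hx <-]] := lcs_quo (@cproj_hom K) (@cproj_surj K) hy.
apply/cproj1 => z; apply/comm_eq1; apply: h; exact: lcs_comm.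
Qed.

Lemma noeth_cquo (K : group) : noeth K -> noeth (cquo K).
Proof. exact: (noeth_surj (@cproj_hom K) (@cproj_surj K)). Qed.

Lemma weval_hom (V : Type) (K Q : group) (p : K -> Q) (e : V -> K) w : is_hom p ->
  p (weval e w) = weval (fun v => p (e v)) w.
Proof. by move=> hp; elim: w => //= [|s <- t <-|t <-]; [apply: hom1|apply: hp|apply: homV]. Qed.

Lemma definable_generation c n (G H : group) (e : fin n -> G) : noeth G -> noeth H ->
  center_class c H -> generates e ->
  exists T : forall K : group, (fin n -> K) -> Prop, dfn T /\ T G e /\
    forall e', T H e' -> forall h, exists w z, center z /\ h = mul (weval e' w) z.
Proof.
elim: c G H e => [|c ih] G H e nG nH hc ge.
  exists (fun K e => True); split; first exact: dfn_const.
  split=> // e' _ h; exists wone, h; split; last by rewrite /=; gs.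
  by move=> x; rewrite (hc h) (hc x).
have [|T1 [d1 [h1 g1]]] := ih (cquo G) (cquo H) (fun v => cproj (e v)) (noeth_cquo nG) (noeth_cquo nH) hc.
  move=> y; have [x <-] := cproj_surj y; have [w ->] := ge x.
  by exists w; apply/weval_hom/cproj_hom.
have [Qs hQs] := tame_basis_generates nH.
have [wl hwl] := tame_basis_exists Qs nG ge.
exists (fun K e => T1 (cquo K) (fun v => cproj (e v)) /\ tame_basis e Qs wl); split.
  by apply: dfn_and; [apply: dfn_cquo|apply: dfn_tame_basis].
split=> // e' [t1 t2] h.
have [w [z [cz ez]]] := g1 _ t1 (cproj h).
(* The word [w] is correct in the quotient only up to its center, so the error in [H] lies in [Z2],
   where the second condition applies. *)
have [|w' [z' [cz' ez']]] := hQs _ _ _ t2 (mul (inv (weval e' w)) h).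
  apply/Z2_cproj; rewrite cproj_hom (homV (@cproj_hom H)) ez (weval_hom _ _ (@cproj_hom H)).
  by gs.
exists (wmul w w'), z'; split=> //=.
by rewrite mulAr -ez'; gs.
Qed.
(** * Embeddings between elementarily equivalent groups *)

Lemma generates_exists (K : group) : fin_gen K -> exists n (e : fin n -> K), generates e.
Proof.
move=> [l gl].
have [e he] : exists e : fin (length l) -> K, forall x, In x l -> exists j, e j = x.
  elim: l {gl} => [|x l [e he]]; first by exists (fun _ => one).
  exists (ocons e x) => y [<-|/he [j <-]]; first by exists None.
  by exists (Some j).
exists (length l), e => x; elim: {x}(gl x) => [x /he [j <-]||x y _ [w ->] _ [w' ->]|x _ [w ->]].
- by exists (wvar j).
- by exists wone.
- by exists (wmul w w').
- by exists (winv w).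
Qed.

Lemma fin_list n : exists l : list (fin n), forall v, In v l.
Proof.
elim: n => [|n [l hl]]; first by exists [] => -[].
exists (None :: map Some l) => -[v|]; [right; exact: in_map|by left].
Qed.

Lemma lcs_antitone_le (K : group) c d (x : K) : c <= d -> lcs d x -> lcs c x.
Proof. by elim=> // k _ ih /lcs_antitone. Qed.

(** Relations of [e] are taken inside the relatively free group of the variety generated by [G] and
    [H]. It is finitely generated nilpotent, so the kernel of evaluation at [e] is finitely
    generated. *)
Lemma finite_relations n (G H : group) (e : fin n -> G) : nilpotent G -> nilpotent H ->
  exists l : list (word (fin n)), (forall w, In w l -> weval e w = one) /\
    forall e' : fin n -> H, (forall w, In w l -> weval e' w = one) ->
      forall w, weval e w = one -> weval e' w = one.
Proof.
move=> [cG nG] [cH nH].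
(* [xi v] is the [v]-th coordinate function on all tuples of [G] and of [H]; the subgroup generated
   by the [xi v] is the relatively free group. *)
pose P := prodg (fung (fin n -> G) G) (fung (fin n -> H) H).
pose xi (v : fin n) : P := (fun f => f v, fun f => f v).
have sA : is_subgroup (fun x : P => exists w, x = weval xi w).
  split; first by exists wone.
  by split=> [x y [w ->] [w' ->]|x [w ->]]; [exists (wmul w w')|exists (winv w)].
have [T [i [hi [ii [iA sT]]]]] := subgroup_group sA.
have h1 f : is_hom (fun t => fst (i t) f) by move=> x y; rewrite hi.
have h2 f : is_hom (fun t => snd (i t) f) by move=> x y; rewrite hi.
have p1 (f : fin n -> G) w : fst (weval xi w) f = weval f w.
  by apply: (@weval_hom _ P G (fun x => fst x f)).
have p2 (f : fin n -> H) w : snd (weval xi w) f = weval f w.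
  by apply: (@weval_hom _ P H (fun x => snd x f)).
have nT : noeth T.
  apply: (@noeth_nilpotent_class (cG + cH)).
    have [l hl] := fin_list n.
    have [g hg] : exists g : fin n -> T, forall v, i (g v) = xi v.
      by apply: (choice (fun v t => i t = xi v)) => v; apply: sT; exists (wvar v).
    exists (map g l) => t; have [w ew] := iA t.
    have -> : t = weval g w.
      by apply: ii; rewrite ew (weval_hom _ _ hi); congr weval; apply: functional_extensionality => v; rewrite hg.
    elim: {ew} w => [v||s hs u hu|u hu] /=; [|exact: gen_one|exact: gen_mul|exact: gen_inv].
    exact/gen_in/in_map.
  move=> t ht; apply: ii; rewrite (hom1 hi) (surjective_pairing (i t)).
  congr (_, _); apply: functional_extensionality => f.
    apply: nG; apply: (lcs_hom (h1 f)); apply: lcs_antitone_le ht; lia.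
  apply: nH; apply: (lcs_hom (h2 f)); apply: lcs_antitone_le ht; lia.
have [m [hm gm]] := nT _ (proj1 (ker_normal (h1 e))).
have [|l [hl el]] := @preimage_list _ P (weval xi) (fun _ => True) (map i m).
  by move=> y /in_map_iff [t [<- _]]; have [w ew] := iA t; exists w.
exists l; split.
  move=> w hw; have := in_map (weval xi) l w hw; rewrite el => /in_map_iff [t [et ht]].
  by rewrite -p1 -et; apply: hm.
move=> e' he' w ew.
have [t et] : exists t, i t = weval xi w by apply: sT; exists w.
rewrite -p2 -et; have bt : fst (i t) e = one by rewrite et p1.
apply: (gen_sub (proj1 (ker_normal (h2 e'))) _ (gm t bt)) => s hs.
have := in_map i m s hs; rewrite -el => /in_map_iff [w' [ew' hw']].
by rewrite -ew' p2; apply: he'.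
Qed.

Lemma hom_from_words n (G H : group) (e : fin n -> G) (e' : fin n -> H) : generates e ->
  (forall w, weval e w = one -> weval e' w = one) ->
  exists p : G -> H, is_hom p /\ forall w, p (weval e w) = weval e' w.
Proof.
move=> ge he.
have [g hg] := choice _ ge.
have E w w' : weval e w = weval e w' -> weval e' w = weval e' w'.
  move=> h; apply/eq_invmul; apply: (he (wmul (winv w) w')) => /=.
  by rewrite h; gs.
exists (fun x => weval e' (g x)); split; last by move=> w; apply: E; rewrite -hg.
by move=> x y; apply: (E _ (wmul (g x) (g y))); rewrite /= -!hg.
Qed.

(** The torsion subgroup is finitely generated and has a finite exponent [k], so it equals its
    finite quotient by [k]-th powers. *)
Lemma torsion_finite (K : group) : noeth K -> abelian K ->
  exists L : list K, forall x k, 1 <= k -> gpow x k = one -> In x L.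
Proof.
move=> nK ab.
have sB : is_subgroup (fun x : K => x = one) by split=> //; split=> [x y -> ->|x ->]; gs.
have sT : is_subgroup (fun x : K => exists k, 1 <= k /\ gpow x k = one).
  split; first by exists 1; rewrite gpow1n.
  split=> [x y [k [k1 hk]] [j [j1 hj]]|x [k [k1 hk]]]; last by exists k; rewrite gpowV hk; gs.
  exists (k * j); split; first nia.
  by rewrite gpowMc; [apply: ab|rewrite gpowM hk {1}Nat.mul_comm (gpowM y) hj !gpow1n; gs].
have [T [i [hi [ii [iT sT']]]]] := subgroup_group sT.
have nT := fg_fin_gen nK hi ii.
have abT : abelian T by move=> x y; apply: ii; rewrite !hi ab.
have [l gl] := noeth_fin_gen nT.
have sBT : is_subgroup (fun x : T => x = one) by split=> //; split=> [x y -> ->|x ->]; gs.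
have [|k [k1 hk]] := @torsion_exponent T l (fun x => x = one) abT sBT.
  move=> x _; have [k [k1 hk]] := iT x; exists k; split=> //.
  by apply: ii; rewrite (hom_pow hi) hk (hom1 hi).
have [L hL] := finite_mod_powers (noeth_fin_gen nT) abT k1.
exists (map i L) => x j j1 hj.
have [t et] : exists t, i t = x by apply: sT'; exists j.
have [w [y [hw ew]]] := hL t.
rewrite (hk y (gl y)) mulg1 in ew.
by rewrite -et ew; apply: in_map.
Qed.

Lemma center_group (K : group) : exists (T : group) (i : T -> K), abelian T /\ is_hom i /\
  (forall x y, i x = i y -> x = y) /\ (forall t, center (i t)) /\
  forall x, center x -> exists t, i t = x.
Proof.
have [T [i [hi [ii [iT sT]]]]] := subgroup_group (center_subgroup K).
exists T, i; split=> //.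
by move=> x y; apply: ii; rewrite !hi; apply: iT.
Qed.

Lemma word_list n (K T : group) (e : fin n -> K) (i : T -> K) (L : list T) : generates e ->
  exists l : list (word (fin n)), map (weval e) l = map i L.
Proof.
move=> ge; elim: L => [|t L [l el]]; first by exists [].
by have [w ew] := ge (i t); exists (w :: l); rewrite /= el -ew.
Qed.

Definition central_cover (G H : group) (p : G -> H) :=
  is_hom p /\ forall h, exists x z, center z /\ h = mul (p x) z.

Lemma cover_center (G H : group) (p : G -> H) x : central_cover p -> center x -> center (p x).
Proof.
move=> [hp sp] hx h; have [y [z [hz ->]]] := sp h.
by rewrite mulA -hp hx hp mulAr -(hz (p x)) mulA.
Qed.

Lemma transfer_cover (G H : group) (m : nat) : fin_gen G -> nilpotent G -> fin_gen H -> nilpotent H ->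
  transfer G H -> 0 < m ->
  exists p : G -> H, central_cover p /\
    (forall z, center z -> exists x y, center x /\ center y /\ z = mul (p x) (gpow y m)) /\
    (forall z k, center z -> 1 <= k -> gpow z k = one -> p z = one -> z = one).
Proof.
move=> fG nG fH nH tr m0.
have NG := noeth_nilpotent fG nG; have NH := noeth_nilpotent fH nH.
have [n [e ge]] := generates_exists fG.
have [c hc] : exists c, center_class c H by case: nH => c /lcs_center_class; exists c.
have [T1 [d1 [t1 g1]]] := definable_generation NG NH hc ge.
have [lr [hr gr]] := finite_relations e nG nH.
have [C [i [abC [hi [ii [iC sC]]]]]] := center_group G.
have NC := fg_fin_gen NG hi ii.
have [LC hLC] := finite_mod_powers (noeth_fin_gen NC) abC m0.
have [lC elC] := word_list i LC ge.
have [LT hLT] := torsion_finite NC abC.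
have [lT elT] := word_list i LT ge.
(* The four conditions give, in this order, generation modulo the center, the homomorphism [p],
   [Z(H) = p(Z(G)) Z(H)^m], and injectivity of [p] on the finite torsion of [Z(G)]. *)
pose Q (K : group) (f : fin n -> K) := T1 K f /\ (forall w, In w lr -> weval f w = one) /\
  (forall z, center z -> exists w, In w lC /\ exists y, center y /\ z = mul (weval f w) (gpow y m)) /\
  (forall w, In w lT -> weval e w <> one -> weval f w <> one).
have utmw (V : Type) (g : fin n -> V) w : utm (fun K (f : V -> K) => weval (fun v => f (g v)) w).
  exact: utm_word.
have dQ : dfn Q.
  apply: dfn_and => //; apply: dfn_and.
    by apply dfn_all_list => w; apply: dfn_eq; [exact: (utmw _ id)|exact: utm_one].
  apply: dfn_and.
    dfn_step; dfn_step; first by dfn_step.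
    apply dfn_ex_list => w; dfn_step; dfn_step; first by dfn_step.
    apply: dfn_eq; first by utm_tac.
    by apply: utm_mul; [exact: (utmw _ (fun v => Some (Some v)))|utm_tac].
  apply dfn_all_list => w; apply: dfn_imp; first exact: dfn_const.
  by apply: dfn_not; apply: dfn_eq; [exact: (utmw _ id)|exact: utm_one].
have QG : Q G e.
  split=> //; split=> //; split.
    move=> z /sC [t <-]; have [w [y [hw ->]]] := hLC t.
    have := in_map i LC w hw; rewrite -elC => /in_map_iff [w' [ew' hw']].
    exists w'; split=> //; exists (i y); split; first exact: iC.
    by rewrite hi (hom_pow hi) ew'.
  by [].
have [e' [q1 [q2 [q3 q4]]]] := tr _ _ dQ (ex_intro _ e QG).
have [p [hp ep]] := hom_from_words ge (gr e' q2).
exists p; split; last split.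
- split=> // h; have [w [z [cz ->]]] := g1 e' q1 h.
  by exists (weval e w), z; rewrite ep.
- move=> z /q3 [w [hw [y [cy ->]]]].
  exists (weval e w), y; rewrite ep; split=> //.
  by have := in_map (weval e) lC w hw; rewrite elC => /in_map_iff [t [<- _]].
- move=> z k cz k1 hk pz; apply: NNPP => nz.
  have [t et] := sC z cz.
  have hz : In t LT.
    by apply: (hLT t k k1); apply: ii; rewrite (hom_pow hi) et hk (hom1 hi).
  have := in_map i LT t hz; rewrite -elT => /in_map_iff [w [ew hw]].
  by apply: (q4 w hw); rewrite -?ep ew et.
Qed.

(** [nakayama] for the subgroup [p(Z(G))] of [Z(H)]. *)
Lemma cover_exponent (G H : group) (m : nat) (p : G -> H) : fin_gen H -> nilpotent H ->
  central_cover p -> 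
  (forall z, center z -> exists x y, center x /\ center y /\ z = mul (p x) (gpow y m)) ->
  exists q, forall z, center z -> exists x, center x /\ gz z (1 + Z.of_nat m * q) = p x.
Proof.
move=> fH nH cp hm; have NH := noeth_nilpotent fH nH; have hp := proj1 cp.
have [C [i [abC [hi [ii [iC sC]]]]]] := center_group H.
have [l gl] := noeth_fin_gen (fg_fin_gen NH hi ii).
have [|||q hq] := @nakayama C l m (fun t => exists x, center x /\ p x = i t) abC.
- have sI := image_subgroup hp (center_subgroup G).
  exact: (preim_subgroup hi sI).
- by move=> x; apply: (gen_mono _ (gl x)); left.
- move=> t; have [x [y [cx [cy et]]]] := hm _ (iC t).
  have [b eb] := sC _ (cover_center cp cx).
  have [s es] := sC _ cy.
  exists b, s; split; first by exists x; rewrite eb.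
  by apply: ii; rewrite hi (hom_pow hi) eb es.
exists q => z /sC [t <-]; have [x [cx ex]] := hq t.
by exists x; rewrite ex (gz_hom _ _ hi).
Qed.

(** Climb the lower central series from its trivial term: commutators of [x] lie in [N] and one term
    lower, hence vanish, so [x] is central. *)
Lemma normal_meets_center (K : group) (N : K -> Prop) : nilpotent K -> normal N ->
  (forall x, N x -> center x -> x = one) -> forall x, N x -> x = one.
Proof.
move=> [c hc] [[n1 [nM nV]] nJ] h.
suff P : forall k, forall x, N x -> lcs (c - k) x -> x = one.
  by move=> x nx; apply: (P c) => //; rewrite Nat.sub_diag.
elim=> [|k ih] x nx; first by rewrite Nat.sub_0_r; move=> /hc.
(* Subtraction is truncated: once [c <= k], both indices are 0. *)
case: (Nat.le_gt_cases c k) => ck.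
  have -> : c - S k = c - k by lia.
  exact: ih.
move=> hx; apply: h => // y; apply/comm_eq1; apply: ih.
  rewrite /comm; apply: nM; first exact: nV.
  exact: nJ.
have -> : c - k = S (c - S k) by lia.
exact: lcs_comm.
Qed.

(** The kernels of the iterates of [a] on the center become stationary, say at [k]. Write
    [z^(M^k) = a^k(y)]; since [a z = 1], the element [y] is in the kernel of [a^(k+1)], hence of
    [a^k], and [z^(M^k) = 1]. *)
Lemma kernel_torsion (K : group) (a : K -> K) (M : Z) : noeth K -> is_hom a -> M <> 0%Z ->
  (forall z, center z -> exists x, center x /\ gz z M = a x) ->
  forall z, center z -> a z = one -> exists k, 1 <= k /\ gpow z k = one.
Proof.
move=> nK ha M0 hM z cz az.
have hit k : is_hom (Nat.iter k a) by elim: k => [|k ih] x y //=; rewrite ih ha.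
have [|k x|k hk] := @chain_fg K (fun k x => center x /\ Nat.iter k a x = one) nK.
- move=> k; apply: cap_subgroup; first exact: center_subgroup.
  by case: (ker_normal (hit k)).
- by move=> [cx e]; split=> //=; rewrite e (hom1 ha).
have it1 j x : Nat.iter j a (a x) = a (Nat.iter j a x) by elim: j => //= j ->.
have pw j : forall x, center x -> exists y, center y /\ gz x (M ^ Z.of_nat j) = Nat.iter j a y.
  elim: j => [|j ih] x cx; first by exists x; rewrite gz1.
  have [y [cy ey]] := hM x cx; have [w [cw ew]] := ih y cy.
  exists w; split=> //; rewrite Nat2Z.inj_succ Z.pow_succ_r; first lia.
  by rewrite gzM ey -(gz_hom _ _ ha) ew.
have [y [cy ey]] := pw k z cz.
have [_ e] : center y /\ Nat.iter k a y = one.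
  apply: (hk (S k)); split=> //=.
  by rewrite -ey (gz_hom _ _ ha) az gz_one.
rewrite e in ey.
have Mk : (M ^ Z.of_nat k <> 0)%Z by apply: Z.pow_nonzero => //; lia.
exists (Z.to_nat (Z.abs (M ^ Z.of_nat k))); split; first lia.
rewrite -gz_nat Z2Nat.id; first lia.
by case: (Z.abs_eq_or_opp (M ^ Z.of_nat k)) => ->; rewrite ?gzN ey; gs.
Qed.

(* [p] is injective because of the map in the other direction: the composite has torsion kernel on
   the center, and [p] kills no torsion of the center. *)
Lemma transfer_embedding (G H : group) (m : nat) : fin_gen G -> nilpotent G -> fin_gen H -> nilpotent H ->
  elem_equiv G H -> 1 < m ->
  exists (p : G -> H) (N : Z), central_cover p /\ (forall x y, p x = p y -> x = y) /\
    (exists q, N = (1 + Z.of_nat m * q)%Z) /\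
    forall z, center z -> exists x, center x /\ gz z N = p x.
Proof.
move=> fG nG fH nH E m1.
have E' : elem_equiv H G by move=> f hf; rewrite (E f hf).
have [p [cp [hm ht]]] := transfer_cover fG nG fH nH (elem_equiv_transfer E) (Nat.lt_trans _ _ _ Nat.lt_0_1 m1).
have [r [cr [hm' _]]] := transfer_cover fH nH fG nG (elem_equiv_transfer E') (Nat.lt_trans _ _ _ Nat.lt_0_1 m1).
have [q hq] := cover_exponent fH nH cp hm.
have [q' hq'] := cover_exponent fG nG cr hm'.
exists p, (1 + Z.of_nat m * q)%Z; split=> //; split; last by split=> //; exists q.
have hp := proj1 cp; have hr := proj1 cr.
apply: (hom_inj hp); apply: (normal_meets_center nG (ker_normal hp)) => z pz cz.
(* This is where [m > 1] matters: no integer congruent to 1 modulo [m] is zero. *)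
have nz (t : Z) : (1 + Z.of_nat m * t <> 0)%Z by case: (Z.le_gt_cases 0 t) => ? ?; nia.
have [||||k [k1 hk]] := @kernel_torsion G (fun x => r (p x)) ((1 + Z.of_nat m * q') * (1 + Z.of_nat m * q)) (noeth_nilpotent fG nG) _ _ _ z cz.
- by move=> x y; rewrite hp hr.
- by have := nz q; have := nz q'; nia.
- move=> x /hq' [y [cy ey]]; have [w [cw ew]] := hq y cy.
  by exists w; rewrite gzM ey -(gz_hom _ _ hr) ew.
- by rewrite pz (hom1 hr).
exact: (ht z k).
Qed.
(** * Isolators and quotients *)

Lemma derived_normal (K : group) (N : K -> Prop) : is_subgroup N -> (forall x, derived x -> N x) -> normal N.
Proof.
move=> sN h; split=> // x y hx; rewrite conj_comm; apply: (proj1 (proj2 sN)) => //.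
by apply: h; apply: gen_in; exists x, y.
Qed.

Lemma derived_quo_abelian (K : group) (N : K -> Prop) (nN : normal N) : (forall x, derived x -> N x) -> abelian (quo nN).
Proof.
move=> h x y; have [a <-] := proj_surj x; have [b <-] := proj_surj y.
rewrite -!proj_hom; apply/proj_eq.
have -> : mul (inv (mul a b)) (mul b a) = comm b a by rewrite /comm; gs.
by apply: h; apply: gen_in; exists b, a.
Qed.

Lemma derived_subgroup (K : group) : is_subgroup (@derived K).
Proof. exact: gen_subgroup. Qed.

Lemma isolator_in (K : group) (N : K -> Prop) x : N x -> isolator N x.
Proof. by move=> h; exists 1; split=> //=; gs. Qed.

Lemma isolator_subgroup (K : group) (N : K -> Prop) : is_subgroup N -> (forall x, derived x -> N x) ->
  is_subgroup (isolator N).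
Proof.
move=> sN h; have nN := derived_normal sN h; have ab := derived_quo_abelian (nN := nN) h.
have hp := proj_hom nN.
split; first by apply: isolator_in; case: sN.
split=> [x y [k [k1 /(proj1P nN) hk]] [j [j1 /(proj1P nN) hj]]|x [k [k1 hk]]].
  exists (k * j); split; first nia.
  apply/(proj1P nN); rewrite (hom_pow hp) hp gpowMc; first exact: ab.
  rewrite gpowM -(hom_pow hp) hk {1}Nat.mul_comm (gpowM (proj nN y)) -(hom_pow hp y) hj !gpow1n.
  by gs.
by exists k; split=> //; rewrite gpowV; apply: (proj2 (proj2 sN)).
Qed.

Lemma isolator_isolated (K : group) (N : K -> Prop) x k : 1 <= k -> isolator N (gpow x k) -> isolator N x.
Proof. by move=> k1 [j [j1 h]]; exists (k * j); split; [nia|rewrite gpowM]. Qed.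

Lemma setprod_subgroup (K : group) (N M : K -> Prop) : is_subgroup N -> is_subgroup M ->
  (forall z, M z -> center z) -> is_subgroup (setprod N M).
Proof.
move=> [n1 [nM nV]] [m1 [mM mV]] cM; split; first by exists one, one; gs.
split=> [x y [a [z [ha [hz ->]]]] [b [w [hb [hw ->]]]]|x [a [z [ha [hz ->]]]]].
  exists (mul a b), (mul z w); split; first exact: nM.
  split; first exact: mM.
  by rewrite !mulAr; congr mul; rewrite mulA (cM z hz) mulAr.
exists (inv a), (inv z); split; first exact: nV.
split; first exact: mV.
by rewrite invMg; apply: (cM _ (mV _ hz)).
Qed.

(** [Is(N)/N] is the torsion of the finitely generated abelian group [K/N], hence finite. *)
Lemma isolator_exponent (K : group) (N : K -> Prop) : noeth K -> is_subgroup N -> (forall x, derived x -> N x) ->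
  exists k, 1 <= k /\ forall x, isolator N x -> N (gpow x k).
Proof.
move=> nK sN h; have nN := derived_normal sN h; have ab := derived_quo_abelian (nN := nN) h.
have hp := proj_hom nN.
have [L hL] := torsion_finite (noeth_surj hp (@proj_surj _ _ nN) nK) ab.
have [k [k1 hk]] : exists k, 1 <= k /\ forall x, In (proj nN x) L -> isolator N x -> proj nN (gpow x k) = one.
  elim: L {hL} => [|y L [k [k1 hk]]]; first by exists 1.
  case: (classic (exists j, 1 <= j /\ gpow y j = one)) => [[j [j1 hj]]|H].
    exists (k * j); split; first nia.
    move=> x [e|hx] ix; rewrite (hom_pow hp).
      by rewrite -e {1}Nat.mul_comm gpowM hj gpow1n.
    by rewrite gpowM -(hom_pow hp x) (hk x hx ix) gpow1n.
  exists k; split=> // x [e|hx] ix; last exact: hk.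
  case: ix => j [j1 /(proj1P nN)]; rewrite (hom_pow hp) -e => hj.
  by case: H; exists j.
exists k; split=> // x ix; apply/(proj1P nN)/hk => //.
case: ix => j [j1 /(proj1P nN)]; rewrite (hom_pow hp) => hj.
exact: (hL _ j).
Qed.

Definition coset (G : group) (B : G -> Prop) (a : G) : G -> Prop := fun x => B (mul (inv a) x).

Lemma coset_eq (G : group) (B : G -> Prop) a b : is_subgroup B -> (coset B a = coset B b <-> B (mul (inv a) b)).
Proof.
move=> [b1 [bM bV]]; split=> [h|h].
  have : coset B b b by rewrite /coset; gs.
  by rewrite -h.
apply: functional_extensionality => x; apply: propositional_extensionality; rewrite /coset; split=> hx.
- have -> : mul (inv b) x = mul (inv (mul (inv a) b)) (mul (inv a) x) by gs.
  by apply: bM => //; apply: bV.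
- have -> : mul (inv a) x = mul (mul (inv a) b) (mul (inv b) x) by gs.
  exact: bM.
Qed.

(** Multiplicativity is asked of [f] modulo [D], so that maps obtained by choosing coset
    representatives are covered. *)
Lemma quot_iso_intro (G H : group) (A B : G -> Prop) (C D : H -> Prop) (f : G -> H) :
  is_subgroup A -> is_subgroup B -> normal D ->
  (forall x, A x -> C (f x)) ->
  (forall x y, A x -> A y -> D (mul (inv (f (mul x y))) (mul (f x) (f y)))) ->
  (forall x y, A x -> A y -> (B (mul (inv x) y) <-> D (mul (inv (f x)) (f y)))) ->
  (forall y, C y -> exists x, A x /\ D (mul (inv (f x)) y)) ->
  quot_iso A B C D.
Proof.
move=> sA sB [sD nD] hC hM hE hS.
have [d1 [dM dV]] := sD.
have [rep hrep] : exists rep : coset_of A B -> G, forall S, A (rep S) /\ proj1_sig S = coset B (rep S).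
  by apply: (choice (fun S a => A a /\ proj1_sig S = coset B a)) => -[S hS'].
have tr a b c : D (mul (inv a) b) -> D (mul (inv b) c) -> D (mul (inv a) c).
  move=> h1 h2; have -> : mul (inv a) c = mul (mul (inv a) b) (mul (inv b) c) by gs.
  exact: dM.
exists (fun S => exist _ (coset D (f (rep S))) (ex_intro _ (f (rep S)) (conj (hC _ (proj1 (hrep S))) eq_refl))).
split; last split.
- move=> S T e; have [aS eS] := hrep S; have [aT eT] := hrep T.
  have {}e := f_equal (@proj1_sig _ _) e; rewrite /= in e.
  have {}e : coset B (rep S) = coset B (rep T) by apply/coset_eq/hE => //; apply/coset_eq.
  rewrite -eS -eT in e.
  case: S T e {eS eT aS aT} => [S pS] [T pT] /= e; exact: subset_eq_compat.
- move=> [U pU]; have [c [hc eU]] := pU.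
  have [x [ax hx]] := hS c hc.
  pose S : coset_of A B := exist _ (coset B x) (ex_intro _ x (conj ax eq_refl)).
  exists S; apply: subset_eq_compat; rewrite eU; apply/(coset_eq _ _ sD).
  have [aS eS] := hrep S; apply: tr hx; apply/hE => //.
  by apply/(coset_eq _ _ sB).
- move=> S T U hU z /=; have [aS eS] := hrep S; have [aT eT] := hrep T; have [aU eU] := hrep U.
  have hst : B (mul (inv (rep U)) (mul (rep S) (rep T))).
    have : proj1_sig U (mul (rep S) (rep T)).
      apply/hU; exists (rep S), (rep T); rewrite eS eT /coset; gs.
      by case: sB.
    by rewrite eU.
  have aST : A (mul (rep S) (rep T)) by apply: (proj1 (proj2 sA)).
  have hf : D (mul (inv (f (rep U))) (mul (f (rep S)) (f (rep T)))).
    by apply: tr (hM _ _ aS aT); apply/hE.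
  rewrite /coset; split=> [[a [b [ha [hb ->]]]]|hz].
    apply: (tr _ _ _ hf); gs.
    have -> : mul (inv (f (rep T))) (mul (inv (f (rep S))) (mul a b)) =
      mul (mul (inv (f (rep T))) (mul (mul (inv (f (rep S))) a) (f (rep T)))) (mul (inv (f (rep T))) b) by gs.
    by apply: dM => //; apply: nD.
  exists (f (rep S)), (mul (inv (f (rep S))) z); split; first by rewrite /coset; gs.
  split; last by gs.
  have -> : mul (inv (f (rep T))) (mul (inv (f (rep S))) z) =
     mul (inv (mul (inv (f (rep U))) (mul (f (rep S)) (f (rep T))))) (mul (inv (f (rep U))) z) by gs.
  by apply: dM => //; apply: dV.
Qed.

Lemma comm_central (K : group) (x y z w : K) : center z -> center w -> comm (mul x z) (mul y w) = comm x y.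
Proof.
move=> hz hw.
have E a b c : center c -> comm (mul a c) b = comm a b :> K.
  by move=> hc; apply: eq_sym; apply: Z2_comm_eq; gs.
by rewrite E // -commV E // commV.
Qed.

(** * Consequences of a central cover that is injective with controlled exponent *)

Section Embedding.
Variables (G H : group) (p : G -> H) (N : Z).
Hypothesis cp : central_cover p.
Hypothesis ip : forall x y, p x = p y -> x = y.
Hypothesis N0 : N <> 0%Z.
Hypothesis hN : forall z, center z -> exists x, center x /\ gz z N = p x.

Let hp : is_hom p := proj1 cp.

Notation DG := (isolator (@derived G)).
Notation DH := (isolator (@derived H)).

Lemma embedding_center x : center (p x) -> center x.
Proof. by move=> h y; apply: ip; rewrite !hp; apply: h. Qed.

Lemma embedding_derived x : derived x -> derived (p x).
Proof.
apply: (hom_gen hp) => z [a [b ->]]; rewrite (hom_comm hp).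
by apply: gen_in; exists (p a), (p b).
Qed.

(** Commutators do not see central factors, and [H = p(G) Z(H)]. *)
Lemma derived_lift y : derived y -> exists x, derived x /\ p x = y.
Proof.
apply: (gen_sub (image_subgroup hp (derived_subgroup G))) => z [a [b ->]].
have [x [c [hc ->]]] := proj2 cp a; have [y' [c' [hc' ->]]] := proj2 cp b.
exists (comm x y'); rewrite (hom_comm hp) comm_central //; split=> //.
by apply: gen_in; exists x, y'.
Qed.

Lemma embedding_isolator x : DG x -> DH (p x).
Proof. by move=> [k [k1 h]]; exists k; split=> //; rewrite -(hom_pow hp); apply: embedding_derived. Qed.

Lemma power_lift y : exists x, gz y N = p x.
Proof.
have [x [z [cz ->]]] := proj2 cp y; have [w [_ ew]] := hN cz.
exists (mul (gz x N) w); rewrite gzMc; first exact: (eq_sym (cz _)).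
by rewrite ew hp (gz_hom _ _ hp).
Qed.

Lemma abs_sub (K : group) (A : K -> Prop) y k : is_subgroup A -> A (gz y k) -> A (gpow y (Z.abs_nat k)).
Proof.
move=> sA h; rewrite -gz_nat Zabs2Nat.id_abs.
by case: (Z.abs_eq_or_opp k) => ->; rewrite ?gzN //; apply: (proj2 (proj2 sA)).
Qed.

(** [Z(H)] modulo [N]-th powers is finite, and [N]-th powers of central elements lie in the
    image. *)
Lemma embedding_finite_index : fin_gen H -> nilpotent H -> finite_index (fun h => exists g, h = p g).
Proof.
move=> fH nH; have NH := noeth_nilpotent fH nH.
have [C [i [abC [hi [ii [iC sC]]]]]] := center_group H.
have [L hL] := finite_mod_powers (m := Z.abs_nat N) (noeth_fin_gen (fg_fin_gen NH hi ii)) abC ltac:(lia).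
exists (map i L) => h; have [x [z [cz ->]]] := proj2 cp h.
have [t et] := sC z cz; have [w [y [hw ey]]] := hL t.
have sI := image_subgroup hp (center_subgroup G).
have [a [ca ea]] : exists a, center a /\ p a = gpow (i y) (Z.abs_nat N).
  apply: (abs_sub sI); have [a [ca ea]] := hN (iC y); by exists a.
exists (i w), (p (mul a x)); split; first exact: in_map.
split; first by exists (mul a x).
by rewrite -(cz (p x)) -et ey hi (hom_pow hi) hp ea; gs.
Qed.

Variable k : nat.
Hypothesis k1 : 1 <= k.
Hypothesis hk : forall y, DH y -> derived (gpow y k).
Hypothesis Nk : exists q, N = (1 + Z.of_nat k * q)%Z.

(* [y^N] and [y^k] lie in the image, and [N], [k] are coprime. *)
Lemma isolator_lift y : DH y -> exists x, DG x /\ p x = y.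
Proof.
move=> iy; have [q eq] := Nk; have dy := hk iy.
have [a ea] := power_lift y; have [b [db eb]] := derived_lift dy.
pose x := mul a (inv (gz b q)).
have ex : p x = y.
  rewrite hp (homV hp) (gz_hom _ _ hp) eb -ea -gz_nat -gzM -gzN -gzD.
  by rewrite (_ : N + _ = 1)%Z ?gz1 //; lia.
exists x; split=> //; exists k; split=> //.
by have -> : gpow x k = b by apply: ip; rewrite (hom_pow hp) ex eb.
Qed.

Lemma isolator_reflect x : DG x <-> DH (p x).
Proof.
split; first exact: embedding_isolator.
by move=> /isolator_lift [x' [h /ip <-]].
Qed.

Lemma embedding_isolator_iso : sub_iso DG DH.
Proof.
exists p; split; first exact: embedding_isolator.
split; first by move=> x y _ _; apply: hp.
split; first by move=> x y _ _; apply: ip.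
exact: isolator_lift.
Qed.

Lemma IG_lift y : IG y -> exists x, IG x /\ p x = y.
Proof.
move=> [/isolator_lift [x [ix ex]] cy]; exists x; split=> //; split=> //.
by apply: embedding_center; rewrite ex.
Qed.

Lemma embedding_IG x : IG x -> IG (p x).
Proof. by move=> [ix cx]; split; [apply: embedding_isolator|apply: cover_center]. Qed.

Lemma isolator_derived_sub (K : group) : is_subgroup (isolator (@derived K)).
Proof. exact: (isolator_subgroup (derived_subgroup K)). Qed.

Lemma isolator_derived_normal (K : group) : normal (isolator (@derived K)).
Proof. by apply: derived_normal; [apply: isolator_derived_sub|apply: isolator_in]. Qed.

Lemma isolator_quo_abelian (K : group) : abelian (quo (isolator_derived_normal K)).
Proof. by apply: derived_quo_abelian; apply: isolator_in. Qed.

Lemma isolator_quo_torsion_free (K : group) : torsion_free (quo (isolator_derived_normal K)).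
Proof.
move=> x j j1; have [a <-] := proj_surj x.
rewrite -(hom_pow (proj_hom _)) => /proj1P h; apply/proj1P.
exact: isolator_isolated h.
Qed.

(** [p] embeds [G/Is(G')] into the free abelian group [H/Is(H')] with cokernel of exponent dividing
    [N]. The isomorphism is [p] followed by the inverse of an isomorphism [j] onto the image. *)
Lemma embedding_abelianization : fin_gen H -> quot_iso (allG G) DG (allG H) DH.
Proof.
move=> fH.
set nH := isolator_derived_normal H; set nG := isolator_derived_normal G.
have hq := proj_hom nH; have sq := @proj_surj _ _ nH.
pose pb x := proj nH (p x).
have hpb : is_hom pb by move=> x y; rewrite /pb hp hq.
have sI : is_subgroup (fun y => exists x, True /\ pb x = y) by apply: (image_subgroup hpb).
have [|j [hj [ij [Cj sj]]]] := free_finite_exponent_iso (N := Z.abs_nat N)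
  (fin_gen_surj hq sq fH) (@isolator_quo_abelian H) (@isolator_quo_torsion_free H) sI ltac:(lia).
  move=> y; have [h <-] := sq y; apply: (abs_sub sI).
  by have [x ex] := power_lift h; exists x; rewrite /pb -ex (gz_hom _ _ hq).
(* [f] lifts the composite of [pb] with the inverse of [j]; it is a homomorphism modulo [Is(H')]. *)
have [f hf] : exists f : G -> H, forall x, j (proj nH (f x)) = pb x.
  apply: (choice (fun x h => j (proj nH h) = pb x)) => x.
  have [|y ey] := sj (pb x); first by exists x.
  by have [h eh] := sq y; exists h; rewrite eh.
apply: (@quot_iso_intro _ _ _ _ _ _ f) => //.
- exact: isolator_derived_sub.
- by move=> x y _ _; apply/(proj_eq nH)/ij; rewrite hq hj !hf hpb.
- move=> x y _ _; rewrite isolator_reflect hp (homV hp) -(proj_eq nH) -(proj_eq nH).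
  split=> h; first by apply: ij; rewrite !hf.
  by have := hf x; rewrite h hf.
- move=> y _; have [x [_ ex]] := Cj (proj nH y); exists x; split=> //.
  by apply/(proj_eq nH)/ij; rewrite hf.
Qed.

Lemma derived_center_sub (K : group) : is_subgroup (setprod (@derived K) center).
Proof. by apply: setprod_subgroup => //; [apply: derived_subgroup|apply: center_subgroup]. Qed.

Lemma isolator_center_sub (K : group) : is_subgroup (setprod (isolator (@derived K)) center).
Proof. by apply: setprod_subgroup => //; [apply: isolator_derived_sub|apply: center_subgroup]. Qed.

Lemma setprod_l (K : group) (A B : K -> Prop) x : is_subgroup B -> A x -> setprod A B x.
Proof. by move=> [b1 _] ax; exists x, one; gs. Qed.

(** Here [p] itself induces the isomorphism: surjectivity is [H = p(G) Z(H)], and both the isolator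
    and the center are reflected by [p]. *)
Lemma embedding_isolator_center : quot_iso
  (isolator (setprod (@derived G) center)) (setprod DG center)
  (isolator (setprod (@derived H) center)) (setprod DH center).
Proof.
have dl (K : group) (x : K) : derived x -> setprod derived center x.
  by apply: setprod_l; apply: center_subgroup.
apply: (@quot_iso_intro _ _ _ _ _ _ p).
- by apply: isolator_subgroup; [apply: derived_center_sub|apply: dl].
- exact: isolator_center_sub.
- apply: derived_normal; first exact: isolator_center_sub.
  by move=> x dx; apply: setprod_l; [apply: center_subgroup|apply: isolator_in].
- move=> x [j [j1 [a [z [da [cz e]]]]]]; exists j; split=> //.
  exists (p a), (p z); rewrite -(hom_pow hp) e hp; split; first exact: embedding_derived.
  by split=> //; apply: cover_center.
- by move=> x y _ _; rewrite hp; gs; case: (isolator_center_sub H).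
- move=> x y _ _; rewrite -(homV hp) -hp; set w := mul _ y.
  split=> [[a [z [ia [cz ->]]]]|[b [z [/isolator_lift [a [ia <-]] [cz e]]]]].
    exists (p a), (p z); rewrite hp; split; first exact: embedding_isolator.
    by split=> //; apply: cover_center.
  exists a, (mul (inv a) w); split=> //; split; last by gs.
  by apply: embedding_center; rewrite hp (homV hp) e; gs.
- move=> y [j [j1 [b [z [/derived_lift [a [da <-]] [cz e]]]]]].
  have [x [z' [cz' ey]]] := proj2 cp y; exists x; split; last first.
    by exists one, z'; rewrite ey; gs; split=> //; case: (isolator_derived_sub H).
  exists j; split=> //; exists a, (mul (inv a) (gpow x j)); split=> //; split; last by gs.
  apply: embedding_center; rewrite hp (homV hp) (hom_pow hp).
  rewrite ey gpowMc in e; first exact: (eq_sym (cz' _)).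
  have -> : gpow (p x) j = mul (mul (p a) z) (inv (gpow z' j)) by rewrite -e; gs.
  gs; have [_ [cM cV]] := center_subgroup H.
  by apply: cM => //; apply: cV; apply: (gpow_sub _ (center_subgroup H)).
Qed.
End Embedding.
(** * Additions *)

Section Addition.
Variables (G H : group) (p : G -> H) (N : Z) (k e : nat) (q : Z) (G0 : G -> Prop).
Hypothesis fG : fin_gen G.
Hypothesis fH : fin_gen H.
Hypothesis nH : nilpotent H.
Hypothesis cp : central_cover p.
Hypothesis ip : forall x y, p x = p y -> x = y.
Hypothesis N0 : N <> 0%Z.
Hypothesis hN : forall z, center z -> exists x, center x /\ gz z N = p x.
Hypothesis k1 : 1 <= k.
Hypothesis hk : forall y : H, isolator derived y -> derived (gpow y k).
Hypothesis Nk : exists q, N = (1 + Z.of_nat k * q)%Z.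
Hypothesis he : forall x : G, isolator (setprod (isolator derived) center) x ->
  setprod (isolator derived) center (gpow x e).
Hypothesis Ne : N = (1 + Z.of_nat e * q)%Z.
Hypothesis aG0 : addition G0.

Let hp : is_hom p := proj1 cp.
Let sG0 : is_subgroup G0 := proj1 aG0.
Let cG0 : forall z, G0 z -> center z := proj1 (proj2 aG0).
Let dG0 : forall z, center z <-> setprod G0 IG z := proj1 (proj2 (proj2 aG0)).
Let iG0 : forall z, G0 z -> IG z -> z = one := proj2 (proj2 (proj2 aG0)).

Lemma IG_subgroup (K : group) : is_subgroup (@IG K).
Proof. exact: (cap_subgroup (isolator_derived_sub K) (center_subgroup K)). Qed.

(** [I(K)] is isolated in the center, hence a direct factor of it. The map is total on [K] but
    controlled only on the center. *)
Lemma center_retraction (K : group) : noeth K -> exists r : K -> K,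
  (forall x y, center x -> center y -> r (mul x y) = mul (r x) (r y)) /\
  (forall x, center x -> IG (r x)) /\ forall x, IG x -> r x = x.
Proof.
move=> nK; have [C [i [abC [hi [ii [iC sC]]]]]] := center_group K.
have [|x j j1 [h _]|r [hr [rI rid]]] := @retraction C (fun t => IG (i t)) abC (noeth_fin_gen (fg_fin_gen nK hi ii)).
- exact: (preim_subgroup hi (IG_subgroup K)).
- split; last exact: iC.
  by apply: (isolator_isolated j1); rewrite -(hom_pow hi).
have [g hg] : exists g : K -> C, forall x, center x -> i (g x) = x.
  apply: (choice (fun x t => center x -> i t = x)) => x.
  case: (classic (center x)) => [/sC [t et]|nx]; first by exists t.
  by exists one.
exists (fun x => i (r (g x))); split; last split.
- move=> x y hx hy; rewrite -hi -hr; congr i; congr r; apply: ii.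
  by rewrite hi !hg //; apply: (proj1 (proj2 (center_subgroup K))).
- by move=> x hx; apply: rI.
- by move=> x [ix cx]; rewrite rid hg.
Qed.

Lemma addition_decomp : exists g : G -> G, forall x, center x -> G0 (g x) /\ IG (mul (inv (g x)) x).
Proof.
apply: (choice (fun x a => center x -> G0 a /\ IG (mul (inv a) x))) => x.
case: (classic (center x)) => [/dG0 [a [b [ha [hb ->]]]]|nx]; last by exists one.
by exists a => _; gs.
Qed.

Lemma G0_unique a b : G0 a -> G0 b -> isolator derived (mul (inv a) b) -> a = b.
Proof.
move=> ha hb h; apply/eq_invmul.
have hab : G0 (mul (inv a) b) by apply: (proj1 (proj2 sG0)) => //; apply: (proj2 (proj2 sG0)).
by apply: iG0 => //; split=> //; apply: cG0.
Qed.

Notation Q := (quo (isolator_derived_normal G)).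
Notation pi := (@proj G _ (isolator_derived_normal G)).

(* Up to the exponent [e], the isolator of the center splits off [G / Is(G')]. *)
Lemma addition_projection : exists t : Q -> G, is_hom t /\ (forall y, G0 (t y)) /\
  forall g, G0 g -> t (pi g) = gpow g e.
Proof.
have hpi := proj_hom (isolator_derived_normal G).
have spi := @proj_surj _ _ (isolator_derived_normal G).
have abQ := @isolator_quo_abelian G.
(* [J] is the isolator in [Q] of the image of the center, and [r] below retracts [Q] onto it. *)
pose J (y : Q) := exists j, 1 <= j /\ exists z, center z /\ pi z = gpow y j.
have sJ : is_subgroup J.
  split; first by exists 1; split=> //; exists one; rewrite (hom1 hpi) gpow1n; split=> //; case: (center_subgroup G).
  split=> [x y [a [a1 [z [cz ez]]]] [b [b1 [w [cw ew]]]]|x [a [a1 [z [cz ez]]]]].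
    exists (a * b); split; first nia.
    exists (mul (gpow z b) (gpow w a)); split.
      by apply: (proj1 (proj2 (center_subgroup G))); apply: (gpow_sub _ (center_subgroup G)).
    rewrite hpi !(hom_pow hpi) ez ew -!gpowM (Nat.mul_comm b) gpowMc //; exact: abQ.
  exists a; split=> //; exists (inv z); rewrite (homV hpi) ez gpowV; split=> //.
  exact: (proj2 (proj2 (center_subgroup G))).
have [|r [hr [rJ rid]]] := retraction abQ (fin_gen_surj hpi spi fG) sJ.
  move=> x j j1 [a [a1 [z [cz ez]]]]; exists (j * a); split; first nia.
  by exists z; rewrite ez gpowM.
(* An element over [r y] has a power in [Is(G')Z(G)], so its [e]-th power lies there by [he];
   dropping the factors in [Is(G')] and [I(G)] leaves an element of [G0]. *)
have ex y : exists g, G0 g /\ pi g = gpow (r y) e.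
  have [j [j1 [z [cz ez]]]] := rJ y; have [x exy] := spi (r y); rewrite -exy in ez *.
  have [|a [z' [ia [/dG0 [g [i [hg [[ii _] ->]]]] e']]]] := he (x := x).
    exists j; split=> //; exists (mul (gpow x j) (inv z)), z; split; last by split=> //; gs.
    by apply/(proj1P (isolator_derived_normal G)); rewrite hpi (homV hpi) ez (hom_pow hpi); gs.
  exists g; split=> //; rewrite -(hom_pow hpi) e' !hpi.
  by rewrite (proj2 (proj1P (isolator_derived_normal G) a) ia) (proj2 (proj1P (isolator_derived_normal G) i) ii); gs.
have uni a b : G0 a -> G0 b -> pi a = pi b -> a = b.
  by move=> ha hb /proj_eq; apply: G0_unique.
have [t ht] := choice _ ex.
exists t; split; last split.
- move=> x y; have [h1 e1] := ht x; have [h2 e2] := ht y; have [h3 e3] := ht (mul x y).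
  apply: uni => //; first exact: (proj1 (proj2 sG0)).
  by rewrite e3 hpi e1 e2 hr gpowMc //; apply: abQ.
- by move=> y; case: (ht y).
- move=> g hg; have [h1 e1] := ht (pi g); apply: uni => //; first exact: gpow_sub.
  rewrite e1 rid ?(hom_pow hpi) //.
  by exists 1; split=> //; exists g; split; [exact: cG0|exact: (eq_sym (mulg1 _))].
Qed.

(* [p] is corrected by a central homomorphism [c] so that it maps [G0] into the kernel of a
   retraction [r] of [Z(H)] onto [I(H)]. *)
Lemma adjusted_retraction : exists (r : H -> H) (c : G -> H),
  (forall x y, center x -> center y -> r (mul x y) = mul (r x) (r y)) /\
  (forall x, center x -> IG (r x)) /\ (forall x, IG x -> r x = x) /\
  is_hom c /\ (forall x, IG (c x)) /\ (forall x, isolator derived x -> c x = one) /\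
  forall g, G0 g -> r (p g) = c g.
Proof.
have [r0 [r0M [r0I r0id]]] := center_retraction (noeth_nilpotent fH nH).
have [ga hga] := addition_decomp.
have [t [ht [tG0 tid]]] := addition_projection.
have [I1 [IM IV]] := IG_subgroup H.
have [C1 [CM CV]] := center_subgroup H.
have [D1 [DM DV]] := center_subgroup G.
have Icomm (x y : H) : IG x -> mul x y = mul y x by move=> [_ cx]; apply: cx.
have r01 : r0 one = one by apply: r0id.
have cov := cover_center cp.
have gaM x y : center x -> center y -> ga (mul x y) = mul (ga x) (ga y).
  move=> hx hy; have [a1 [b1 _]] := hga x hx; have [a2 [b2 _]] := hga y hy; have [a3 [b3 _]] := hga _ (DM _ _ hx hy).
  apply: eq_sym; apply: G0_unique => //; first exact: (proj1 (proj2 sG0)).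
  have [i1 [iM iV]] := isolator_derived_sub G.
  have -> : mul (inv (mul (ga x) (ga y))) (ga (mul x y)) =
    mul (mul (inv (ga y)) (mul (mul (inv (ga x)) x) y)) (inv (mul (inv (ga (mul x y))) (mul x y))) by gs.
  refine (iM _ _ _ (iV _ b3)).
  have -> : mul (inv (ga y)) (mul (mul (inv (ga x)) x) y) = mul (mul (inv (ga x)) x) (mul (inv (ga y)) y).
    have cy : center (inv (ga y)) by apply: DV; apply: cG0.
    by rewrite (cy (mul _ y)) (cy y); gs.
  exact: iM.
have gaid g : G0 g -> ga g = g.
  move=> hg; have [a1 [b1 _]] := hga g (cG0 hg); exact: G0_unique.
have gaI x : IG x -> ga x = one.
  move=> [ix cx]; have [a1 [b1 _]] := hga x cx; apply: iG0 => //; split; last exact: cG0.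
  have [i1 [iM iV]] := isolator_derived_sub G.
  have -> : ga x = mul x (inv (mul (inv (ga x)) x)) by gs.
  by apply: iM => //; apply: iV.
have [w hw] : exists w : H -> G, forall z, center z -> center (w z) /\ gz z N = p (w z).
  apply: (choice (fun z x => center z -> center x /\ gz z N = p x)) => z.
  case: (classic (center z)) => [/hN [x hx]|nz]; first by exists x.
  by exists one.
have wM x y : center x -> center y -> w (mul x y) = mul (w x) (w y).
  move=> hx hy; have [a1 b1] := hw x hx; have [a2 b2] := hw y hy; have [a3 b3] := hw _ (CM _ _ hx hy).
  by apply: ip; rewrite hp -b3 -b1 -b2 gzMc //; apply: hx.
(* The [I(H)]-component of the image of the [G0]-component; it measures how far [p] is from sending
   [G0] into the kernel of [r0]. *)
pose ka x := r0 (p (ga x)).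
have kaM x y : center x -> center y -> ka (mul x y) = mul (ka x) (ka y).
  move=> hx hy; rewrite /ka gaM // hp r0M //; apply/cov/cG0; [by case: (hga x hx)|by case: (hga y hy)].
have kaI x : center x -> IG (ka x) by move=> hx; apply/r0I/cov/cG0; case: (hga x hx).
have rg x j : center x -> r0 (gz x j) = gz (r0 x) j.
  move=> hx.
  have P i : r0 (gpow x i) = gpow (r0 x) i.
    by elim: i => [|i ih] //=; rewrite r0M ?ih //; apply: (gpow_sub _ (center_subgroup H)).
  case: j => [|j|j] /=; [exact: r01|exact: P|].
  apply: (@mulIg _ (r0 (gpow x (Pos.to_nat j)))).
  have cj := gpow_sub (Pos.to_nat j) (center_subgroup H) hx.
  by rewrite -r0M ?P //; [exact: CV|gs].
(* With [w z] the preimage of [z^N], the new retraction sends [p g], for [g] in [G0], to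
   [r0(p g)^(1 - N) = r0(p g)^(- e q)]. As [t (pi g) = g^e], this is [c g], and [c] is defined on
   all of [G]. On [I(H)] the correction vanishes, because [w] takes values in [I(G)] there. *)
exists (fun z => mul (r0 z) (inv (ka (w z)))), (fun x => gz (r0 (p (t (pi x)))) (- q)).
split.
  move=> x y hx hy; have [a1 b1] := hw x hx; have [a2 b2] := hw y hy.
  rewrite r0M // wM // kaM // invMg; gs; congr mul.
  rewrite (Icomm (inv (ka (w y)))); first by apply/IV/kaI.
  by rewrite mulA (Icomm (r0 y)) ?mulAr //; apply: r0I.
split; first by move=> x hx; apply: IM; [apply: r0I|apply/IV/kaI; case: (hw x hx)].
split.
  move=> x hx; have [ix cx] := hx; have [a1 b1] := hw x cx; rewrite r0id //.
  suff -> : ka (w x) = one by gs.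
  rewrite /ka gaI ?(hom1 hp) //.
  split=> //; apply/(isolator_reflect cp ip hN k1 hk Nk); rewrite -b1.
  by apply: (gz_sub _ (isolator_derived_sub H)).
have cpt x : center (p (t x)) by apply/cov/cG0.
split.
  move=> x y; rewrite proj_hom ht hp r0M // gzMc //; apply: Icomm; exact: r0I.
split; first by move=> x; apply: (gz_sub _ (IG_subgroup H)); apply: r0I.
split.
  move=> x ix; have -> : pi x = one by apply/proj1P.
  by rewrite (hom1 ht) (hom1 hp) r01 gz_one.
move=> g hg; have cg := cG0 hg; have cpg := cov _ cg.
have [a1 b1] := hw _ cpg.
have -> : w (p g) = gz g N by apply: ip; rewrite -b1 (gz_hom _ _ hp).
rewrite /ka gaid; first exact: (gz_sub _ sG0).
rewrite tid // (gz_hom _ _ hp) rg // (hom_pow hp) -gz_nat rg // -gzM.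
rewrite -{1}(gz1 (r0 (p g))) -gzN -gzD; congr gz; lia.
Qed.

(** [H0] is the kernel of [r] on [Z(H)], a complement of [I(H)]. The corrected map [p' = p c^(-1)]
    sends [G0] into [H0], because [r] fixes [I(H)] and agrees with [c] on [p(G0)]. *)
Lemma addition_transfer : exists H0 : H -> Prop, addition H0 /\ sub_iso G0 H0 /\
  quot_iso (allG G) G0 (allG H) H0.
Proof.
have [r [c [rM [rI [rid [hc [cI [c1 rc]]]]]]]] := adjusted_retraction.
have NH := noeth_nilpotent fH nH.
have [I1 [IM IV]] := IG_subgroup H.
have [C1 [CM CV]] := center_subgroup H.
have [D1 [DM DV]] := center_subgroup G.
have cov := cover_center cp.
have r1 : r one = one by apply: rid.
have rV x : center x -> r (inv x) = inv (r x).
  by move=> hx; apply: (@mulIg _ (r x)); rewrite -rM //; [exact: CV|gs].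
pose H0 z := center z /\ r z = one.
have sH0 : is_subgroup H0.
  split=> //; split=> [x y [hx ex] [hy ey]|x [hx ex]].
    by split; [apply: CM|rewrite rM // ex ey; gs].
  by split; [apply: CV|rewrite rV // ex; gs].
have iH0 z : H0 z -> IG z -> z = one by move=> [cz ez] iz; rewrite -(rid z iz).
have aH0 : addition H0.
  split=> //; split; first by move=> z [].
  split=> // z; split=> [cz|[a [b [[ca _] [[_ cb] ->]]]]]; last exact: CM.
  have [_ crz] := rI z cz.
  exists (mul z (inv (r z))), (r z); split; last by split; [apply: rI|gs].
  split; first by apply: CM => //; apply: CV.
  by rewrite rM ?rV // ?(rid (r z)); [exact: CV|exact: rI|gs].
exists H0; split=> //.
pose p' x := mul (p x) (inv (c x)).
have cc x : center (c x) by case: (cI x).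
have hp' : is_hom p'.
  move=> x y; rewrite /p' hp hc invMg; gs; congr mul.
  by rewrite (CV _ (cc x) (mul _ _)) mulAr.
have pp' x : p x = mul (p' x) (c x) by rewrite /p'; gs.
have p'0 g : G0 g -> H0 (p' g).
  move=> hg; have cg := cov _ (cG0 hg); split; first by apply: CM => //; apply: CV.
  by rewrite rM ?rV // ?rc //; [exact: CV|rewrite (rid (c g)) //; gs].
have p'I x : IG x -> p' x = p x by move=> [ix cx]; rewrite /p' c1 //; gs.
have p'c x : center (p' x) -> center x.
  move=> h; apply: (embedding_center cp ip); rewrite pp'; exact: CM.
have ker x : IG x -> H0 (p x) -> x = one.
  move=> ix hx; apply: ip; rewrite (hom1 hp); apply: iH0 => //; exact: (embedding_IG cp).
(* In the decomposition [w = g i], the factor [p' i = p i] lies in both [H0] and [I(H)], so [i] is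
   trivial. *)
have back w : H0 (p' w) -> G0 w.
  move=> h; have /dG0 [g [i [hg [hi ew]]]] : center w by apply: p'c; case: h.
  suff i1 : i = one by rewrite ew i1; gs.
  apply: ker => //; rewrite -p'I //.
  have -> : p' i = mul (inv (p' g)) (p' w) by rewrite ew hp'; gs.
  by apply: (proj1 (proj2 sH0)) => //; apply: (proj2 (proj2 sH0)); apply: p'0.
split; last first.
  apply: (@quot_iso_intro _ _ _ _ _ _ p') => //.
  - split=> //; first by move=> x y [cx ex]; rewrite cx; gs.
  - by move=> x y _ _; rewrite hp'; gs.
  - move=> x y _ _; rewrite -(homV hp') -hp'; split; [exact: p'0|exact: back].
  - move=> h _; have [x [z [cz eh]]] := proj2 cp h.
    (* The central defect [c x z] splits along [H0] and [I(H)]; its part in [I(H)] lifts to [I(G)],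
       where [p'] agrees with [p]. *)
    have /(proj1 (proj2 (proj2 aH0))) [h0 [i' [hh [/(IG_lift cp ip hN k1 hk Nk) [i [ii ei]] ez]]]] : center (mul (c x) z) by apply: CM.
    exists (mul x i); split=> //.
    have -> : h = mul (p' x) (mul h0 (p' i)) by rewrite (p'I i ii) ei -ez eh pp'; gs.
    by rewrite hp' (proj1 hh (p' i)); gs.
have [T [i [hi [ii [iT sT]]]]] := subgroup_group sH0.
have nT := fg_fin_gen NH hi ii.
have abT : abelian T by move=> x y; apply: ii; rewrite !hi; case: (iT x) => h _; apply: h.
have tfT : torsion_free T.
  move=> x j j1 ej; apply: ii; rewrite (hom1 hi); apply: iH0 => //.
  split; last by case: (iT x).
  apply: (isolator_isolated j1); rewrite -(hom_pow hi) ej (hom1 hi).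
  by case: (isolator_derived_sub H).
have hpG := image_subgroup hp' sG0.
(* [H0] meets [I(H)] trivially, so it is free abelian, and [p'(G0)] has finite exponent in it; hence
   [p'(G0)] is isomorphic to [H0]. *)
have [|j [hj [ij [Cj sj]]]] := free_finite_exponent_iso (N := Z.abs_nat N) (noeth_fin_gen nT) abT tfT
    (preim_subgroup hi hpG) ltac:(lia).
  move=> x; rewrite (hom_pow hi); apply: (abs_sub hpG).
  have [y [/dG0 [g [i0 [hg [hi0 ey]]]] ex]] := hN (proj1 (iT x)).
  exists g; split=> //.
  (* The [N]-th power and [p' g] both lie in [H0] and differ by an element of [I(H)], so they
     coincide. *)
  have hz : H0 (mul (inv (p' g)) (gz (i x) N)).
    by apply: (proj1 (proj2 sH0)); [apply: (proj2 (proj2 sH0)); apply: p'0|apply: gz_sub].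
  apply/eq_invmul; apply: iH0 => //.
  by rewrite ex ey hp pp'; gs; apply: IM => //; apply: (embedding_IG cp).
have [f hf] : exists f : G -> H, forall g, G0 g -> exists t, i (j t) = p' g /\ f g = i t.
  apply: (choice (fun g h => G0 g -> exists t, i (j t) = p' g /\ h = i t)) => g.
  case: (classic (G0 g)) => [hg|ng]; last by exists one.
  have [t et] := sT _ (p'0 g hg).
  have [|s es] := sj t; first by exists g; rewrite et.
  by exists (i s) => _; exists s; rewrite es.
exists f; split; first by move=> g /hf [t [_ ->]].
split.
  move=> x y hx hy; have [t1 [e1 ->]] := hf x hx; have [t2 [e2 ->]] := hf y hy.
  have [|t3 [e3 ->]] := hf (mul x y); first exact: (proj1 (proj2 sG0)).
  by rewrite -hi; congr i; apply/ij/ii; rewrite e3 hj hi e1 e2 hp'.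
split.
  move=> x y hx hy; have [t1 [e1 ->]] := hf x hx; have [t2 [e2 ->]] := hf y hy => /ii et.
  rewrite et e2 in e1.
  apply/eq_invmul; have hxy : G0 (mul (inv x) y).
    by apply: (proj1 (proj2 sG0)) => //; apply: (proj2 (proj2 sG0)).
  apply: iG0 => //; have cxy := cG0 hxy; split=> //.
  (* If [p'] identifies [x] and [y], then [p] and [c] agree on their quotient, which therefore lies
     in [Is(G')] as well as in [G0]. *)
  apply/(isolator_reflect cp ip hN k1 hk Nk).
  have -> : p (mul (inv x) y) = c (mul (inv x) y).
    by rewrite pp' hp' (homV hp') e1; gs.
  by case: (cI (mul (inv x) y)).
move=> y hy; have [t et] := sT y hy; have [g [hg eg]] := Cj t.
exists g; split=> //; have [s [es ->]] := hf g hg.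
by rewrite -et; congr i; apply/ij/ii; rewrite es eg.
Qed.
End Addition.

Theorem mainTheorem3 (G H : group)
  (fgG : fin_gen G) (nilG : nilpotent G)
  (fgH : fin_gen H) (nilH : nilpotent H)
  (eqGH : elem_equiv G H) :
  (* (a) *)
  (exists phi : G -> H, is_hom phi /\ (forall x y, phi x = phi y -> x = y) /\
      finite_index (fun h => exists g, h = phi g)) /\
  (* (b) *)
  (forall G0 : G -> Prop, addition G0 ->
      exists H0 : H -> Prop, addition H0 /\ sub_iso G0 H0 /\
        quot_iso (allG G) G0 (allG H) H0) /\
  (* (c) *)
  sub_iso (isolator (@derived G)) (isolator (@derived H)) /\
  (* (d) *)
  quot_iso (allG G) (isolator (@derived G)) (allG H) (isolator (@derived H)) /\
  (* (e) *)
  quot_iso (isolator (setprod (@derived G) (@center G)))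
           (setprod (isolator (@derived G)) (@center G))
           (isolator (setprod (@derived H) (@center H)))
           (setprod (isolator (@derived H)) (@center H)).
Proof.
have [k [k1 hk]] := isolator_exponent (noeth_nilpotent fgH nilH) (derived_subgroup H) (fun x d => d).
have [|e [e1 he]] := isolator_exponent (noeth_nilpotent fgG nilG) (isolator_center_sub G).
  by move=> x d; apply: setprod_l; [apply: center_subgroup|apply: isolator_in].
(* [N] has to be 1 modulo [k] for lifting isolators and 1 modulo [e] for correcting [p] on
   additions; the factor 2 ensures [m > 1] even when [k = e = 1]. *)
have [|p [N [cp [ip [[q eN] hN]]]]] := transfer_embedding (m := 2 * k * e) fgG nilG fgH nilH eqGH; first nia.
have N0 : N <> 0%Z by nia.
have Nk : exists q, N = (1 + Z.of_nat k * q)%Z by exists (2 * Z.of_nat e * q)%Z; lia.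
have Ne : N = (1 + Z.of_nat e * (2 * Z.of_nat k * q))%Z by lia.
split; first by exists p; split; [case: cp|split=> //; exact: (embedding_finite_index cp N0 hN)].
split; first by move=> G0 aG0; exact: (addition_transfer fgG fgH nilH cp ip N0 hN k1 hk Nk he Ne aG0).
split; first exact: (embedding_isolator_iso cp ip hN k1 hk Nk).
split; first exact: (embedding_abelianization cp ip N0 hN k1 hk Nk fgH).
exact: (embedding_isolator_center cp ip hN k1 hk Nk).
Qed.
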